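(* Let $\alpha\in[-1,0]$ and consider on $\mathbb{T}^3\times(0,\infty)$ the problem $$\partial_t\theta+u\cdot\nabla\theta=0,\qquad u=(-\Delta)^{\alpha/2}\mathbf{M}\theta,\qquad \theta(\mathbf{x},0)=\theta_0(\mathbf{x}),$$ where $\mathbf{M}$ is the magnetogeostrophic Fourier multiplier. Fix $r>3$ and $K_0>0$. (i) If $\alpha\in(-1,0]$, fix $s\in[1,\frac{1}{\alpha+1}]$. Let $\theta_0\in G^s$ with radius $\tau_0>0$ and $\|(-\Delta)^{r/2}e^{\tau_0(-\Delta)^{1/(2s)}}\theta_0\|_{L^2}\le K_0$. Then there exist $T_*=T_*(\tau_0,K_0)>0$ and a unique solution in $G^s$ on $[0,T_* )$. (ii) If $\alpha=-1$, then for all $s\ge1$ and such $\theta_0\in G^s$ (radius $\tau_0$, bound $K_0$), there exist $T_*=T_*(\tau_0,K_0)>0$ and a unique solution in $G^s$ on $[0,T_* )$.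
   Context: $\mathbb{T}^3=[0,2\pi]^3$ periodic; functions are mean-free. $\mathbf{M}=(\mathbf{M}_1,\mathbf{M}_2,\mathbf{M}_3)$ is the Fourier multiplier with symbols, for $\mathbf{k}=(k_1,k_2,k_3)\in\mathbb{Z}^3$ with $k_3\ne0$, $\widehat{\mathbf{M}}_1(\mathbf{k})=\frac{2\Omega k_2k_3|\mathbf{k}|^2-(\beta^2/\eta)k_1k_2^2k_3}{4\Omega^2k_3^2|\mathbf{k}|^2+(\beta^2/\eta)^2k_2^4}$, $\widehat{\mathbf{M}}_2(\mathbf{k})=\frac{-2\Omega k_1k_3|\mathbf{k}|^2-(\beta^2/\eta)k_2^3k_3}{4\Omega^2k_3^2|\mathbf{k}|^2+(\beta^2/\eta)^2k_2^4}$, $\widehat{\mathbf{M}}_3(\mathbf{k})=\frac{(\beta^2/\eta)k_2^2(k_1^2+k_2^2)}{4\Omega^2k_3^2|\mathbf{k}|^2+(\beta^2/\eta)^2k_2^4}$, and $\widehat{\mathbf{M}}(k_1,k_2,0)=0$, where $\beta,\eta,\Omega>0$ are fixed constants. $(-\Delta)^{\alpha/2}$ has symbol $|\mathbf{k}|^\alpha$. For fixed $r>3$, $s\ge1$, $\tau>0$: $\|\theta\|_{G^s_\tau}^2=\sum_{\mathbf{k}\ne0}|\mathbf{k}|^{2r}e^{2\tau|\mathbf{k}|^{1/s}}|\widehat\theta(\mathbf{k})|^2$, $G^s_\tau$ the space of functions with finite norm ($\tau$ the radius), $G^s=\bigcup_{\tau>0}G^s_\tau$. *)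

(* Defs.v *)
(* Fourier-side formulation of the magnetogeostrophic
   (MG) active scalar equation on T^3 = [0,2pi]^3. *)
From HB Require Import structures.
From mathcomp Require Import all_boot all_order all_algebra.
From mathcomp Require Import complex.
From mathcomp Require Import all_classical all_reals all_analysis.
Set Implicit Arguments. Unset Strict Implicit. Unset Printing Implicit Defensive.
Import Order.TTheory GRing.Theory Num.Theory.
Import numFieldNormedType.Exports.
Local Open Scope classical_set_scope.
Local Open Scope ring_scope.

Definition Z3 := (int * int * int)%type.
Definition k1 (k : Z3) : int := k.1.1.
Definition k2 (k : Z3) : int := k.1.2.
Definition k3 (k : Z3) : int := k.2.
Definition zsub (k l : Z3) : Z3 := (k1 k - k1 l, k2 k - k2 l, k3 k - k3 l).
Definition zopp (k : Z3) : Z3 := (- k1 k, - k2 k, - k3 k).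
Definition z0 : Z3 := (0, 0, 0).

Section Defs.
Variable R : realType.

Definition knorm2 (k : Z3) : R := ((k1 k) ^+ 2 + (k2 k) ^+ 2 + (k3 k) ^+ 2)%:~R.
Definition knorm (k : Z3) : R := Num.sqrt (knorm2 k).

Definition cR (x : R) : R[i] := Complex x 0.
Definition iu : R[i] := Complex 0 1.
Definition cabs2 (z : R[i]) : R := complex.Re z ^+ 2 + complex.Im z ^+ 2.

Definition Mden (beta eta Omega : R) (k : Z3) : R :=
  4 * Omega ^+ 2 * (k3 k)%:~R ^+ 2 * knorm2 k
  + (beta ^+ 2 / eta) ^+ 2 * (k2 k)%:~R ^+ 4.
Definition M1 (beta eta Omega : R) (k : Z3) : R :=
  if k3 k == 0 then 0 else
  (2 * Omega * (k2 k)%:~R * (k3 k)%:~R * knorm2 k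
   - (beta ^+ 2 / eta) * (k1 k)%:~R * (k2 k)%:~R ^+ 2 * (k3 k)%:~R)
  / Mden beta eta Omega k.
Definition M2 (beta eta Omega : R) (k : Z3) : R :=
  if k3 k == 0 then 0 else
  (- 2 * Omega * (k1 k)%:~R * (k3 k)%:~R * knorm2 k
   - (beta ^+ 2 / eta) * (k2 k)%:~R ^+ 3 * (k3 k)%:~R)
  / Mden beta eta Omega k.
Definition M3 (beta eta Omega : R) (k : Z3) : R :=
  if k3 k == 0 then 0 else
  ((beta ^+ 2 / eta) * (k2 k)%:~R ^+ 2 * ((k1 k)%:~R ^+ 2 + (k2 k)%:~R ^+ 2))
  / Mden beta eta Omega k.

(* A function on T^3 is represented by its Fourier coefficients. *)
Definition fcoef := Z3 -> R[i].

Definition gevrey_norm2 (r s tau : R) (th : fcoef) : \bar R :=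
  (\esum_(k in [set k : Z3 | k != z0])
     (powR (knorm k) (2 * r) * expR (2 * tau * powR (knorm k) s^-1)
      * cabs2 (th k))%:E)%E.

Definition mean_free (th : fcoef) : Prop := th z0 = 0.
Definition real_valued (th : fcoef) : Prop :=
  forall k, complex.Re (th (zopp k)) = complex.Re (th k) /\ complex.Im (th (zopp k)) = - complex.Im (th k).

Definition zrange (N : nat) : seq int := [seq (i%:Z - N%:Z) | i <- iota 0 (N.*2.+1)].
Definition boxseq (N : nat) : seq Z3 :=
  [seq (ab.1, ab.2, c) | ab <- [seq (a, b) | a <- zrange N, b <- zrange N],
                         c <- zrange N].
Definition series_to (F : Z3 -> R[i]) (v : R[i]) : Prop :=
  (fun N : nat => complex.Re (\sum_(l <- boxseq N) F l)) @ \oo --> complex.Re v /\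
  (fun N : nat => complex.Im (\sum_(l <- boxseq N) F l)) @ \oo --> complex.Im v.

(* Fourier coefficient of the summand of (u . grad theta)^(k), with
   u = (-Delta)^{alpha/2} M theta:
   i (u^(k-l) . l) theta^(l),  u^(j) = |j|^alpha M^(j) theta^(j). *)
Definition transport_term (alpha beta eta Omega : R) (th : fcoef) (k l : Z3) : R[i] :=
  let j := zsub k l in
  iu * cR (powR (knorm j) alpha *
           (M1 beta eta Omega j * (k1 l)%:~R + M2 beta eta Omega j * (k2 l)%:~R
            + M3 beta eta Omega j * (k3 l)%:~R))
     * th j * th l.

Definition MG_solution_Gs (alpha beta eta Omega r s T : R)
    (th0 : fcoef) (th : R -> fcoef) : Prop :=
  [/\ th 0 = th0,
      (forall t, 0 <= t < T -> mean_free (th t)),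
      (forall T', 0 < T' < T -> exists tau, exists B : R, 0 < tau /\
         forall t, 0 <= t <= T' -> (gevrey_norm2 r s tau (th t) <= B%:E)%E),
      (forall k, (fun t => complex.Re (th t k)) t @[t --> 0^'+] --> complex.Re (th0 k) /\
                 (fun t => complex.Im (th t k)) t @[t --> 0^'+] --> complex.Im (th0 k)) &
      (forall t, 0 < t < T -> forall k, exists v : R[i],
         series_to (transport_term alpha beta eta Omega (th t) k) v /\
         is_derive t (1 : R) (fun t' => complex.Re (th t' k)) (- complex.Re v) /\
         is_derive t (1 : R) (fun t' => complex.Im (th t' k)) (- complex.Im v))].

End Defs.

(* Main.v *)
(** Write [rho] for [1/s]. Since the velocity is divergence free, its symbol satisfies
    [|j|^alpha |M(j).l| <= (3/Omega) |j|^(alpha+1) min(|l|, |j+l|)], and both cases of the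
    theorem say that [0 <= alpha+1 <= rho <= 1].  In the energy
    [sum_k |k|^10 e^(2 tau |k|^rho) |theta(k)|^2] the transport term is antisymmetric up to the
    commutator of the weight.  By subadditivity of [x^rho] this commutator costs only the
    factors [|k|^(rho/2) |l|^(rho/2)], which the term produced by letting [tau] decrease
    linearly in time absorbs.  The power 10 is convenient; any other power, in particular [2 r],
    is traded for an arbitrarily small loss of radius.

    Existence: explicit Euler steps for the Galerkin truncation to the box of size [N], with a
    step small enough for the energy to remain bounded up to an error 1, and a limit of all
    Fourier coefficients along an ultrafilter.  A second order Taylor bound, uniform in [N],
    passes to the limit and yields the derivative in time.

    Uniqueness: the same mechanism for the energy with weight [e^(2 tau |k|^rho)] of the
    difference of two solutions.  Truncating it to a box makes it a finite sum, at the price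
    of an error [O(1/N)] in its derivative. *)
Require Import Defs.
From HB Require Import structures.
From mathcomp Require Import all_boot all_order all_algebra.
From mathcomp Require Import complex.
From mathcomp Require Import all_classical all_reals all_analysis.
From mathcomp Require Import ring lra zify.
Import Order.TTheory GRing.Theory Num.Theory.
Import numFieldNormedType.Exports ComplexField.Normc.
Local Open Scope classical_set_scope.
Local Open Scope ring_scope.
Set Implicit Arguments. Unset Strict Implicit. Unset Printing Implicit Defensive.

(** The obstacle is the loss of derivatives. [M] can grow like [|j|], so when [alpha + 1 = rho] the
    velocity alone costs [|j|^rho], which is all that a shrinking radius can repay; the gradient in
    [u . grad theta] must not be paid for as well. Divergence-freeness moves it to the lower of the
    two outer frequencies, where the increment of the weight cancels it: if [y <= x <= y + d], then
    [y * (x^rho - y^rho) <= d * y^rho]. Every product is then arranged as one l^1 factor and two l^2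
    factors. The power 10 is tuned to this: [|k|^2 |theta|] is [|k|^(-3)] times [|k|^5 |theta|], and
    [|k|^(-6)] is summable over Z^3. For the difference [w = v - u] of two solutions, the term
    [w . grad v] has no antisymmetry, but its gradient falls on [v], whose stronger energy is
    already bounded. Only [u . grad w] uses antisymmetry, and this asks reality of [u] alone; the
    competing solution [v] may be complex valued. *)

(** * Frequencies and cubic boxes in Z^3 *)

Lemma zsub_injl (k : Z3) : injective (zsub k).
Proof.
move=> [[a b] c] [[a' b'] c']; rewrite /zsub /k1 /k2 /k3 /= => -[ha hb hc].
by congr (_, _, _); lia.
Qed.

Lemma zsub_injr (l : Z3) : injective (zsub ^~ l).
Proof.
move=> [[a b] c] [[a' b'] c']; rewrite /zsub /k1 /k2 /k3 /= => -[ha hb hc].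
by congr (_, _, _); lia.
Qed.

Lemma zoppK : involutive zopp.
Proof. by move=> [[a b] c]; rewrite /zopp /k1 /k2 /k3 /= !opprK. Qed.

Lemma zopp_sub (k l : Z3) : zopp (zsub k l) = zsub l k.
Proof. by rewrite /zopp /zsub /k1 /k2 /k3 /= !opprB. Qed.

Lemma zsub_opp (k l : Z3) : zsub (zopp k) (zopp l) = zopp (zsub k l).
Proof. by rewrite /zopp /zsub /k1 /k2 /k3 /=; congr (_, _, _); lia. Qed.

Lemma mem_zrange (N : nat) (a : int) : (a \in zrange N) = (`|a| <= N%:Z).
Proof.
apply/mapP/idP => [[j]|ha].
  by rewrite mem_iota add0n => hj ->; lia.
exists (absz (a + N%:Z)); last by lia.
by rewrite mem_iota add0n; lia.
Qed.

Lemma uniq_zrange (N : nat) : uniq (zrange N).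
Proof. by rewrite map_inj_uniq ?iota_uniq // => i j; lia. Qed.

Lemma mem_boxseq (N : nat) (k : Z3) :
  (k \in boxseq N) = [&& `|k1 k| <= N%:Z, `|k2 k| <= N%:Z & `|k3 k| <= N%:Z].
Proof.
rewrite -!mem_zrange; case: k => [[a b] c]; rewrite /k1 /k2 /k3.
apply/allpairsP/and3P => [[p [/allpairsP[q [h1 h2 hq]] h3]]|[ha hb hc]].
  by rewrite hq => -[-> -> ->].
by exists ((a, b), c); split => //; apply/allpairsP; exists (a, b).
Qed.

Lemma uniq_boxseq (N : nat) : uniq (boxseq N).
Proof.
rewrite allpairs_uniq ?uniq_zrange //.
  by rewrite allpairs_uniq ?uniq_zrange // => -[a b] [a' b'] _ _ /= [-> ->].
by move=> [[a b] c] [[a' b'] c'] _ _ /= [-> -> ->].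
Qed.

Lemma zopp_boxseq (N : nat) (k : Z3) : (zopp k \in boxseq N) = (k \in boxseq N).
Proof. by rewrite !mem_boxseq /zopp /k1 /k2 /k3 /= !normrN. Qed.

Lemma boxseq_mono (M N : nat) : (M <= N)%N -> {subset boxseq M <= boxseq N}.
Proof. by move=> MN k; rewrite !mem_boxseq => /and3P[h1 h2 h3]; apply/and3P; split; lia. Qed.

Lemma in_boxseq_near (k : Z3) : \forall N \near \oo, k \in boxseq N.
Proof.
exists (absz (k1 k) + absz (k2 k) + absz (k3 k))%N => // N /= hN.
by rewrite mem_boxseq; apply/and3P; split; lia.
Qed.

Lemma sub_boxseq (s : seq Z3) : exists N, {subset s <= boxseq N}.
Proof.
elim: s => [|k s [N hN]]; first by exists 0%N.
have [M _ hM] := in_boxseq_near k.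
exists (maxn M N) => l; rewrite inE => /orP[/eqP ->|/hN hl].
  by apply: hM => /=; rewrite leq_maxl.
by apply: boxseq_mono hl; rewrite leq_maxr.
Qed.

(** * The Euclidean norm on frequencies *)

Section Lattice.
Variable R : realType.
Local Notation nm := (@knorm R).

Lemma knorm2_ge0 (k : Z3) : 0 <= knorm2 R k.
Proof. by rewrite /knorm2 ler0z !addr_ge0 // sqr_ge0. Qed.

Lemma knorm_ge0 (k : Z3) : 0 <= nm k. Proof. exact: sqrtr_ge0. Qed.

Lemma sqr_knorm (k : Z3) : nm k ^+ 2 = knorm2 R k.
Proof. by rewrite sqr_sqrtr // knorm2_ge0. Qed.

Lemma sqr_knormE (k : Z3) :
  nm k ^+ 2 = (k1 k)%:~R ^+ 2 + (k2 k)%:~R ^+ 2 + (k3 k)%:~R ^+ 2.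
Proof. by rewrite sqr_knorm /knorm2 !intrD !rmorphXn. Qed.

Lemma knorm0 : nm z0 = 0.
Proof. by rewrite /knorm /knorm2 /k1 /k2 /k3 /= expr0n !addr0 sqrtr0. Qed.

Lemma knormN (k : Z3) : nm (zopp k) = nm k.
Proof. by rewrite /knorm /knorm2 /zopp /k1 /k2 /k3 /= !sqrrN. Qed.

Lemma knorm_subC (k l : Z3) : nm (zsub k l) = nm (zsub l k).
Proof. by rewrite -zopp_sub knormN. Qed.

Lemma le_k1 (k : Z3) : `|(k1 k)%:~R : R| <= nm k.
Proof.
rewrite -ler_sqr ?nnegrE ?knorm_ge0 // real_normK ?num_real // sqr_knormE.
by rewrite -addrA lerDl addr_ge0 ?sqr_ge0.
Qed.

Lemma le_k2 (k : Z3) : `|(k2 k)%:~R : R| <= nm k.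
Proof.
rewrite -ler_sqr ?nnegrE ?knorm_ge0 // real_normK ?num_real // sqr_knormE.
by rewrite addrAC lerDr addr_ge0 ?sqr_ge0.
Qed.

Lemma le_k3 (k : Z3) : `|(k3 k)%:~R : R| <= nm k.
Proof.
rewrite -ler_sqr ?nnegrE ?knorm_ge0 // real_normK ?num_real // sqr_knormE.
by rewrite lerDr addr_ge0 ?sqr_ge0.
Qed.

Lemma knorm_ge1 (k : Z3) : k != z0 -> 1 <= nm k.
Proof.
move=> k0; rewrite -(@ler_sqr R) ?nnegrE ?knorm_ge0 // sqr_knorm expr1n /knorm2.
rewrite -[1]/(1%:~R) ler_int.
have h (x : int) : x != 0 -> 1 <= x ^+ 2 by nia.
have h2 (x : int) : 0 <= x ^+ 2 by nia.
have := h2 (k1 k); have := h2 (k2 k); have := h2 (k3 k).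
case: (eqVneq (k1 k) 0) => [e1|/h]; last by lia.
case: (eqVneq (k2 k) 0) => [e2|/h]; last by lia.
case: (eqVneq (k3 k) 0) => [e3|/h]; last by lia.
by case/negP: k0; move: e1 e2 e3; case: k => [[a b] c]; rewrite /k1 /k2 /k3 /= => -> -> ->.
Qed.

Lemma knorm_gt0 (k : Z3) : k != z0 -> 0 < nm k.
Proof. by move/knorm_ge1; apply: lt_le_trans. Qed.

Lemma knorm_notin_box (N : nat) (k : Z3) : k \notin boxseq N -> N.+1%:R <= nm k.
Proof.
have h (x : int) : ~~ (`|x| <= N%:Z) -> N.+1%:R <= `|x%:~R : R|.
  by move=> hx; rewrite -intr_norm -[_%:R]/(N.+1%:~R) ler_int; lia.
rewrite mem_boxseq !negb_and => /or3P[] /h hk; apply: le_trans hk _.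
- exact: le_k1.
- exact: le_k2.
- exact: le_k3.
Qed.

Lemma dot3_le (a b c x y z u v : R) : 0 <= u -> 0 <= v ->
  u ^+ 2 = a ^+ 2 + b ^+ 2 + c ^+ 2 -> v ^+ 2 = x ^+ 2 + y ^+ 2 + z ^+ 2 ->
  a * x + b * y + c * z <= u * v.
Proof.
move=> u0 v0 hu hv; apply: le_trans (ler_norm _) _.
rewrite -ler_sqr ?nnegrE ?mulr_ge0 // real_normK ?num_real // exprMn hu hv.
rewrite -subr_ge0.
have -> : (a ^+ 2 + b ^+ 2 + c ^+ 2) * (x ^+ 2 + y ^+ 2 + z ^+ 2) - (a * x + b * y + c * z) ^+ 2
  = (a * y - b * x) ^+ 2 + (a * z - c * x) ^+ 2 + (b * z - c * y) ^+ 2 by ring.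
by rewrite !addr_ge0 ?sqr_ge0.
Qed.

Lemma knorm_triangle (k l : Z3) : nm k <= nm (zsub k l) + nm l.
Proof.
rewrite -ler_sqr ?nnegrE ?addr_ge0 ?knorm_ge0 //.
have h := dot3_le (knorm_ge0 (zsub k l)) (knorm_ge0 l) (sqr_knormE _) (sqr_knormE _).
rewrite sqrrD !sqr_knormE.
have -> : (k1 k)%:~R ^+ 2 + (k2 k)%:~R ^+ 2 + (k3 k)%:~R ^+ 2 =
  ((k1 (zsub k l))%:~R ^+ 2 + (k2 (zsub k l))%:~R ^+ 2 + (k3 (zsub k l))%:~R ^+ 2)
  + ((k1 (zsub k l))%:~R * (k1 l)%:~R + (k2 (zsub k l))%:~R * (k2 l)%:~R
  + (k3 (zsub k l))%:~R * (k3 l)%:~R) *+ 2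
  + ((k1 l)%:~R ^+ 2 + (k2 l)%:~R ^+ 2 + (k3 l)%:~R ^+ 2) :> R.
  rewrite /zsub /k1 /k2 /k3 /= !intrB; ring.
by rewrite lerD2r lerD2l ler_wMn2r.
Qed.

Lemma knorm_triangle_sub (k l : Z3) : nm (zsub k l) <= nm k + nm l.
Proof.
have := knorm_triangle (zsub k l) k.
have -> : zsub (zsub k l) k = zopp l.
  by rewrite /zsub /zopp /k1 /k2 /k3 /=; congr (_, _, _); lia.
by rewrite knormN addrC.
Qed.

Lemma knorm_triangle_r (k l : Z3) : nm l <= nm (zsub k l) + nm k.
Proof. by rewrite knorm_subC; exact: knorm_triangle. Qed.

End Lattice.

(** * Summable families over Z^3 and Young-type convolution bounds *)

Section FamilySums.
Variable R : realType.
Implicit Types (f g : Z3 -> R) (C : R) (s t : seq Z3).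

Lemma mul_le_half (x y : R) : x * y <= (x ^+ 2 + y ^+ 2) / 2.
Proof. by have := sqr_ge0 (x - y); rewrite sqrrB mulr2n; lra. Qed.

(* For a nonnegative family, [sumle f C] says that the (unordered) sum is at most [C]. *)
Definition sumle f C := forall s, uniq s -> \sum_(k <- s) f k <= C.

Lemma sumle_ge0 f C : sumle f C -> 0 <= C.
Proof. by move=> /(_ [::] isT); rewrite big_nil. Qed.

Lemma sumle_le f g C : (forall k, f k <= g k) -> sumle g C -> sumle f C.
Proof. by move=> fg gC s us; apply: le_trans (gC s us); apply: ler_sum => k _. Qed.

Lemma sumle_leC f C C' : C <= C' -> sumle f C -> sumle f C'.
Proof. by move=> CC fC s us; apply: le_trans (fC s us) CC. Qed.

Lemma sumleD f g C D : sumle f C -> sumle g D -> sumle (fun k => f k + g k) (C + D).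
Proof. by move=> fC gD s us; rewrite big_split lerD ?fC ?gD. Qed.

Lemma sumleZ a f C : 0 <= a -> sumle f C -> sumle (fun k => a * f k) (a * C).
Proof. by move=> a0 fC s us; rewrite -mulr_sumr ler_wpM2l ?fC. Qed.

Lemma sumle_inj h f C : injective h -> sumle f C -> sumle (f \o h) C.
Proof.
move=> hI fC s us; rewrite -(big_map h predT f); apply: fC.
by rewrite map_inj_uniq.
Qed.

Lemma sumle_pt f C k : sumle f C -> f k <= C.
Proof. by move=> /(_ [:: k] isT); rewrite big_seq1. Qed.

Lemma ler_sum_sub f s t : (forall k, 0 <= f k) -> uniq s -> uniq t ->
  {subset s <= t} -> \sum_(k <- s) f k <= \sum_(k <- t) f k.
Proof.
move=> f0 us ut st.
rewrite [leRHS](bigID (mem s)) /= -[leLHS]addr0 lerD ?sumr_ge0 //.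
rewrite -[leRHS]big_filter le_eqVlt; apply/orP; left; apply/eqP.
apply: perm_big; apply: uniq_perm => //; first exact: filter_uniq.
by move=> k; rewrite mem_filter; case: (boolP (k \in s)) => // /st ->.
Qed.

Lemma sum_sub_split (V : nmodType) (F : Z3 -> V) s t : uniq s -> uniq t ->
  {subset s <= t} ->
  \sum_(l <- t) F l = \sum_(l <- s) F l + \sum_(l <- [seq l <- t | l \notin s]) F l.
Proof.
move=> us ut st; rewrite (bigID (mem s)) /= -big_filter [in RHS]big_filter; congr (_ + _).
apply: perm_big; apply: uniq_perm => //; first exact: filter_uniq.
by move=> l; rewrite mem_filter; case: (boolP (l \in s)) => // /st ->.
Qed.

Lemma sumle_box f C : (forall k, 0 <= f k) ->
  (forall N, \sum_(k <- boxseq N) f k <= C) -> sumle f C.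
Proof.
move=> f0 fC s us; have [N sN] := sub_boxseq s.
by apply: le_trans (fC N); apply: ler_sum_sub => //; exact: uniq_boxseq.
Qed.

Lemma sumle_box_tail f C M : (forall k, 0 <= f k) ->
  sumle (fun k => if k \in boxseq M then 0 else f k) C ->
  sumle f (\sum_(k <- boxseq M) f k + C).
Proof.
move=> f0 fC s us; rewrite (bigID (mem (boxseq M))) /= lerD //.
  rewrite -big_filter; apply: ler_sum_sub => //; rewrite ?filter_uniq ?uniq_boxseq //.
  by move=> k; rewrite mem_filter => /andP[].
rewrite big_mkcond; apply: le_trans (fC s us).
by apply: ler_sum => k _; case: (k \in boxseq M).
Qed.

(** Chebyshev's argument: outside the box the factor [knorm] is at least [M + 1]. *)
Lemma sumle_tail f C M : (forall k, 0 <= f k) ->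
  sumle (fun k => knorm R k * f k) C ->
  sumle (fun k => if k \in boxseq M then 0 else f k) (C / M.+1%:R).
Proof.
move=> f0 fC s us; rewrite ler_pdivlMr ?ltr0n // mulr_suml.
apply: le_trans (fC s us); apply: ler_sum => k _.
case: ifP => [_|/negbT/(knorm_notin_box R) hk].
  by rewrite mul0r mulr_ge0 ?knorm_ge0.
by rewrite mulrC ler_wpM2r.
Qed.

(** Young's inequality for one l^1 and two l^2 factors. Products of the l^2 factors are bounded by
    half the sum of squares instead of by Cauchy-Schwarz; all applications have [c = d], so nothing
    is lost. The variants below place the l^1 factor at the outer frequency, the inner one, or their
    difference. *)
Lemma sum_conv_base s t (f : Z3 -> R) (A B : Z3 -> Z3 -> R) b c d :
  uniq s -> (forall k, 0 <= f k) -> sumle f b ->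
  (forall x, \sum_(y <- t) A x y ^+ 2 <= c) ->
  (forall x, \sum_(y <- t) B x y ^+ 2 <= d) ->
  \sum_(x <- s) \sum_(y <- t) f x * A x y * B x y <= b * ((c + d) / 2).
Proof.
move=> us f0 fb hA hB.
have cd0 : 0 <= (c + d) / 2.
  rewrite divr_ge0 // addr_ge0 //.
    by apply: le_trans (hA z0); apply: sumr_ge0 => y _; exact: sqr_ge0.
  by apply: le_trans (hB z0); apply: sumr_ge0 => y _; exact: sqr_ge0.
apply: (@le_trans _ _ (\sum_(x <- s) f x * ((c + d) / 2))); last first.
  by rewrite -mulr_suml ler_wpM2r // fb.
apply: ler_sum => x _; under eq_bigr do rewrite -mulrA.
rewrite -mulr_sumr ler_wpM2l //.
apply: (@le_trans _ _ (\sum_(y <- t) (A x y ^+ 2 + B x y ^+ 2) / 2)).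
  by apply: ler_sum => y _; exact: mul_le_half.
by rewrite -mulr_suml ler_wpM2r ?invr_ge0 // big_split lerD.
Qed.

Lemma sum_conv_outer s t f g h b c d : uniq s -> uniq t ->
  (forall k, 0 <= f k) -> sumle f b ->
  sumle (fun k => g k ^+ 2) c -> sumle (fun k => h k ^+ 2) d ->
  \sum_(k <- s) \sum_(l <- t) f k * g (zsub k l) * h l <= b * ((c + d) / 2).
Proof.
move=> us ut f0 fb gc hd; apply: sum_conv_base => //.
  by move=> x; apply: (sumle_inj (@zsub_injl x) gc).
by move=> x; apply: hd.
Qed.

Lemma sum_conv_inner s t f g h b c d : uniq s -> uniq t ->
  (forall k, 0 <= f k) -> sumle f b ->
  sumle (fun k => g k ^+ 2) c -> sumle (fun k => h k ^+ 2) d ->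
  \sum_(k <- s) \sum_(l <- t) f l * g (zsub k l) * h k <= b * ((c + d) / 2).
Proof.
move=> us ut f0 fb gc hd; rewrite exchange_big; apply: sum_conv_base => //.
  by move=> x; apply: (sumle_inj (@zsub_injr x) gc).
by move=> x; apply: hd.
Qed.

Lemma sum_conv_diff s t f g h b c d : uniq s -> uniq t ->
  (forall k, 0 <= f k) -> sumle f b ->
  sumle (fun k => g k ^+ 2) c -> sumle (fun k => h k ^+ 2) d ->
  \sum_(k <- s) \sum_(l <- t) f (zsub k l) * g k * h l <= b * ((c + d) / 2).
Proof.
move=> us ut f0 fb gc hd.
have b0 := sumle_ge0 fb.
apply: (@le_trans _ _ (\sum_(k <- s) \sum_(l <- t)
   (f (zsub k l) * (g k ^+ 2 / 2) + f (zsub k l) * (h l ^+ 2 / 2)))).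
  apply: ler_sum => k _; apply: ler_sum => l _.
  by rewrite -mulrDr -mulrA ler_wpM2l // -mulrDl; exact: mul_le_half.
under eq_bigr do rewrite big_split /=.
rewrite big_split /= mulrDl mulrDr lerD //.
  under eq_bigr do rewrite -mulr_suml.
  apply: (@le_trans _ _ (\sum_(k <- s) b * (g k ^+ 2 / 2))).
    apply: ler_sum => k _; rewrite ler_wpM2r ?divr_ge0 ?sqr_ge0 //.
    exact: (sumle_inj (@zsub_injl k) fb).
  by rewrite -mulr_sumr ler_wpM2l // -mulr_suml ler_wpM2r ?invr_ge0 ?gc.
rewrite exchange_big /=.
under eq_bigr do rewrite -mulr_suml.
apply: (@le_trans _ _ (\sum_(k <- t) b * (h k ^+ 2 / 2))).
  apply: ler_sum => k _; rewrite ler_wpM2r ?divr_ge0 ?sqr_ge0 //.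
  exact: (sumle_inj (@zsub_injr k) fb).
by rewrite -mulr_sumr ler_wpM2l // -mulr_suml ler_wpM2r ?invr_ge0 ?hd.
Qed.

Lemma sum_conv1 s t f g b c : uniq s -> uniq t ->
  (forall k, 0 <= f k) -> (forall k, 0 <= g k) -> sumle f b -> sumle g c ->
  \sum_(k <- s) \sum_(l <- t) f (zsub k l) * g l <= b * c.
Proof.
move=> us ut f0 g0 fb gc; rewrite exchange_big /=.
under eq_bigr do rewrite -mulr_suml.
apply: (@le_trans _ _ (\sum_(l <- t) b * g l)).
  apply: ler_sum => l _; rewrite ler_wpM2r //.
  exact: (sumle_inj (@zsub_injr l) fb).
by rewrite -mulr_sumr ler_wpM2l ?gc // (sumle_ge0 fb).
Qed.

Lemma esum_sumle (f : Z3 -> R) C : (forall k, 0 <= f k) ->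
  (\esum_(k in [set k : Z3 | k != z0]) (f k)%:E <= C%:E)%E <->
  sumle (fun k => if k != z0 then f k else 0) C.
Proof.
move=> f0; split => [h s us|h].
  rewrite -lee_fin; apply: le_trans h; rewrite -big_mkcond /= -big_filter.
  apply: esum_ge; exists [set` [seq k <- s | k != z0]].
    split; first exact: finite_seq.
    by move=> k /=; rewrite mem_filter => /andP[].
  by rewrite -fsbig_seq ?filter_uniq // sumEFin.
apply: ge_ereal_sup => _ [A [finA AS] <-].
rewrite fsbig_finite //= sumEFin lee_fin.
apply: le_trans (h _ (finmap.fset_uniq (fset_set A))).
rewrite big_seq [leRHS]big_seq; apply: ler_sum => k.
by rewrite in_fset_set // inE => /AS /= ->.
Qed.

(** The correction [4 / (N + 1)] makes the induction telescope: the two new terms contribute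
    [2 / (1 + x^2) <= 4 / x - 4 / (x + 1)]. *)
Lemma sum_zrange_recip (N : nat) :
  \sum_(a <- zrange N) (1 + (a%:~R : R) ^+ 2)^-1 <= 5 - 4 / N.+1%:R.
Proof.
have perm n : perm_eq (zrange n.+1) (n.+1%:Z :: - n.+1%:Z :: zrange n).
  apply: uniq_perm => [||a]; first exact: uniq_zrange.
    by rewrite 2!cons_uniq uniq_zrange in_cons !mem_zrange; lia.
  by rewrite mem_zrange 2!in_cons mem_zrange; lia.
elim: N => [|n IH].
  by rewrite /zrange /= big_seq1 subrr expr0n addr0 !invr1; lra.
have -> : \sum_(a <- zrange n.+1) (1 + (a%:~R : R) ^+ 2)^-1 =
    2 * (1 + n.+1%:R ^+ 2)^-1 + \sum_(a <- zrange n) (1 + a%:~R ^+ 2)^-1.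
  by rewrite (perm_big _ (perm n)) 2!big_cons rmorphN sqrrN mulrDl !mul1r -addrA.
set x : R := n.+1%:R in IH *.
have -> : n.+2%:R = x + 1 :> R by rewrite -natr1.
have x1 : 1 <= x by rewrite ler1n.
have h : (1 + x ^+ 2)^-1 <= 2 / (x * (x + 1)).
  rewrite ler_pdivlMr ?mulr_gt0; [|lra..].
  rewrite mulrC ler_pdivrMr; nra.
have e : 4 / x - 4 / (x + 1) = 2 * (2 / (x * (x + 1))) by field; apply/andP; split; lra.
move: IH h e; set a := _^-1; set b := 2 / _; set c := 4 / x; set d := 4 / _.
by move=> *; lra.
Qed.

(** Each of the three factors is at most [2 |k|^2]. The product form lets the lattice sum split into
    three sums over the integers. *)
Lemma knorm6_ge (k : Z3) : k != z0 ->
  (1 + (k1 k)%:~R ^+ 2) * (1 + (k2 k)%:~R ^+ 2) * (1 + (k3 k)%:~R ^+ 2) <= 8 * knorm R k ^+ 6.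
Proof.
move=> /(knorm_ge1 R) h.
have hn : 1 <= knorm R k ^+ 2 by rewrite exprn_ege1.
have -> : knorm R k ^+ 6 = (knorm R k ^+ 2) ^+ 3 by rewrite -exprM.
have := sqr_knormE R k; move: hn; move: (knorm R k ^+ 2) => y y1 hy.
have -> : 8 * y ^+ 3 = (2 * y) * (2 * y) * (2 * y) by ring.
have h1 := sqr_ge0 ((k1 k)%:~R : R); have h2 := sqr_ge0 ((k2 k)%:~R : R).
have h3 := sqr_ge0 ((k3 k)%:~R : R).
by rewrite !ler_pM ?mulr_ge0 //; lra.
Qed.

Lemma sumle_knorm6 : sumle (fun k => if k != z0 then (knorm R k ^+ 6)^-1 else 0) 1000.
Proof.
pose q (a : int) : R := (1 + a%:~R ^+ 2)^-1.
have q0 a : 0 <= q a by rewrite invr_ge0 addr_ge0 ?sqr_ge0.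
apply: (@sumle_le _ (fun k => 8 * (q (k1 k) * q (k2 k) * q (k3 k)))) => [k|].
  case: ifP => [k0|_]; last by rewrite !mulr_ge0.
  rewrite -!invfM ler_pdivlMr; last by rewrite !mulr_gt0 ?ltr_pwDl ?sqr_ge0.
  by rewrite mulrC ler_pdivrMr ?knorm6_ge // exprn_gt0 // knorm_gt0.
(* Here 8 is the constant of [knorm6_ge], and each of the three one-dimensional sums is at most
   5. *)
have -> : 1000 = 8 * (5 * 5 * 5) :> R by ring.
apply: sumleZ => //; apply: sumle_box => [k|N]; first by rewrite !mulr_ge0.
have hq : \sum_(a <- zrange N) q a <= 5.
  apply: le_trans (sum_zrange_recip N) _.
  by rewrite gerBl divr_ge0.
have -> : \sum_(k <- boxseq N) q (k1 k) * q (k2 k) * q (k3 k) =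
    \sum_(a <- zrange N) \sum_(b <- zrange N) \sum_(c <- zrange N) q a * q b * q c.
  rewrite (@big_allpairs_dep _ _ _ (int * int)%type (fun=> int) Z3
    (fun ab c => (ab.1, ab.2, c)) _ (fun=> zrange N)).
  exact: (@big_allpairs_dep _ _ _ int (fun=> int) (int * int)%type pair _ (fun=> zrange N)).
under eq_bigr do under eq_bigr do rewrite -mulr_sumr.
under eq_bigr do rewrite -mulr_suml -mulr_sumr.
rewrite -!mulr_suml !ler_pM ?mulr_ge0 ?sumr_ge0 //.
Qed.

End FamilySums.

(** * Real inequalities for powers, exponentials and Gevrey weights *)

Section ScalarBounds.
Variable R : realType.
Implicit Types (x y d t rho gam p : R).

Lemma ler_of_eq x y : x = y -> x <= y. Proof. by move=> ->. Qed.

Lemma powR_half_sqr x rho : 0 < x -> (x `^ (rho / 2)) ^+ 2 = x `^ rho.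
Proof.
move=> x0; rewrite expr2 -powRD; last by rewrite (gt_eqF x0) implybT.
by congr (_ `^ _); lra.
Qed.

Lemma powR_ge1 x p : 1 <= x -> 0 <= p -> 1 <= x `^ p.
Proof. by move=> x1 p0; rewrite -(powRr0 x); exact: ler_powR. Qed.

Lemma powR_le_id x rho : 1 <= x -> rho <= 1 -> x `^ rho <= x.
Proof. by move=> x1 r1; exact: ler1_powR. Qed.

(** On [[0, 1]] one has [a <= a^rho]; this is applied to the fractions [y / (y + d)] and
    [d / (y + d)], which add up to 1. *)
Lemma powR_subadd x y d rho : 0 <= rho -> rho <= 1 -> 1 <= x -> 1 <= y -> 1 <= d ->
  x <= y + d -> x `^ rho <= y `^ rho + d `^ rho.
Proof.
move=> r0 r1 x1 y1 d1 xyd.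
apply: (@le_trans _ _ ((y + d) `^ rho)).
  by apply: ge0_ler_powR => //; rewrite nnegrE; lra.
have z0 : 0 < y + d by lra.
have h a : 0 < a -> a <= y + d -> a / (y + d) * (y + d) `^ rho <= a `^ rho.
  move=> a0 az.
  have -> : a `^ rho = (a / (y + d)) `^ rho * (y + d) `^ rho.
    by rewrite -powRM ?divr_ge0 ?divfK ?gt_eqF // ltW.
  rewrite ler_wpM2r ?powR_ge0 // ger1_powR //.
  by rewrite divr_gt0 // ler_pdivrMr // mul1r.
apply: le_trans (lerD (h y _ _) (h d _ _)); try lra.
by rewrite -mulrDl -mulrDl divff ?mul1r // gt_eqF.
Qed.

(** The ratio [x / y] is at least 1, so its power [rho] is at most the ratio itself. The factor [y]
    in front is the gradient at the lower frequency. *)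
Lemma powR_increment x y d rho : 0 <= rho -> rho <= 1 -> 1 <= y -> y <= x ->
  x <= y + d -> y * (x `^ rho - y `^ rho) <= d * y `^ rho.
Proof.
move=> r0 r1 y1 yx xyd; have y0 : 0 < y by lra.
have -> : x `^ rho = (x / y) `^ rho * y `^ rho.
  by rewrite -powRM ?divr_ge0 ?divfK ?gt_eqF //; lra.
have h : (x / y) `^ rho <= x / y.
  by apply: powR_le_id => //; rewrite ler_pdivlMr // mul1r.
rewrite -[X in _ - X]mul1r -mulrBl mulrA ler_wpM2r ?powR_ge0 //.
apply: (@le_trans _ _ (y * (x / y - 1))); first by rewrite ler_wpM2l ?lerD2r // ltW.
by rewrite mulrBr mulrCA divff ?gt_eqF // !mulr1; lra.
Qed.

Lemma expR_increment (a b : R) : expR a - expR b <= (a - b) * expR a.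
Proof.
have -> : expR b = expR (b - a) * expR a by rewrite -expRD subrK.
have := expR_ge1Dx (b - a); have := expR_ge0 a; nra.
Qed.

Section Commutator.
Variables (rho gam t x y d : R).
Hypotheses (rho0 : 0 < rho) (rho1 : rho <= 1) (gam0 : 0 <= gam) (gamrho : gam <= rho).
Hypotheses (t0 : 0 <= t) (y1 : 1 <= y) (yx : y <= x) (d1 : 1 <= d).
Hypotheses (xyd : x <= y + d) (dxy : d <= x + y).
Local Notation g a := (powR a rho).
Local Notation h a := (powR a (rho / 2)).
Local Notation Xi := (expR (t * (g x + g y + g d))).

Local Ltac push_hyps := move: rho0 rho1 gam0 gamrho t0 y1 yx d1 xyd dxy => *.
Local Ltac slra := push_hyps; lra.
Local Ltac snra := push_hyps; nra.

Let x1 : 1 <= x. Proof. exact: le_trans yx. Qed.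
Let hge1 a : 1 <= a -> 1 <= h a. Proof. by move=> a1; apply: powR_ge1 => //; slra. Qed.
Let hsqr a : 1 <= a -> h a ^+ 2 = g a. Proof. by move=> a1; apply: powR_half_sqr; slra. Qed.
Let hle : h y <= h x. Proof. by apply: ge0_ler_powR; rewrite ?nnegrE; slra. Qed.

(** By subadditivity [2 g x <= g x + g y + g d]: the full weight at [x] is distributed as one half
    weight on each of the three frequencies. *)
Let exp_le : expR (2 * t * g x) <= Xi.
Proof.
rewrite ler_expR.
have := powR_subadd (ltW rho0) rho1 x1 y1 d1 xyd.
snra.
Qed.

(** The increment costs [d * g y], and [g y = h y ^+ 2 <= h x * h y] shares this cost between the
    two outer frequencies, half a power each. *)
Lemma exp_commutator :
  y * (expR (2 * t * g x) - expR (2 * t * g y)) <= 2 * t * d * (h x * h y) * Xi.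
Proof.
have := expR_increment (2 * t * g x) (2 * t * g y).
rewrite -mulrBr => /(ler_wpM2l (ltW (lt_le_trans ltr01 y1))) /le_trans; apply.
have -> : y * (2 * t * (g x - g y) * expR (2 * t * g x)) =
  2 * t * (y * (g x - g y)) * expR (2 * t * g x) by ring.
apply: ler_pM; rewrite ?expR_ge0 ?exp_le //.
  rewrite !mulr_ge0 //; first slra; rewrite subr_ge0.
  by apply: ge0_ler_powR; rewrite ?nnegrE //; slra.
rewrite -[leRHS]mulrA ler_wpM2l ?mulr_ge0 //.
apply: le_trans (powR_increment (ltW rho0) rho1 y1 yx xyd) _.
rewrite ler_wpM2l //; first slra.
by rewrite -hsqr // expr2 ler_wpM2r //; have := hge1 y1; slra.
Qed.

Let gam_le_d : d `^ gam <= d.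
Proof. by apply: powR_le_id => //; slra. Qed.

(** For the terms in which the velocity is the rough factor: of [g d = h d ^+ 2] one half stays at
    [d], and the other moves to [x] because [d <= 2 * x]. *)
Let gam_le_h : d `^ gam <= 2 * (h d * h x).
Proof.
apply: (@le_trans _ _ (g d)); first exact: ler_powR.
rewrite -hsqr // expr2 mulrCA ler_wpM2l //; first by have := hge1 d1; slra.
apply: (@le_trans _ _ (h (2 * x))).
  by apply: ge0_ler_powR; rewrite ?nnegrE //; slra.
rewrite powRM //; last slra.
rewrite ler_wpM2r ?powR_ge0 //; apply: powR_le_id; slra.
Qed.

Lemma exp_commutator_gam :
  d `^ gam * (y * (expR (2 * t * g x) - expR (2 * t * g y)))
  <= 2 * t * d ^+ 2 * (h x * h y) * Xi.
Proof.
apply: le_trans (ler_wpM2l (powR_ge0 _ _) exp_commutator) _.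
have -> : 2 * t * d ^+ 2 * (h x * h y) * Xi = d * (2 * t * d * (h x * h y) * Xi) by ring.
by rewrite ler_wpM2r ?gam_le_d // !mulr_ge0 ?powR_ge0 ?expR_ge0 //; slra.
Qed.

(** Of the nine powers of [x] left by the factorization, five stay at [x]. The other four go to the
    larger of [y] and [d], as [x] is at most twice that; hence [160 = 10 * 2^4]. In either term two
    frequencies end up with five powers each, which is what [Zs] carries. *)
Let pow10_commutator :
  y * (x ^+ 10 - y ^+ 10) <= 160 * (d * x ^+ 5 * y ^+ 5) + 160 * (d ^+ 5 * x ^+ 5 * y).
Proof.
have x0 : 0 <= x by slra. have y0 : 0 <= y by slra. have d0 : 0 <= d by slra.
have h9 : x ^+ 10 - y ^+ 10 <= 10 * (d * x ^+ 9).
  rewrite subrXX mulrCA; apply: ler_pM; [slra| |slra|].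
    by apply: sumr_ge0 => i _; rewrite mulr_ge0 ?exprn_ge0.
  apply: (@le_trans _ _ (\sum_(i < 10) x ^+ 9)); last first.
    by rewrite sumr_const card_ord -[leLHS]mulr_natl.
  apply: ler_sum => i _.
  have e : (10 - i.+1 + i = 9)%N by rewrite subSS subnK // -ltnS.
  have -> : x ^+ 9 = x ^+ (10 - i.+1) * x ^+ i by rewrite -exprD e.
  by rewrite ler_wpM2l ?exprn_ge0 // lerXn2r.
apply: le_trans (ler_wpM2l y0 h9) _.
have -> : y * (10 * (d * x ^+ 9)) = 10 * (d * x ^+ 5 * y) * x ^+ 4 by ring.
have [dy|yd] := leP d y.
  have h4 : x ^+ 4 <= 16 * y ^+ 4.
    have -> : 16 * y ^+ 4 = (2 * y) ^+ 4 by ring.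
    by rewrite lerXn2r ?nnegrE //; slra.
  apply: (@le_trans _ _ (10 * (d * x ^+ 5 * y) * (16 * y ^+ 4))).
    by rewrite ler_wpM2l ?mulr_ge0 ?exprn_ge0.
  rewrite -[leLHS]addr0 lerD ?mulr_ge0 ?exprn_ge0 //.
  by apply: ler_of_eq; ring.
have h4 : x ^+ 4 <= 16 * d ^+ 4.
  have -> : 16 * d ^+ 4 = (2 * d) ^+ 4 by ring.
  by rewrite lerXn2r ?nnegrE //; slra.
apply: (@le_trans _ _ (10 * (d * x ^+ 5 * y) * (16 * d ^+ 4))).
  by rewrite ler_wpM2l ?mulr_ge0 ?exprn_ge0.
rewrite -[leLHS]add0r lerD ?mulr_ge0 ?exprn_ge0 //.
by apply: ler_of_eq; ring.
Qed.

Let weight_commutator_aux :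
  d `^ gam * (y * (x ^+ 10 * expR (2 * t * g x) - y ^+ 10 * expR (2 * t * g y)))
  <= ((160 + 2 * t) * (d ^+ 2 * (h x * x ^+ 5) * (h y * y ^+ 5))
      + 320 * ((h d * d ^+ 5) * (h x * x ^+ 5) * y)) * Xi.
Proof.
have x0 : 0 <= x by slra. have y0 : 0 <= y by slra. have d0 : 0 <= d by slra.
set e1 := expR (2 * t * g x); set e2 := expR (2 * t * g y).
(* Discrete product rule: increment of the power with the exponential at [x], plus increment of the
   exponential with the power at [y]. *)
have -> : d `^ gam * (y * (x ^+ 10 * e1 - y ^+ 10 * e2)) =
  d `^ gam * (y * (x ^+ 10 - y ^+ 10)) * e1 + y ^+ 10 * (d `^ gam * (y * (e1 - e2))).
  by ring.
have hx := hge1 x1; have hy := hge1 y1; have hd := hge1 d1.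
have hx0 : 0 <= h x by slra. have hy0 : 0 <= h y by slra. have hd0 : 0 <= h d by slra.
have -> : ((160 + 2 * t) * (d ^+ 2 * (h x * x ^+ 5) * (h y * y ^+ 5))
      + 320 * ((h d * d ^+ 5) * (h x * x ^+ 5) * y)) * Xi =
  (160 * (d ^+ 2 * (h x * x ^+ 5) * (h y * y ^+ 5))
      + 320 * ((h d * d ^+ 5) * (h x * x ^+ 5) * y)) * Xi +
  (x ^+ 5 * y ^+ 5) * (2 * t * d ^+ 2 * (h x * h y) * Xi) by ring.
apply: lerD; last first.
  apply: (@le_trans _ _ (y ^+ 10 * (2 * t * d ^+ 2 * (h x * h y) * Xi))).
    by rewrite ler_wpM2l ?exprn_ge0 //; exact: exp_commutator_gam.
  rewrite ler_wpM2r ?mulr_ge0 ?exprn_ge0 ?expR_ge0 //.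
  have -> : y ^+ 10 = y ^+ 5 * y ^+ 5 by ring.
  by rewrite ler_wpM2r ?exprn_ge0 // lerXn2r.
apply: ler_pM; rewrite ?expR_ge0 ?exp_le //.
  rewrite !mulr_ge0 ?powR_ge0 // subr_ge0.
  by rewrite lerXn2r.
apply: (@le_trans _ _ (d `^ gam * (160 * (d * x ^+ 5 * y ^+ 5)) +
                      d `^ gam * (160 * (d ^+ 5 * x ^+ 5 * y)))).
  by rewrite -mulrDr ler_wpM2l ?powR_ge0 //; exact: pow10_commutator.
apply: lerD.
  apply: (@le_trans _ _ (d * (160 * (d * x ^+ 5 * y ^+ 5)))).
    by rewrite ler_wpM2r ?mulr_ge0 ?exprn_ge0.
  have -> : d * (160 * (d * x ^+ 5 * y ^+ 5)) = 160 * (d ^+ 2 * x ^+ 5 * y ^+ 5) by ring.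
  rewrite ler_wpM2l //.
  have -> : d ^+ 2 * (h x * x ^+ 5) * (h y * y ^+ 5) = (h x * h y) * (d ^+ 2 * x ^+ 5 * y ^+ 5) by ring.
  rewrite -[leLHS]mul1r ler_wpM2r ?mulr_ge0 ?exprn_ge0 //.
  exact: mulr_ege1.
apply: (@le_trans _ _ (2 * (h d * h x) * (160 * (d ^+ 5 * x ^+ 5 * y)))).
  by rewrite ler_wpM2r ?mulr_ge0 ?exprn_ge0.
by apply: ler_of_eq; ring.
Qed.

(** A single [K] covers both [160 + 2 * t] and [320]. Stated as an inequality on [K], it can be
    fixed at the largest radius and reused while the radius shrinks. *)
Lemma weight_commutator_gam K : 320 + 2 * t <= K ->
  d `^ gam * (y * (x ^+ 10 * expR (2 * t * g x) - y ^+ 10 * expR (2 * t * g y)))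
  <= K * (d ^+ 2 * (h x * x ^+ 5) * (h y * y ^+ 5)
          + (h d * d ^+ 5) * (h x * x ^+ 5) * y) * Xi.
Proof.
move=> hK; apply: le_trans weight_commutator_aux _; apply: (ler_wpM2r (expR_ge0 _)).
have x0 : 0 <= x by slra. have y0 : 0 <= y by slra. have d0 : 0 <= d by slra.
have hx := powR_ge0 x (rho / 2); have hy := powR_ge0 y (rho / 2).
have hd := powR_ge0 d (rho / 2).
rewrite mulrDr; apply: lerD; apply: (@ler_wpM2r R).
- by rewrite !mulr_ge0 ?exprn_ge0.
- by slra.
- by rewrite !mulr_ge0 ?exprn_ge0.
- by slra.
Qed.

End Commutator.

Lemma exp_direct rho gam t (j k l : R) : 0 < rho -> rho <= 1 -> 0 <= gam -> gam <= rho ->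
  0 <= t -> 1 <= j -> 1 <= k -> 1 <= l -> j <= k + l -> k <= j + l ->
  j `^ gam * expR (2 * t * k `^ rho) <=
  2 * (j `^ (rho / 2) * k `^ (rho / 2) * l) * expR (t * (j `^ rho + k `^ rho + l `^ rho)).
Proof.
move=> r0 r1 g0 gr t0 j1 k1 l1 jkl kjl.
apply: ler_pM; rewrite ?powR_ge0 ?expR_ge0 //; last first.
  rewrite ler_expR; have := powR_subadd (ltW r0) r1 k1 j1 l1 kjl; nra.
apply: (@le_trans _ _ (j `^ rho)); first exact: ler_powR.
rewrite -[j `^ rho]powR_half_sqr; last lra.
have -> (a b c : R) : 2 * (a * b * c) = a * (2 * b * c) by ring.
rewrite expr2 ler_wpM2l ?powR_ge0 //.
apply: (@le_trans _ _ (k `^ (rho / 2) + l `^ (rho / 2))).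
  by apply: powR_subadd => //; lra.
have hk : 1 <= k `^ (rho / 2) by apply: powR_ge1 => //; lra.
have hl : l `^ (rho / 2) <= l by apply: powR_le_id => //; lra.
nra.
Qed.

Lemma exprn_le_expR n (y d : R) : 0 < d -> 0 <= y ->
  y ^+ n.+1 <= (n.+1)`!%:R / d ^+ n.+1 * expR (d * y).
Proof.
move=> d0 y0.
have dy : 0 <= d * y by rewrite mulr_ge0 // ltW.
have h : (d * y) ^+ n.+1 / n.+1`!%:R <= expR (d * y).
  by have := expR_ge1Dxn n dy; lra.
rewrite mulrAC ler_pdivlMr ?exprn_gt0 // mulrC -exprMn.
by rewrite [leRHS]mulrC -ler_pdivrMr // ltr0n fact_gt0.
Qed.

(** The device that trades a power for radius: [n + 1] exceeds [p / rho], and one term of the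
    exponential series dominates. *)
Lemma powR_le_expR rho p d : 0 < rho -> 0 < d ->
  exists2 c : R, 0 < c & forall x, 1 <= x -> x `^ p <= c * expR (d * x `^ rho).
Proof.
move=> r0 d0; pose n := Num.truncn (Num.max 0 (p / rho)).
exists ((n.+1)`!%:R / d ^+ n.+1).
  by rewrite divr_gt0 ?exprn_gt0 // ltr0n fact_gt0.
move=> x x1; apply: le_trans (exprn_le_expR n d0 (powR_ge0 _ _)).
rewrite -powR_mulrn ?powR_ge0 // -powRrM; apply: ler_powR => //.
rewrite mulrC -ler_pdivrMr //.
have h : 0 <= Num.max 0 (p / rho) by rewrite le_max lexx.
have := truncnS_gt (Num.max 0 (p / rho)); rewrite -/n => /ltW; apply: le_trans.
by rewrite le_max lexx orbT.
Qed.

End ScalarBounds.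

(** * Modulus and real part of complex coefficients *)

Section ComplexModulus.
Variable R : realType.
Implicit Types z w : R[i].
Local Notation normc := (@normc R).

Lemma normc_ge0 z : 0 <= normc z.
Proof. by case: z => a b; exact: sqrtr_ge0. Qed.

Lemma sqr_normc_cabs2 z : normc z ^+ 2 = cabs2 z.
Proof. by case: z => a b; rewrite /cabs2 /= sqr_sqrtr // addr_ge0 ?sqr_ge0. Qed.

Lemma cabs2_ge0 z : 0 <= cabs2 z.
Proof. by rewrite -sqr_normc_cabs2 sqr_ge0. Qed.

Lemma normcC z : normc (conjc z) = normc z.
Proof. by case: z => a b; rewrite /= sqrrN. Qed.

Lemma ler_normcD z w : normc (z + w) <= normc z + normc w.
Proof. exact: le_normcD. Qed.

Lemma normcB_le z w : normc (z - w) <= normc z + normc w.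
Proof. by apply: le_trans (ler_normcD _ _) _; rewrite normcN. Qed.

Lemma ler_Re_normc z : `|complex.Re z| <= normc z.
Proof.
rewrite -ler_sqr ?nnegrE ?normc_ge0 // sqr_normc_cabs2 real_normK ?num_real //.
by rewrite lerDl sqr_ge0.
Qed.

Lemma ler_Im_normc z : `|complex.Im z| <= normc z.
Proof.
rewrite -ler_sqr ?nnegrE ?normc_ge0 // sqr_normc_cabs2 real_normK ?num_real //.
by rewrite lerDr sqr_ge0.
Qed.

Lemma normc_cR (a : R) : normc (cR a) = `|a|.
Proof. by rewrite /cR /= expr0n addr0 sqrtr_sqr. Qed.

Lemma normc_iu : normc (iu R) = 1.
Proof. by rewrite /iu /= expr0n add0r expr1n sqrtr1. Qed.

Lemma normc_sum (I : Type) (s : seq I) (F : I -> R[i]) :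
  normc (\sum_(x <- s) F x) <= \sum_(x <- s) normc (F x).
Proof.
elim: s => [|x s IH]; first by rewrite !big_nil normc0.
by rewrite !big_cons; apply: le_trans (ler_normcD _ _) _; rewrite lerD2l.
Qed.

Lemma Re_sum (I : Type) (s : seq I) (F : I -> R[i]) :
  complex.Re (\sum_(x <- s) F x) = \sum_(x <- s) complex.Re (F x).
Proof. by elim/big_rec2: _ => // x y z _ <-; case: (F x) => ? ?; case: z. Qed.

Lemma complexP z w : complex.Re z = complex.Re w -> complex.Im z = complex.Im w -> z = w.
Proof. by case: z => a b; case: w => c d /= -> ->. Qed.

Lemma real_valuedP (th : fcoef R) : real_valued th <-> (forall k, th (zopp k) = conjc (th k)).
Proof.
split=> h k; last by rewrite h; case: (th k).
by have := h k; case: (th (zopp k)) => c d; case: (th k) => a b /= [-> ->].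
Qed.

(** The adjoint of multiplication by [i a u] is multiplication by [- i a] times the conjugate of
    [u]. *)
Lemma Re_trilinear_swap (a : R) (u v w : R[i]) :
  complex.Re (conjc v * (iu R * cR a * conjc u * w)) =
  - complex.Re (conjc w * (iu R * cR a * u * v)).
Proof. by case: u => u1 u2; case: v => v1 v2; case: w => w1 w2 /=; ring. Qed.

End ComplexModulus.

(** * The symbol of the nonlinearity: parity, divergence-freeness, size *)

Section TransportCoefficient.
Variables (R : realType) (alpha beta eta Omega : R).
Local Notation normc := (@normc R).
Local Notation nm := (@knorm R).

(* [i * acoef j l] is the symbol of the bilinear term, with [j] the frequency of the velocity. *)
Definition acoef (j l : Z3) : R :=
  powR (nm j) alpha *
  (M1 beta eta Omega j * (k1 l)%:~R + M2 beta eta Omega j * (k2 l)%:~R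
   + M3 beta eta Omega j * (k3 l)%:~R).

Lemma transport_termE (th : fcoef R) (k l : Z3) :
  transport_term alpha beta eta Omega th k l =
  iu R * cR (acoef (zsub k l) l) * th (zsub k l) * th l.
Proof. by []. Qed.

Lemma knorm2N (k : Z3) : knorm2 R (zopp k) = knorm2 R k.
Proof. by rewrite -!sqr_knorm knormN. Qed.

(** The multipliers have even symbols, so a real scalar generates a real velocity. *)
Lemma acoefNl (j l : Z3) : acoef (zopp j) l = acoef j l.
Proof.
rewrite /acoef knormN /M1 /M2 /M3 /Mden knorm2N /zopp /k1 /k2 /k3 /= oppr_eq0.
case: (eqVneq j.2 0) => _ //; rewrite !rmorphN /=.
by congr (_ * (_ / _ * _ + _ / _ * _ + _ / _ * _)); ring.
Qed.

Lemma acoefNr (j l : Z3) : acoef j (zopp l) = - acoef j l.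
Proof. by rewrite /acoef /zopp /k1 /k2 /k3 /= !rmorphN /=; ring. Qed.

(** This is [M(j) . j = 0], the divergence-freeness of the velocity. *)
Lemma acoef_diag (j : Z3) : acoef j j = 0.
Proof.
rewrite /acoef /M1 /M2 /M3; case: ifP => _; first by rewrite !mul0r !addr0 mulr0.
by move: (Mden _ _ _ _)^-1 => D; ring.
Qed.

(** Since [zsub k l] is orthogonal to the velocity at that frequency, the gradient may be read at
    [k] or at [l], whichever is smaller. *)
Lemma acoef_zsub (k l : Z3) : acoef (zsub k l) k = acoef (zsub k l) l.
Proof.
have := acoef_diag (zsub k l); rewrite /acoef {3 5 7}/zsub /k1 /k2 /k3 /= !rmorphB /=.
by move=> h; apply/eqP; rewrite -subr_eq0 -[X in _ == X]h; apply/eqP; ring.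
Qed.

Lemma acoef0 (l : Z3) : acoef z0 l = 0.
Proof. by rewrite /acoef /M1 /M2 /M3 eqxx !mul0r !addr0 mulr0. Qed.

Lemma acoef_to0 (l : Z3) : acoef (zsub z0 l) l = 0.
Proof. by rewrite -acoef_zsub /acoef /z0 /k1 /k2 /k3 /= !mulr0 !addr0 mulr0. Qed.

Hypotheses (beta0 : 0 < beta) (eta0 : 0 < eta) (Omega0 : 0 < Omega).

(** One estimate for two components: [(u, v)] is [(k2, k1)] for [M1] and [(- k1, k2)] for [M2], with
    [b = k2] and [c = k3]. Half of the [Omega] part of the denominator absorbs the first term, as
    [|c| >= 1]. The rest absorbs the second by [x * y <= 2 * x^2 + y^2] with [x = Omega * |c| * n]
    and [y = G * b^2], so that [G] drops out of the bound. *)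
Lemma symbol_bound (G b c n u v : R) : 0 < G -> 1 <= n -> 1 <= `|c| ->
  `|u| <= n -> `|v| <= n ->
  `|2 * Omega * u * c * n ^+ 2 - G * v * b ^+ 2 * c| <=
  Omega^-1 * n * (4 * Omega ^+ 2 * c ^+ 2 * n ^+ 2 + G ^+ 2 * b ^+ 4).
Proof.
move: Omega0 => O0 G0 n1 c1 un vn.
have n0 : 0 <= n by lra. have On := ltW O0. have Gn := ltW G0.
apply: le_trans (ler_normB _ _) _.
have -> : `|2 * Omega * u * c * n ^+ 2| = 2 * Omega * `|u| * `|c| * n ^+ 2.
  by rewrite normrM (ger0_norm (sqr_ge0 n)) !normrM normr_nat (ger0_norm On).
have -> : `|G * v * b ^+ 2 * c| = G * `|v| * b ^+ 2 * `|c|.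
  by rewrite !(normrM _ c) (normrM _ (b ^+ 2)) (ger0_norm (sqr_ge0 b)) normrM (ger0_norm Gn).
have -> : c ^+ 2 = `|c| ^+ 2 by rewrite real_normK ?num_real.
move: (`|c|) c1 => {}c c1; move: (`|u|) (normr_ge0 u) un => {}u u0 un.
move: (`|v|) (normr_ge0 v) vn => {}v v0 vn.
have -> : Omega^-1 * n * (4 * Omega ^+ 2 * c ^+ 2 * n ^+ 2 + G ^+ 2 * b ^+ 4) =
  2 * Omega * n * c ^+ 2 * n ^+ 2 +
  Omega^-1 * n * (2 * Omega ^+ 2 * c ^+ 2 * n ^+ 2 + G ^+ 2 * b ^+ 4).
  by field; rewrite gt_eqF.
have c0 : 0 <= c by lra.
apply: lerD.
  rewrite ler_wpM2r ?exprn_ge0 //.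
  have h1 : 2 * Omega * u <= 2 * Omega * n by rewrite ler_wpM2l ?mulr_ge0.
  have h2 : c <= c ^+ 2 by rewrite expr2 ler_peMl.
  by apply: ler_pM; rewrite ?mulr_ge0.
apply: (@le_trans _ _ (Omega^-1 * n * (Omega * c * n * (G * b ^+ 2)))).
  have -> : Omega^-1 * n * (Omega * c * n * (G * b ^+ 2)) = n * n * (G * b ^+ 2 * c).
    by field; rewrite gt_eqF.
  have -> : G * v * b ^+ 2 * c = v * (G * b ^+ 2 * c) by ring.
  rewrite ler_wpM2r ?(mulr_ge0 (mulr_ge0 Gn (sqr_ge0 b)) c0) //.
  by apply: le_trans vn _; rewrite ler_peMl.
rewrite ler_wpM2l ?mulr_ge0 ?invr_ge0 //.
have -> : 2 * Omega ^+ 2 * c ^+ 2 * n ^+ 2 + G ^+ 2 * b ^+ 4 =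
  2 * (Omega * c * n) ^+ 2 + (G * b ^+ 2) ^+ 2 by ring.
have x0 : 0 <= Omega * c * n by rewrite !mulr_ge0.
have y0 : 0 <= G * b ^+ 2 by rewrite mulr_ge0 ?sqr_ge0.
move: (Omega * c * n) (G * b ^+ 2) x0 y0 => x y x0 y0; nra.
Qed.

(** With [x = Omega * n] and [y = G * b^2], the numerator is at most [Omega^-1 * n * x * y]. Because
    [|c| >= 1], the denominator is at least [4 * x^2 + y^2]. *)
Lemma M3_bound (G a b c n : R) : 0 < G -> 1 <= n -> 1 <= `|c| ->
  n ^+ 2 = a ^+ 2 + b ^+ 2 + c ^+ 2 ->
  `|G * b ^+ 2 * (a ^+ 2 + b ^+ 2)| <=
  Omega^-1 * n * (4 * Omega ^+ 2 * c ^+ 2 * n ^+ 2 + G ^+ 2 * b ^+ 4).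
Proof.
move: Omega0 => O0 G0 n1 c1 hn.
have n0 : 0 <= n by lra. have On := ltW O0. have Gn := ltW G0.
rewrite ger0_norm; last exact: mulr_ge0 (mulr_ge0 Gn (sqr_ge0 b)) (addr_ge0 (sqr_ge0 a) (sqr_ge0 b)).
have hab : a ^+ 2 + b ^+ 2 <= n ^+ 2 by rewrite hn lerDl sqr_ge0.
apply: (@le_trans _ _ (G * b ^+ 2 * n ^+ 2)).
  by rewrite ler_wpM2l // (mulr_ge0 Gn (sqr_ge0 b)).
have c2 : 1 <= c ^+ 2 by rewrite -[c ^+ 2]real_normK ?num_real // exprn_ege1.
have -> : G * b ^+ 2 * n ^+ 2 = Omega^-1 * n * ((G * b ^+ 2) * (Omega * n)).
  by field; rewrite gt_eqF.
rewrite ler_wpM2l ?mulr_ge0 ?invr_ge0 //.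
have -> : 4 * Omega ^+ 2 * c ^+ 2 * n ^+ 2 + G ^+ 2 * b ^+ 4 =
  4 * (Omega * n) ^+ 2 * c ^+ 2 + (G * b ^+ 2) ^+ 2 by ring.
have x0 : 0 <= Omega * n by rewrite !mulr_ge0.
have y0 : 0 <= G * b ^+ 2 by rewrite mulr_ge0 ?sqr_ge0.
move: (Omega * n) (G * b ^+ 2) x0 y0 => x y x0 y0.
apply: (@le_trans _ _ (4 * x ^+ 2 * 1 + y ^+ 2)); first by nra.
by rewrite lerD2r ler_wpM2l // mulr_ge0 ?sqr_ge0.
Qed.

Lemma acoef_bound (j l : Z3) : j != z0 ->
  `|acoef j l| <= 3 / Omega * nm j `^ (alpha + 1) * nm l.
Proof.
move=> j0; move: beta0 eta0 Omega0 => b0 e0 O0.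
have n1 := knorm_ge1 R j0.
have G0 : 0 < beta ^+ 2 / eta by rewrite divr_gt0 ?exprn_gt0.
rewrite /acoef normrM ger0_norm ?powR_ge0 //.
rewrite powRD ?powRr1 ?knorm_ge0 //; last by rewrite (gt_eqF (knorm_gt0 R j0)) implybT.
have -> : 3 / Omega * (nm j `^ alpha * nm j) * nm l =
  nm j `^ alpha * (Omega^-1 * nm j * nm l + Omega^-1 * nm j * nm l + Omega^-1 * nm j * nm l) by ring.
rewrite ler_wpM2l ?powR_ge0 //.
have [c0|c0] := eqVneq (k3 j) 0.
  rewrite /M1 /M2 /M3 c0 eqxx !mul0r !addr0 normr0.
  by rewrite !addr_ge0 // !mulr_ge0 ?invr_ge0 ?knorm_ge0 // ltW.
have c1 : 1 <= `|(k3 j)%:~R : R|.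
  by rewrite -intr_norm -[1]/(1%:~R) ler_int; lia.
have D0 : 0 < Mden beta eta Omega j.
  rewrite /Mden -sqr_knorm ltr_pwDl //; last first.
    by apply: mulr_ge0; [exact: sqr_ge0|exact: exprn_even_ge0].
  have c2 : 0 < (k3 j)%:~R ^+ 2 :> R by rewrite exprn_even_gt0 //= intr_eq0.
  have O2 : 0 < 4 * Omega ^+ 2 by rewrite mulr_gt0 // exprn_gt0.
  exact: mulr_gt0 (mulr_gt0 O2 c2) (exprn_gt0 _ (knorm_gt0 R j0)).
have hD (num x y : R) :
  `|num| <= Omega^-1 * nm j * Mden beta eta Omega j -> `|x| <= y ->
  `|num / Mden beta eta Omega j * x| <= Omega^-1 * nm j * y.
  move=> hnum hx; rewrite !normrM; apply: ler_pM; rewrite ?mulr_ge0 //.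
  by rewrite normfV (gtr0_norm D0) ler_pdivrMr.
apply: le_trans (ler_normD _ _) _; apply: lerD.
  apply: le_trans (ler_normD _ _) _; apply: lerD.
    rewrite /M1 (negbTE c0); apply: hD; last exact: le_k1.
    rewrite /Mden -sqr_knorm.
    by apply: (@symbol_bound _ _ (k3 j)%:~R (nm j) (k2 j)%:~R (k1 j)%:~R); rewrite ?le_k1 ?le_k2.
  rewrite /M2 (negbTE c0); apply: hD; last exact: le_k2.
  have -> : - 2 * Omega * (k1 j)%:~R * (k3 j)%:~R * knorm2 R j
     - beta ^+ 2 / eta * (k2 j)%:~R ^+ 3 * (k3 j)%:~R =
    2 * Omega * (- (k1 j)%:~R) * (k3 j)%:~R * knorm2 R j
     - beta ^+ 2 / eta * (k2 j)%:~R * (k2 j)%:~R ^+ 2 * (k3 j)%:~R by ring.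
  rewrite /Mden -sqr_knorm.
  by apply: symbol_bound; rewrite ?normrN ?le_k1 ?le_k2.
rewrite /M3 (negbTE c0); apply: hD; last exact: le_k3.
by rewrite /Mden -sqr_knorm; apply: M3_bound => //; exact: sqr_knormE.
Qed.

End TransportCoefficient.

(** * Commutator bounds as products of weighted amplitudes *)

Section ScalarPairs.
Variable R : realType.
Implicit Types (rho gam t j k l x xj xk xl : R).

(** Three ways of weighting an amplitude [x] at frequency size [n]. Squares of [Zs] add up to the
    dissipation produced by a shrinking radius; [Bs] is the l^1 factor; [Vs] replaces [Zs] for the
    energy without a power. *)
Definition Zs rho t n x : R := n `^ (rho / 2) * n ^+ 5 * expR (t * n `^ rho) * x.
Definition Bs rho t n x : R := n ^+ 2 * expR (t * n `^ rho) * x.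
Definition Vs rho t n x : R := n `^ (rho / 2) * expR (t * n `^ rho) * x.

Lemma Zs_ge0 rho t n x : 0 <= n -> 0 <= x -> 0 <= Zs rho t n x.
Proof. by move=> n0 x0; rewrite !mulr_ge0 ?powR_ge0 ?exprn_ge0 ?expR_ge0. Qed.

Lemma Bs_ge0 rho t n x : 0 <= x -> 0 <= Bs rho t n x.
Proof. by move=> x0; apply: mulr_ge0 x0; apply: mulr_ge0 (expR_ge0 _); exact: sqr_ge0. Qed.

Lemma Vs_ge0 rho t n x : 0 <= x -> 0 <= Vs rho t n x.
Proof. by move=> x0; rewrite !mulr_ge0 ?powR_ge0 ?expR_ge0. Qed.

Lemma le_Bs rho t n x : 1 <= n -> 0 <= x -> n * expR (t * n `^ rho) * x <= Bs rho t n x.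
Proof.
move=> n1 x0; rewrite /Bs ler_wpM2r // ler_wpM2r ?expR_ge0 // expr2 ler_peMl //.
exact: le_trans n1.
Qed.

Section Hyps.
Variables (rho gam t : R).
Hypotheses (rho0 : 0 < rho) (rho1 : rho <= 1) (gam0 : 0 <= gam) (gamrho : gam <= rho).
Hypotheses (t0 : 0 <= t).
Variable K : R.
Hypothesis hK : 320 + 2 * t <= K.

Let K0 : 0 <= K. Proof. by apply: le_trans hK; rewrite addr_ge0 ?mulr_ge0 ?ler0n. Qed.

Let expg_mono k l : 0 <= k -> k <= l -> expR (2 * t * k `^ rho) <= expR (2 * t * l `^ rho).
Proof.
move=> k0 kl; rewrite ler_expR ler_wpM2l ?mulr_ge0 // ge0_ler_powR ?nnegrE //.
  exact: ltW.
exact: le_trans kl.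
Qed.

Let weight_mono k l : 0 <= k -> k <= l ->
  k ^+ 10 * expR (2 * t * k `^ rho) <= l ^+ 10 * expR (2 * t * l `^ rho).
Proof.
move=> k0 kl; apply: ler_pM; [exact: exprn_ge0|exact: expR_ge0| |exact: expg_mono].
by rewrite lerXn2r ?nnegrE // (le_trans k0).
Qed.

Let weight_pair_le j k l xj xk xl : 1 <= j -> 1 <= l -> l <= k -> k <= l + j -> j <= k + l ->
  0 <= xj -> 0 <= xk -> 0 <= xl ->
  j `^ gam * (Num.min k l *
    `|k ^+ 10 * expR (2 * t * k `^ rho) - l ^+ 10 * expR (2 * t * l `^ rho)|) * (xj * (xk * xl))
  <= K * (Bs rho t j xj * Zs rho t k xk * Zs rho t l xl
          + Bs rho t l xl * Zs rho t j xj * Zs rho t k xk).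
Proof.
move=> j1 l1 lk klj jkl xj0 xk0 xl0.
have l0 : 0 <= l by exact: le_trans l1.
have k0 : 0 <= k by exact: le_trans lk.
have j0 : 0 <= j by exact: le_trans j1.
rewrite min_r // ger0_norm; last by rewrite subr_ge0 weight_mono.
have key := weight_commutator_gam rho0 rho1 gam0 gamrho t0 l1 lk j1 klj jkl hK.
have q0 : 0 <= xj * (xk * xl) by apply: mulr_ge0 => //; exact: mulr_ge0.
apply: le_trans (ler_wpM2r q0 key) _.
have hB := le_Bs rho t l1 xl0.
have hZ : 0 <= Zs rho t j xj * Zs rho t k xk by apply: mulr_ge0; exact: Zs_ge0.
have := ler_wpM2r hZ hB.
have -> : Bs rho t l xl * (Zs rho t j xj * Zs rho t k xk) =
  Bs rho t l xl * Zs rho t j xj * Zs rho t k xk by ring.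
move: (Bs rho t l xl * Zs rho t j xj * Zs rho t k xk) => M hM.
apply: (@le_trans _ _ (K * (Bs rho t j xj * Zs rho t k xk * Zs rho t l xl +
  l * expR (t * l `^ rho) * xl * (Zs rho t j xj * Zs rho t k xk)))).
  apply: ler_of_eq; rewrite /Bs /Zs !mulrDr !expRD.
  move: (expR (t * j `^ rho)) (expR (t * k `^ rho)) (expR (t * l `^ rho)) => ej ek el.
  move: (j `^ (rho / 2)) (k `^ (rho / 2)) (l `^ (rho / 2)) => hj hk hl; ring.
by apply: (ler_wpM2l K0); rewrite lerD2l.
Qed.

(** The commutator estimate puts the larger outer frequency first. The right-hand side contains the
    terms of both orderings, so either of [k] and [l] may be the larger. *)
Lemma weight_pair j k l xj xk xl : 1 <= j -> 1 <= k -> 1 <= l ->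
  k <= l + j -> l <= k + j -> j <= k + l -> 0 <= xj -> 0 <= xk -> 0 <= xl ->
  j `^ gam * (Num.min k l *
    `|k ^+ 10 * expR (2 * t * k `^ rho) - l ^+ 10 * expR (2 * t * l `^ rho)|) * (xj * (xk * xl))
  <= K * (Bs rho t j xj * Zs rho t k xk * Zs rho t l xl
          + (Bs rho t l xl * Zs rho t j xj * Zs rho t k xk
             + Bs rho t k xk * Zs rho t j xj * Zs rho t l xl)).
Proof.
move=> j1 k1 l1 klj lkj jkl xj0 xk0 xl0.
have k0 : 0 <= k by exact: le_trans k1.
have l0 : 0 <= l by exact: le_trans l1.
have j0 : 0 <= j by exact: le_trans j1.
have M1 : 0 <= Bs rho t l xl * Zs rho t j xj * Zs rho t k xk.
  by apply: mulr_ge0; [apply: mulr_ge0; [exact: Bs_ge0|exact: Zs_ge0]|exact: Zs_ge0].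
have M2 : 0 <= Bs rho t k xk * Zs rho t j xj * Zs rho t l xl.
  by apply: mulr_ge0; [apply: mulr_ge0; [exact: Bs_ge0|exact: Zs_ge0]|exact: Zs_ge0].
have [kl|lk] := orP (le_total k l); last first.
  apply: le_trans (weight_pair_le j1 l1 lk klj jkl xj0 xk0 xl0) _.
  by apply: (ler_wpM2l K0); rewrite lerD2l lerDl.
have jlk : j <= l + k by rewrite addrC.
have := weight_pair_le j1 k1 kl lkj jlk xj0 xl0 xk0.
rewrite (minC l k).
have dC (u v : R) : `|u - v| = `|v - u| by exact: distrC.
rewrite (dC (l ^+ 10 * _)).
rewrite (mulrC xl xk).
rewrite (mulrAC (Bs rho t j xj) (Zs rho t l xl) (Zs rho t k xk)) => /le_trans; apply.
by apply: (ler_wpM2l K0); rewrite lerD2l lerDr.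
Qed.

Let exp_pair_le j k l xj xk xl : 1 <= j -> 1 <= l -> l <= k -> k <= l + j -> j <= k + l ->
  0 <= xj -> 0 <= xk -> 0 <= xl ->
  j `^ gam * (Num.min k l *
    `|expR (2 * t * k `^ rho) - expR (2 * t * l `^ rho)|) * (xj * (xk * xl))
  <= 2 * t * (Bs rho t j xj * Vs rho t k xk * Vs rho t l xl).
Proof.
move=> j1 l1 lk klj jkl xj0 xk0 xl0.
have l0 : 0 <= l by exact: le_trans l1.
rewrite min_r // ger0_norm; last by rewrite subr_ge0 expg_mono.
have key := exp_commutator_gam rho0 rho1 gam0 gamrho t0 l1 lk j1 klj jkl.
have q0 : 0 <= xj * (xk * xl) by apply: mulr_ge0 => //; exact: mulr_ge0.
apply: le_trans (ler_wpM2r q0 key) _.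
apply: ler_of_eq; rewrite /Bs /Vs !mulrDr !expRD.
move: (expR (t * j `^ rho)) (expR (t * k `^ rho)) (expR (t * l `^ rho)) => ej ek el.
move: (j `^ (rho / 2)) (k `^ (rho / 2)) (l `^ (rho / 2)) => hj hk hl; ring.
Qed.

Lemma exp_pair j k l xj xk xl : 1 <= j -> 1 <= k -> 1 <= l ->
  k <= l + j -> l <= k + j -> j <= k + l -> 0 <= xj -> 0 <= xk -> 0 <= xl ->
  j `^ gam * (Num.min k l *
    `|expR (2 * t * k `^ rho) - expR (2 * t * l `^ rho)|) * (xj * (xk * xl))
  <= 2 * t * (Bs rho t j xj * Vs rho t k xk * Vs rho t l xl).
Proof.
move=> j1 k1 l1 klj lkj jkl xj0 xk0 xl0.
have [kl|lk] := orP (le_total k l); last exact: exp_pair_le.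
have jlk : j <= l + k by rewrite addrC.
have := exp_pair_le j1 k1 kl lkj jlk xj0 xl0 xk0.
rewrite (minC l k).
have dC (u v : R) : `|u - v| = `|v - u| by exact: distrC.
rewrite (dC (expR (2 * t * l `^ rho))).
rewrite (mulrC xl xk).
by rewrite (mulrAC (Bs rho t j xj) (Vs rho t l xl) (Vs rho t k xk)).
Qed.

Lemma exp_direct_pair j k l xj xk xl : 1 <= j -> 1 <= k -> 1 <= l ->
  j <= k + l -> k <= j + l -> 0 <= xj -> 0 <= xk -> 0 <= xl ->
  expR (2 * t * k `^ rho) * (j `^ gam * l) * (xj * (xl * xk)) <=
  2 * (Bs rho t l xl * Vs rho t j xj * Vs rho t k xk).
Proof.
move=> j1 k1 l1 jkl kjl xj0 xk0 xl0.
have l0 : 0 <= l by exact: le_trans l1.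
have q0 : 0 <= l * (xj * (xl * xk)) by do 3 apply: mulr_ge0 => //.
have := ler_wpM2r q0 (exp_direct rho0 rho1 gam0 gamrho t0 j1 k1 l1 jkl kjl).
have -> : expR (2 * t * k `^ rho) * (j `^ gam * l) * (xj * (xl * xk)) =
  j `^ gam * expR (2 * t * k `^ rho) * (l * (xj * (xl * xk))) by ring.
move/le_trans; apply.
apply: ler_of_eq; rewrite /Bs /Vs !mulrDr !expRD.
move: (expR (t * j `^ rho)) (expR (t * k `^ rho)) (expR (t * l `^ rho)) => ej ek el.
move: (j `^ (rho / 2)) (k `^ (rho / 2)) (l `^ (rho / 2)) => hj hk hl; ring.
Qed.

End Hyps.
End ScalarPairs.

(** * Cancellation and the trilinear energy estimate *)

Section Trilinear.
Variables (R : realType) (alpha beta eta Omega rho : R).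
Local Notation normc := (@normc R).
Local Notation nm := (@knorm R).
Local Notation a_ := (acoef alpha beta eta Omega).
Local Notation gam := (alpha + 1).
Local Notation g k := (powR (nm k) rho).
Local Notation h k := (powR (nm k) (rho / 2)).

(** Summed over [k] and [l] this is the real part of the pairing of [u . grad w] with [w], where [u]
    stands for the scalar that generates the velocity. *)
Definition skew_term (u w : fcoef R) (k l : Z3) : R :=
  complex.Re (conjc (w k) * (iu R * cR (a_ (zsub k l) l) * u (zsub k l) * w l)).

(** The swap reverses [zsub k l]. Evenness of the symbol and divergence-freeness preserve the
    coefficient, reality of [u] conjugates its value, and the adjoint rule supplies the sign. *)
Lemma skew_term_swap (u w : fcoef R) (k l : Z3) : real_valued u ->
  skew_term u w l k = - skew_term u w k l.
Proof.
move=> /real_valuedP hu; rewrite /skew_term -Re_trilinear_swap.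
by rewrite -(zopp_sub k l) acoefNl acoef_zsub hu.
Qed.

(* Antisymmetry of [skew_term] encodes the cancellation [<u . grad w, w> = 0]. *)
Lemma skew_sum (u w : fcoef R) (W : Z3 -> R) (s : seq Z3) : real_valued u ->
  \sum_(k <- s) \sum_(l <- s) W k * skew_term u w k l =
  2^-1 * \sum_(k <- s) \sum_(l <- s) (W k - W l) * skew_term u w k l.
Proof.
move=> hu; set S := LHS.
suff -> : \sum_(k <- s) \sum_(l <- s) (W k - W l) * skew_term u w k l = S + S by lra.
have {2}-> : S = \sum_(k <- s) \sum_(l <- s) - (W l * skew_term u w k l).
  rewrite /S exchange_big; apply: eq_bigr => k _; apply: eq_bigr => l _.
  by rewrite skew_term_swap // mulrN.
rewrite -big_split; apply: eq_bigr => k _; rewrite -big_split; apply: eq_bigr => l _.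
by rewrite /= mulrBl.
Qed.

Lemma skew_term_le (u w : fcoef R) (k l : Z3) :
  `|skew_term u w k l| <= `|a_ (zsub k l) l| * normc (u (zsub k l)) * normc (w k) * normc (w l).
Proof.
apply: le_trans (ler_Re_normc _) _; rewrite !normcM normcC normc_iu mul1r normc_cR.
by apply: ler_of_eq; ring.
Qed.

Definition Zfam (t : R) (X : fcoef R) (k : Z3) : R := Zs rho t (nm k) (normc (X k)).
Definition Bfam (t : R) (X : fcoef R) (k : Z3) : R := Bs rho t (nm k) (normc (X k)).
Definition Vfam (t : R) (X : fcoef R) (k : Z3) : R := Vs rho t (nm k) (normc (X k)).
Definition wt (t : R) (k : Z3) : R := nm k ^+ 10 * expR (2 * t * g k).

Lemma Zfam_ge0 t X k : 0 <= Zfam t X k.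
Proof. exact: Zs_ge0 (knorm_ge0 R k) (normc_ge0 _). Qed.
Lemma Bfam_ge0 t X k : 0 <= Bfam t X k.
Proof. exact: Bs_ge0 (normc_ge0 _). Qed.
Lemma Vfam_ge0 t X k : 0 <= Vfam t X k.
Proof. exact: Vs_ge0 (normc_ge0 _). Qed.
Lemma BVV_ge0 t X Y i k l : 0 <= Bfam t X i * Vfam t Y k * Vfam t Y l.
Proof. exact: mulr_ge0 (mulr_ge0 (Bfam_ge0 _ _ _) (Vfam_ge0 _ _ _)) (Vfam_ge0 _ _ _). Qed.
Lemma wt_ge0 t k : 0 <= wt t k.
Proof. by rewrite mulr_ge0 ?exprn_ge0 ?expR_ge0 ?knorm_ge0. Qed.

Lemma sqr_Zfam t X k : mean_free X ->
  Zfam t X k ^+ 2 = g k * (wt t k * normc (X k) ^+ 2).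
Proof.
move=> X0; have [->|k0] := eqVneq k z0.
  by rewrite /Zfam /Zs X0 normc0 expr0n /= !mulr0 expr0n.
rewrite /wt /Zfam /Zs; have -> : 2 * t * g k = t * g k + t * g k by ring.
rewrite expRD; move: (expR (t * g k)) => e.
by rewrite -(powR_half_sqr rho (knorm_gt0 R k0)); ring.
Qed.

Lemma sqr_Vfam t X k : mean_free X ->
  Vfam t X k ^+ 2 = g k * (expR (2 * t * g k) * normc (X k) ^+ 2).
Proof.
move=> X0; have [->|k0] := eqVneq k z0.
  by rewrite /Vfam /Vs X0 normc0 expr0n /= !mulr0 expr0n.
rewrite /Vfam /Vs; have -> : 2 * t * g k = t * g k + t * g k by ring.
rewrite expRD; move: (expR (t * g k)) => e.
by rewrite -(powR_half_sqr rho (knorm_gt0 R k0)); ring.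
Qed.

(** [Bfam] is the product of [|k|^(-3)] and the square root of the energy density. Half the sum of
    the squares gives the bound, 1000 being the lattice sum of [|k|^(-6)]. *)
Lemma sumle_Bfam t X E : mean_free X ->
  sumle (fun k => wt t k * normc (X k) ^+ 2) E -> sumle (Bfam t X) ((1000 + E) / 2).
Proof.
move=> X0 hE; rewrite mulrC.
apply: sumle_le (sumleZ _ (sumleD (sumle_knorm6 R) hE)); last by rewrite invr_ge0.
move=> k; case: eqVneq => [->|k0].
  by rewrite /Bfam /Bs X0 normc0 expr0n /= !mulr0 addr0 mulr0.
have n0 := knorm_gt0 R k0.
have := mul_le_half ((nm k ^+ 3)^-1) (nm k ^+ 5 * expR (t * g k) * normc (X k)).
have -> : (nm k ^+ 3)^-1 * (nm k ^+ 5 * expR (t * g k) * normc (X k)) = Bfam t X k.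
  by rewrite /Bfam /Bs; field; rewrite gt_eqF.
have -> : ((nm k ^+ 3)^-1) ^+ 2 = (nm k ^+ 6)^-1 by rewrite exprVn -exprM.
have -> : (nm k ^+ 5 * expR (t * g k) * normc (X k)) ^+ 2 = wt t k * normc (X k) ^+ 2.
  rewrite /wt; have -> : 2 * t * g k = t * g k + t * g k by ring.
  by rewrite expRD; ring.
by rewrite [leRHS]mulrC.
Qed.

Section Estimates.
Hypotheses (beta0 : 0 < beta) (eta0 : 0 < eta) (Omega0 : 0 < Omega).
Hypotheses (rho0 : 0 < rho) (rho1 : rho <= 1) (gam0 : 0 <= gam) (gamrho : gam <= rho).
Local Notation C0 := (3 / Omega).

Let C0_ge0 : 0 <= C0. Proof. by rewrite divr_ge0 // ltW. Qed.

Lemma acoef_bound_min (k l : Z3) : zsub k l != z0 ->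
  `|a_ (zsub k l) l| <= C0 * nm (zsub k l) `^ gam * Num.min (nm k) (nm l).
Proof.
move=> j0; case: (leP (nm k) (nm l)) => _; last exact: acoef_bound.
by rewrite -acoef_zsub; exact: acoef_bound.
Qed.

Let pair_bound (W : Z3 -> R) (u w : fcoef R) (k l : Z3) (r : R) :
  mean_free u -> mean_free w -> 0 <= r ->
  (zsub k l != z0 -> k != z0 -> l != z0 ->
   nm (zsub k l) `^ gam * (Num.min (nm k) (nm l) * `|W k - W l|) *
     (normc (u (zsub k l)) * (normc (w k) * normc (w l))) <= r) ->
  `|(W k - W l) * skew_term u w k l| <= C0 * r.
Proof.
move=> u0 w0 r0 hr; set j := zsub k l in hr *.
rewrite normrM; apply: le_trans (ler_wpM2l (normr_ge0 _) (skew_term_le _ _ _ _)) _.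
rewrite -/j; have rhs0 : 0 <= C0 * r by rewrite (mulr_ge0 C0_ge0).
have [j0|j0] := eqVneq j z0; first by apply: le_trans rhs0; rewrite j0 u0 normc0 ?(mul0r, mulr0).
have [k0|k0] := eqVneq k z0; first by apply: le_trans rhs0; rewrite k0 w0 normc0 ?(mul0r, mulr0).
have [l0|l0] := eqVneq l z0; first by apply: le_trans rhs0; rewrite l0 w0 normc0 ?(mul0r, mulr0).
move: hr => /(_ j0 k0 l0) /(ler_wpM2l C0_ge0); apply: le_trans.
have := acoef_bound_min j0; rewrite -/j.
have q0 : 0 <= `|W k - W l| * (normc (u j) * (normc (w k) * normc (w l))).
  by rewrite !mulr_ge0 ?normc_ge0.
move/(ler_wpM2r q0).
move: (normc (u j)) (normc (w k)) (normc (w l)) (`|W k - W l|) (Num.min _ _) (`|a_ j l|) C0 (nm j `^ gam).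
by move=> x y z v m a c p hh; apply: le_trans (le_trans _ hh) _; apply: ler_of_eq; ring.
Qed.

Let side (k l : Z3) : [/\ nm k <= nm l + nm (zsub k l), nm l <= nm k + nm (zsub k l),
  nm (zsub k l) <= nm k + nm l & nm k <= nm (zsub k l) + nm l].
Proof.
split; first by rewrite addrC; exact: knorm_triangle.
- by rewrite addrC; exact: knorm_triangle_r.
- exact: knorm_triangle_sub.
- exact: knorm_triangle.
Qed.

Lemma energy_pair (t K : R) (X : fcoef R) (k l : Z3) : 0 <= t -> 320 + 2 * t <= K ->
  mean_free X ->
  `|(wt t k - wt t l) * skew_term X X k l| <=
  C0 * (K * (Bfam t X (zsub k l) * Zfam t X k * Zfam t X l
             + (Bfam t X l * Zfam t X (zsub k l) * Zfam t X k
                + Bfam t X k * Zfam t X (zsub k l) * Zfam t X l))).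
Proof.
move=> t0 hK X0; have [s1 s2 s3 _] := side k l.
have m3 x y z : 0 <= Bfam t X x * Zfam t X y * Zfam t X z.
  exact: mulr_ge0 (mulr_ge0 (Bfam_ge0 _ _ _) (Zfam_ge0 _ _ _)) (Zfam_ge0 _ _ _).
apply: pair_bound => // [|j0 k0 l0].
  apply: mulr_ge0; first by apply: le_trans hK; rewrite addr_ge0 ?mulr_ge0 ?ler0n.
  by rewrite (addr_ge0 (m3 _ _ _)) // addr_ge0.
exact: (weight_pair rho0 rho1 gam0 gamrho t0 hK (knorm_ge1 R j0) (knorm_ge1 R k0)
  (knorm_ge1 R l0) s1 s2 s3 (normc_ge0 _) (normc_ge0 _) (normc_ge0 _)).
Qed.

(** What matters is linearity in [Z], the quantity released by a shrinking radius: a rate of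
    shrinking equal to the coefficient of [Z] closes the estimate. *)
Lemma energy_trilinear (t K E Z : R) (X : fcoef R) (s : seq Z3) : 0 <= t ->
  320 + 2 * t <= K -> uniq s -> real_valued X -> mean_free X ->
  sumle (fun k => wt t k * normc (X k) ^+ 2) E ->
  sumle (fun k => g k * (wt t k * normc (X k) ^+ 2)) Z ->
  `|\sum_(k <- s) \sum_(l <- s) wt t k * skew_term X X k l| <=
  2 * C0 * K * ((1000 + E) / 2) * Z.
Proof.
move=> t0 hK us Xr X0 hE hZ.
have hB := sumle_Bfam X0 hE.
have hZ2 : sumle (fun k => Zfam t X k ^+ 2) Z by apply: sumle_le hZ => k; rewrite sqr_Zfam.
have K0 : 0 <= K by apply: le_trans hK; rewrite addr_ge0 ?mulr_ge0 ?ler0n.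
move: (_ / 2) hB => b hB.
have b0 := sumle_ge0 hB; have Z0 := sumle_ge0 hZ.
have B0 := @Bfam_ge0 t X.
have CK0 : 0 <= C0 * K by rewrite (mulr_ge0 C0_ge0).
rewrite skew_sum // normrM ger0_norm ?invr_ge0 //.
(* Each of the three convolution sums is at most [b * Z], and antisymmetry contributes one half; the
   resulting 3/2 is rounded up to 2. *)
apply: (@le_trans _ _ (2^-1 * (C0 * K * (b * ((Z + Z) / 2) +
  (b * ((Z + Z) / 2) + b * ((Z + Z) / 2)))))); last first.
  have := mulr_ge0 CK0 (mulr_ge0 b0 Z0); lra.
rewrite ler_wpM2l ?invr_ge0 //.
apply: le_trans (ler_norm_sum _ _ _) _.
apply: (@le_trans _ _ (\sum_(k <- s) \sum_(l <- s)
  C0 * (K * (Bfam t X (zsub k l) * Zfam t X k * Zfam t X l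
             + (Bfam t X l * Zfam t X (zsub k l) * Zfam t X k
                + Bfam t X k * Zfam t X (zsub k l) * Zfam t X l))))).
  apply: ler_sum => k _; apply: le_trans (ler_norm_sum _ _ _) _.
  by apply: ler_sum => l _; exact: energy_pair.
under eq_bigr do under eq_bigr do rewrite mulrA.
under eq_bigr do rewrite -mulr_sumr big_split big_split.
rewrite -mulr_sumr big_split big_split ler_wpM2l // lerD //; first exact: sum_conv_diff.
by rewrite lerD //; [exact: sum_conv_inner | exact: sum_conv_outer].
Qed.

Lemma exp_skew_pair (t : R) (u w : fcoef R) (k l : Z3) : 0 <= t -> mean_free u -> mean_free w ->
  `|(expR (2 * t * g k) - expR (2 * t * g l)) * skew_term u w k l| <=
  C0 * (2 * t * (Bfam t u (zsub k l) * Vfam t w k * Vfam t w l)).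
Proof.
move=> t0 u0 w0; have [s1 s2 s3 _] := side k l.
apply: (@pair_bound (fun k => expR (2 * t * g k))) => // [|j0 k0 l0].
  exact: mulr_ge0 (mulr_ge0 (ler0n R 2) t0) (BVV_ge0 _ _ _ _ _ _).
exact: (exp_pair rho0 rho1 gam0 gamrho t0 (knorm_ge1 R j0) (knorm_ge1 R k0)
  (knorm_ge1 R l0) s1 s2 s3 (normc_ge0 _) (normc_ge0 _) (normc_ge0 _)).
Qed.

Lemma exp_direct_term (t : R) (v w : fcoef R) (k l : Z3) : 0 <= t ->
  mean_free v -> mean_free w ->
  expR (2 * t * g k) * (`|a_ (zsub k l) l| * (normc (w (zsub k l)) * (normc (v l) * normc (w k))))
  <= C0 * (2 * (Bfam t v l * Vfam t w (zsub k l) * Vfam t w k)).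
Proof.
move=> t0 v0 w0; have [s1 s2 s3 s4] := side k l; set j := zsub k l in s1 s2 s3 s4 *.
have rhs0 : 0 <= C0 * (2 * (Bfam t v l * Vfam t w j * Vfam t w k)).
  exact: mulr_ge0 C0_ge0 (mulr_ge0 (ler0n R 2) (BVV_ge0 _ _ _ _ _ _)).
have [j0|j0] := eqVneq j z0; first by apply: le_trans rhs0; rewrite j0 w0 normc0 ?(mul0r, mulr0).
have [k0|k0] := eqVneq k z0; first by apply: le_trans rhs0; rewrite k0 w0 normc0 ?(mul0r, mulr0).
have [l0|l0] := eqVneq l z0; first by apply: le_trans rhs0; rewrite l0 v0 normc0 ?(mul0r, mulr0).
have key := exp_direct_pair rho0 rho1 gam0 gamrho t0 (knorm_ge1 R j0) (knorm_ge1 R k0)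
  (knorm_ge1 R l0) s3 s4 (normc_ge0 (w j)) (normc_ge0 (w k)) (normc_ge0 (v l)).
apply: le_trans (ler_wpM2l C0_ge0 key).
have := @acoef_bound R alpha _ _ _ beta0 eta0 Omega0 _ l j0.
have q0 : 0 <= expR (2 * t * g k) * (normc (w j) * (normc (v l) * normc (w k))).
  by rewrite !mulr_ge0 ?normc_ge0 ?expR_ge0.
move/(ler_wpM2r q0); rewrite -/(a_ j l).
move: (normc (w j)) (normc (v l)) (normc (w k)) (expR _) (`|a_ j l|) C0 (nm j `^ gam) (nm l).
by move=> x y z e a c p n hh; apply: le_trans (le_trans _ hh) _; apply: ler_of_eq; ring.
Qed.

End Estimates.
End Trilinear.

(** * Euler steps for the Galerkin truncation and their energy *)

Section Euler.
Variables (R : realType) (alpha beta eta Omega : R).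
Local Notation normc := (@normc R).
Local Notation nm := (@knorm R).
Local Notation a_ := (acoef alpha beta eta Omega).
Local Notation C0 := (3 / Omega).

Definition Phi (s : seq Z3) (X : fcoef R) (k : Z3) : R[i] :=
  \sum_(l <- s) transport_term alpha beta eta Omega X k l.

Definition euler_step (s : seq Z3) (h : R) (X : fcoef R) : fcoef R :=
  fun k => if k \in s then X k - cR h * Phi s X k else 0.

Definition truncation (s : seq Z3) (X : fcoef R) : fcoef R :=
  fun k => if k \in s then X k else 0.

Lemma Phi_mean_free s X : Phi s X z0 = 0.
Proof.
rewrite /Phi big1 // => l _; rewrite transport_termE acoef_to0.
by rewrite /cR -[Complex 0 0]/(0 : R[i]) mulr0 !mul0r.
Qed.

Lemma euler_step_mean_free s h X : mean_free X -> mean_free (euler_step s h X).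
Proof.
by rewrite /mean_free /euler_step => ->; rewrite Phi_mean_free mulr0 subr0 if_same.
Qed.

Lemma perm_zopp_boxseq N : perm_eq [seq zopp k | k <- boxseq N] (boxseq N).
Proof.
apply: uniq_perm; rewrite ?uniq_boxseq //.
  by rewrite map_inj_uniq ?uniq_boxseq //; exact: can_inj zoppK.
move=> k; apply/mapP/idP => [[l hl ->]|hk]; first by rewrite zopp_boxseq.
by exists (zopp k); rewrite ?zopp_boxseq ?zoppK.
Qed.

Lemma Phi_conj N X k : real_valued X -> Phi (boxseq N) X (zopp k) = conjc (Phi (boxseq N) X k).
Proof.
move=> /real_valuedP hX; rewrite /Phi -(perm_big _ (perm_zopp_boxseq N)) big_map rmorph_sum.
apply: eq_bigr => l _; rewrite !transport_termE zsub_opp !hX acoefNl acoefNr !rmorphM.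
congr (_ * _ * _); rewrite /iu /cR; apply: complexP => /=; ring.
Qed.

Lemma euler_step_real N h X : real_valued X -> real_valued (euler_step (boxseq N) h X).
Proof.
move=> hX; apply/real_valuedP => k; rewrite /euler_step zopp_boxseq Phi_conj //.
move/real_valuedP: (hX) => ->; case: ifP => _; last by rewrite rmorph0.
rewrite rmorphB rmorphM; congr (_ - _ * _).
by rewrite /cR; apply: complexP => /=; rewrite ?oppr0.
Qed.

Lemma truncation_real N X : real_valued X -> real_valued (truncation (boxseq N) X).
Proof.
move=> /real_valuedP hX; apply/real_valuedP => k; rewrite /truncation zopp_boxseq hX.
by case: ifP => _ //; rewrite rmorph0.
Qed.

Lemma truncation_mean_free s X : mean_free X -> mean_free (truncation s X).
Proof. by rewrite /mean_free /truncation => ->; rewrite if_same. Qed.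

Lemma cabs2_step (h : R) (x p : R[i]) :
  cabs2 (x - cR h * p) = cabs2 x - 2 * h * complex.Re (conjc x * p) + h ^+ 2 * cabs2 p.
Proof. by case: x => a b; case: p => c d; rewrite /cabs2 /=; ring. Qed.

Lemma Re_conj_Phi s X k : complex.Re (conjc (X k) * Phi s X k) =
  \sum_(l <- s) skew_term alpha beta eta Omega X X k l.
Proof. by rewrite /Phi mulr_sumr Re_sum. Qed.

Lemma sumle_support (f : Z3 -> R) s : uniq s -> (forall k, 0 <= f k) ->
  (forall k, k \notin s -> f k = 0) -> sumle f (\sum_(k <- s) f k).
Proof.
move=> us f0 fs t ut; rewrite (bigID (mem s)) /= [X in _ + X]big1 ?addr0; last exact: fs.
rewrite -big_filter; apply: ler_sum_sub => //; first exact: filter_uniq.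
by move=> k; rewrite mem_filter => /andP[].
Qed.

Section Energy.
Hypotheses (beta0 : 0 < beta) (eta0 : 0 < eta) (Omega0 : 0 < Omega).
Variable rho : R.
Hypotheses (rho0 : 0 < rho) (rho1 : rho <= 1).
Hypotheses (gam0 : 0 <= alpha + 1) (gamrho : alpha + 1 <= rho).
Local Notation g k := (powR (nm k) rho).
Local Notation wt := (@wt R rho).

Definition energy (s : seq Z3) (t : R) (X : fcoef R) : R :=
  \sum_(k <- s) wt t k * normc (X k) ^+ 2.

Lemma wt_ge1 t k : 0 <= t -> k != z0 -> 1 <= wt t k.
Proof.
move=> t0 k0; apply: mulr_ege1; first exact: exprn_ege1 (knorm_ge1 R k0).
by rewrite -expR0 ler_expR !mulr_ge0 ?powR_ge0.
Qed.

Lemma wt_mono t t' k : t' <= t -> wt t' k <= wt t k.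
Proof.
move=> tt; rewrite ler_wpM2l ?exprn_ge0 ?knorm_ge0 //.
by rewrite ler_expR ler_wpM2r ?powR_ge0 // ler_wpM2l.
Qed.

(** By [1 + a <= e^a] the first order gain is a lower bound for finite [h], so the discrete
    dissipation comes without a remainder. *)
Lemma wt_decrease t h k : 0 <= h -> wt t k + 2 * h * (g k * wt t k) <= wt (t + h) k.
Proof.
move=> h0; have := expR_ge1Dx (2 * h * g k); have w0 := wt_ge0 rho t k.
move/(ler_wpM2r w0); rewrite mulrDl mul1r -!mulrA => /le_trans; apply.
apply: ler_of_eq; rewrite /wt.
have -> : 2 * (t + h) * g k = 2 * (h * g k) + 2 * t * g k by ring.
by rewrite expRD; ring.
Qed.

Lemma energy_ge0 s t X : 0 <= energy s t X.
Proof. by apply: sumr_ge0 => k _; rewrite mulr_ge0 ?wt_ge0 ?sqr_ge0. Qed.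

Lemma energy_sumle s t X : uniq s -> (forall k, k \notin s -> X k = 0) ->
  sumle (fun k => wt t k * normc (X k) ^+ 2) (energy s t X).
Proof.
move=> us hX; apply: sumle_support => // k; first by rewrite mulr_ge0 ?wt_ge0 ?sqr_ge0.
by move/hX ->; rewrite normc0 expr0n mulr0.
Qed.

Lemma sumle_wt_sup t X E k : 0 <= t -> mean_free X ->
  sumle (fun k => wt t k * normc (X k) ^+ 2) E -> normc (X k) ^+ 2 <= E.
Proof.
move=> t0 X0 hE; have E0 := sumle_ge0 hE.
have [->|k0] := eqVneq k z0; first by rewrite X0 normc0 expr0n.
by apply: le_trans (sumle_pt k hE); rewrite ler_peMl ?sqr_ge0 ?wt_ge1.
Qed.

(** A crude bound for the weighted norm of the truncated nonlinearity. It is not uniform in the box,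
    but it is only ever multiplied by the square of the step, which is chosen after the box. *)
Definition euler_defect (s : seq Z3) (t E : R) : R :=
  \sum_(k <- s) wt t k * (\sum_(l <- s) `|a_ (zsub k l) l| * E) ^+ 2.

Lemma euler_defect_ge0 s t E : 0 <= euler_defect s t E.
Proof. by apply: sumr_ge0 => k _; rewrite mulr_ge0 ?wt_ge0 ?sqr_ge0. Qed.

Lemma Phi_le_defect s t t1 E X : 0 <= t -> t <= t1 -> mean_free X ->
  sumle (fun k => wt t k * normc (X k) ^+ 2) E ->
  \sum_(k <- s) wt t k * normc (Phi s X k) ^+ 2 <= euler_defect s t1 E.
Proof.
move=> t0 tt1 X0 hE; apply: ler_sum => k _.
apply: ler_pM; rewrite ?wt_ge0 ?sqr_ge0 ?wt_mono //.
have E0 := sumle_ge0 hE.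
rewrite lerXn2r ?nnegrE ?normc_ge0 ?sumr_ge0 //; first by move=> l _; rewrite mulr_ge0.
apply: le_trans (normc_sum _ _) _; apply: ler_sum => l _.
rewrite transport_termE !normcM normc_iu mul1r normc_cR -mulrA ler_wpM2l //.
apply: le_trans (mul_le_half _ _) _.
have := sumle_wt_sup (zsub k l) t0 X0 hE; have := sumle_wt_sup l t0 X0 hE; lra.
Qed.

(** [mu] is the coefficient of [Z] in [energy_trilinear]. Hence the first order term of the expanded
    square is dominated by the gain [2 * (mu * h) * Z] from lowering the radius by [mu * h], and
    only the term in [h ^+ 2] is left over. *)
Lemma energy_step N (t h mu K t1 E : R) X : 0 <= t -> 0 <= h -> 0 <= t1 -> t + mu * h <= t1 ->
  320 + 2 * t1 <= K -> mu = C0 * K * (1000 + E) ->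
  real_valued X -> mean_free X -> (forall k, k \notin boxseq N -> X k = 0) ->
  energy (boxseq N) (t + mu * h) X <= E ->
  energy (boxseq N) t (euler_step (boxseq N) h X) <=
  energy (boxseq N) (t + mu * h) X + h ^+ 2 * euler_defect (boxseq N) t1 E.
Proof.
move=> t0 h0 t10 htt1 hK muE Xr X0 Xs hE; set s := boxseq N in Xs hE *.
have E0 : 0 <= E by apply: le_trans (energy_ge0 _ _ _) hE.
have O0 : 0 < Omega by exact: Omega0.
have C00 : 0 <= C0 by rewrite divr_ge0 // ltW.
have K0 : 0 <= K by apply: le_trans hK; rewrite addr_ge0 ?ler0n // mulr_ge0.
have mu0 : 0 <= mu by rewrite muE; exact: mulr_ge0 (mulr_ge0 C00 K0) (addr_ge0 (ler0n R 1000) E0).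
have muh0 : 0 <= mu * h by exact: mulr_ge0.
have tt1 : t <= t1 by lra.
set Z := \sum_(k <- s) g k * (wt t k * normc (X k) ^+ 2).
have us : uniq s by exact: uniq_boxseq.
have hZ : sumle (fun k => g k * (wt t k * normc (X k) ^+ 2)) Z.
  apply: sumle_support => // k.
    exact: mulr_ge0 (powR_ge0 _ _) (mulr_ge0 (wt_ge0 _ _ _) (sqr_ge0 _)).
  by move/Xs ->; rewrite normc0 expr0n !mulr0.
have Z0 := sumle_ge0 hZ.
have hEt : energy s t X + 2 * (mu * h) * Z <= energy s (t + mu * h) X.
  rewrite /energy /Z mulr_sumr -big_split; apply: ler_sum => k _ /=.
  have := ler_wpM2r (sqr_ge0 (normc (X k))) (wt_decrease t k muh0).
  by rewrite mulrDl -!mulrA.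
have hE' : energy s t X <= E.
  have mhZ : 0 <= 2 * (mu * h) * Z by apply: mulr_ge0 => //; apply: mulr_ge0.
  by apply: le_trans hE; apply: le_trans hEt; rewrite lerDl.
have hsE : sumle (fun k => wt t k * normc (X k) ^+ 2) E.
  exact: sumle_leC hE' (energy_sumle _ us Xs).
have hKt : 320 + 2 * t <= K by apply: le_trans hK; rewrite lerD2l ler_wpM2l.
have := energy_trilinear beta0 eta0 Omega0 rho0 rho1 gam0 gamrho t0 hKt us Xr X0 hsE hZ.
set T3 := \sum_(k <- s) \sum_(l <- s) _ => hT.
have -> : energy s t (euler_step s h X) =
    energy s t X - 2 * h * T3 + h ^+ 2 * \sum_(k <- s) wt t k * normc (Phi s X k) ^+ 2.
  rewrite /energy /T3 2!mulr_sumr -sumrB -big_split big_seq [RHS]big_seq.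
  apply: eq_bigr => k ks /=; rewrite /euler_step ks !sqr_normc_cabs2 cabs2_step Re_conj_Phi.
  by rewrite -mulr_sumr; ring.
have hD := Phi_le_defect s t0 tt1 X0 hsE.
have := ler_wpM2l (sqr_ge0 h) hD.
have hT2 : - (2 * h * T3) <= 2 * (mu * h) * Z.
  have : - T3 <= mu * Z.
    apply: le_trans (ler_norm _) _; rewrite normrN; apply: le_trans hT _.
    rewrite muE; apply: ler_of_eq; by field; rewrite gt_eqF.
  by move/(ler_wpM2l h0); lra.
move: hEt hT2; move: (energy s (t + mu * h) X) (energy s t X) (2 * h * T3) (2 * (mu * h) * Z).
by move: (h ^+ 2 * \sum_(k <- s) _) (h ^+ 2 * _) => *; lra.
Qed.

(** The rate [mu] is computed for the level [E0 + 1]. The accumulated error stays at most 1, so the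
    level is never exceeded and one rate serves all steps. *)
Lemma energy_iter N (h mu K t1 E0 : R) X M : 0 <= h -> 0 <= t1 ->
  320 + 2 * t1 <= K -> mu = C0 * K * (1000 + (E0 + 1)) ->
  real_valued X -> mean_free X -> (forall k, k \notin boxseq N -> X k = 0) ->
  energy (boxseq N) t1 X <= E0 -> mu * (M%:R * h) <= t1 ->
  M%:R * h ^+ 2 * euler_defect (boxseq N) t1 (E0 + 1) <= 1 ->
  forall m, (m <= M)%N ->
  let Y := iter m (euler_step (boxseq N) h) X in
  [/\ real_valued Y, mean_free Y, (forall k, k \notin boxseq N -> Y k = 0) &
   energy (boxseq N) (t1 - mu * (m%:R * h)) Y <=
   E0 + m%:R * h ^+ 2 * euler_defect (boxseq N) t1 (E0 + 1)].
Proof.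
move=> h0 t10 hK muE Xr X0 Xs hE hmu hdef.
have E00 : 0 <= E0 by apply: le_trans (energy_ge0 _ _ _) hE.
have O0 : 0 < Omega by exact: Omega0.
have C00 : 0 <= C0 by rewrite divr_ge0 // ltW.
have K0 : 0 <= K by apply: le_trans hK; rewrite addr_ge0 ?ler0n // mulr_ge0.
have mu0 : 0 <= mu.
  by rewrite muE; exact: mulr_ge0 (mulr_ge0 C00 K0) (addr_ge0 (ler0n R 1000) (addr_ge0 E00 ler01)).
have D0 := euler_defect_ge0 (boxseq N) t1 (E0 + 1).
set D := euler_defect _ _ _ in hdef D0 *.
have hD0 : 0 <= h ^+ 2 * D by apply: mulr_ge0 D0; exact: sqr_ge0.
have hmono m n : (m <= n)%N -> m%:R * h ^+ 2 * D <= n%:R * h ^+ 2 * D.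
  by move=> mn; rewrite -(mulrA m%:R) -(mulrA n%:R); apply: (ler_wpM2r hD0); rewrite ler_nat.
have tmono m n : (m <= n)%N -> mu * (m%:R * h) <= mu * (n%:R * h).
  by move=> mn; apply: (ler_wpM2l mu0); apply: (ler_wpM2r h0); rewrite ler_nat.
elim=> [_|m IH mM]; first by split => //; rewrite !mul0r mulr0 subr0 addr0.
have [Yr Y0 Ys Ye] := IH (ltnW mM); rewrite iterS; set Y := iter m _ X in Yr Y0 Ys Ye *.
split; [exact: euler_step_real | exact: euler_step_mean_free | |].
  by move=> k hk; rewrite /euler_step (negbTE hk).
have e1 : t1 - mu * (m%:R * h) = t1 - mu * (m.+1%:R * h) + mu * h by rewrite -natr1; ring.
have hm := tmono _ _ mM; have hm' := hmono _ _ (ltnW mM).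
have muh0 : 0 <= mu * (m%:R * h) by rewrite !mulr_ge0.
have := @energy_step N (t1 - mu * (m.+1%:R * h)) h mu K t1 (E0 + 1) Y.
rewrite -e1 => /(_ _ h0 t10 _ hK muE Yr Y0 Ys _)/le_trans; apply; try lra.
have -> : m.+1%:R * h ^+ 2 * D = m%:R * h ^+ 2 * D + h ^+ 2 * D by rewrite -natr1; ring.
by rewrite addrA lerD2r.
Qed.

End Energy.
End Euler.

(** * Bounds on the nonlinearity and the trajectories, uniform in the box *)

Section Moments.
Variables (R : realType) (alpha beta eta Omega : R).
Local Notation normc := (@normc R).
Local Notation nm := (@knorm R).
Local Notation a_ := (acoef alpha beta eta Omega).
Local Notation Phi := (Phi alpha beta eta Omega).
Local Notation step := (euler_step alpha beta eta Omega).
Local Notation C0 := (3 / Omega).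
Hypotheses (beta0 : 0 < beta) (eta0 : 0 < eta) (Omega0 : 0 < Omega).
Hypotheses (gam1 : alpha + 1 <= 1).

(** Enough regularity to make the nonlinearity Lipschitz at each fixed frequency, uniformly in the
    truncation. *)
Definition moment2 (b : R) (X : fcoef R) : Prop :=
  mean_free X /\ sumle (fun k => nm k ^+ 2 * normc (X k)) b.

Let C0_ge0 : 0 <= C0. Proof. by rewrite divr_ge0 // ltW. Qed.

Lemma knorm_le_sqr k : nm k <= nm k ^+ 2.
Proof.
have [->|k0] := eqVneq k z0; first by rewrite knorm0 expr0n.
by rewrite expr2 ler_peMl ?knorm_ge0 ?knorm_ge1.
Qed.

Lemma acoef_lin j l : `|a_ j l| <= C0 * nm j * nm l.
Proof.
have [->|j0] := eqVneq j z0.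
  by rewrite acoef0 normr0 knorm0 mulr0 mul0r.
apply: le_trans (acoef_bound _ beta0 eta0 Omega0 l j0) _.
apply: (ler_wpM2r (knorm_ge0 R l)); apply: (ler_wpM2l C0_ge0).
by apply: powR_le_id => //; exact: knorm_ge1.
Qed.

(** With the output frequency [k] fixed, both derivatives can be loaded onto one input at the price
    of [nm k + 1]: onto [l] here, onto [zsub k l] in the next lemma. *)
Lemma acoef_le_inner k l : `|a_ (zsub k l) l| <= C0 * (nm k + 1) * nm l ^+ 2.
Proof.
apply: le_trans (acoef_lin _ _) _; rewrite -[leLHS]mulrA -[leRHS]mulrA; apply: (ler_wpM2l C0_ge0).
have [->|l0] := eqVneq l z0; first by rewrite knorm0 expr0n !mulr0.
have l1 := knorm_ge1 R l0; have k0 := knorm_ge0 R k.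
have -> : (nm k + 1) * nm l ^+ 2 = (nm k + 1) * nm l * nm l by ring.
apply: (ler_wpM2r (knorm_ge0 R l)); apply: le_trans (knorm_triangle_sub R k l) _.
by rewrite mulrDl mul1r lerD2r ler_peMr.
Qed.

Lemma acoef_le_diff k l : `|a_ (zsub k l) l| <= C0 * (nm k + 1) * nm (zsub k l) ^+ 2.
Proof.
rewrite -acoef_zsub; apply: le_trans (acoef_lin _ _) _.
rewrite -[leLHS]mulrA -[leRHS]mulrA; apply: (ler_wpM2l C0_ge0); rewrite mulrC.
apply: ler_pM; rewrite ?knorm_ge0 ?knorm_le_sqr //.
by rewrite lerDl.
Qed.

Section OneFamily.
Variables (b : R) (X : fcoef R).
Hypothesis hX : moment2 b X.

Let b0 : 0 <= b. Proof. by case: hX => _ /sumle_ge0. Qed.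

Lemma moment1_sumle : sumle (fun k => nm k * normc (X k)) b.
Proof.
case: hX => _; apply: sumle_le => k.
by apply: (ler_wpM2r (normc_ge0 _)); exact: knorm_le_sqr.
Qed.

Lemma moment1_le k : nm k * normc (X k) <= b.
Proof. exact: sumle_pt moment1_sumle. Qed.

Lemma moment0_le k : normc (X k) <= b.
Proof.
have [->|k0] := eqVneq k z0; first by case: hX => -> _; rewrite normc0.
by apply: le_trans (moment1_le k); rewrite ler_peMl ?normc_ge0 ?knorm_ge1.
Qed.

Let f k := nm k ^+ 2 * normc (X k).
Let f0 k : 0 <= f k. Proof. exact: mulr_ge0 (sqr_ge0 _) (normc_ge0 _). Qed.

Lemma Phi_le s k : uniq s -> normc (Phi s X k) <= C0 * b * b.
Proof.
move=> us; apply: le_trans (normc_sum _ _) _.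
apply: (@le_trans _ _ (\sum_(l <- s) C0 * (nm (zsub k l) * normc (X (zsub k l))
                                           * (nm l * normc (X l))))).
  apply: ler_sum => l _; rewrite transport_termE !normcM normc_iu mul1r normc_cR -mulrA.
  have q0 : 0 <= normc (X (zsub k l)) * normc (X l) by rewrite mulr_ge0 ?normc_ge0.
  have := ler_wpM2r q0 (acoef_lin (zsub k l) l).
  by move=> /le_trans; apply; apply: ler_of_eq; ring.
rewrite -mulr_sumr -[leRHS]mulrA; apply: (ler_wpM2l C0_ge0).
have g0 m : 0 <= nm m * normc (X m) by rewrite mulr_ge0 ?knorm_ge0 ?normc_ge0.
have := @sum_conv1 R [:: k] s _ _ _ _ isT us g0 g0 moment1_sumle moment1_sumle.
by rewrite big_seq1.
Qed.

(** Both derivatives are loaded onto [X (zsub k l)], which remains summable; this leaves [X l] free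
    to provide the decay [b / (M + 1)]. *)
Lemma Phi_tail M s k : uniq s -> {subset boxseq M <= s} ->
  normc (Phi s X k - Phi (boxseq M) X k) <= C0 * (nm k + 1) * b * (b / M.+1%:R).
Proof.
move=> us Ms; have k0 := knorm_ge0 R k.
have C1 : 0 <= C0 * (nm k + 1) by rewrite (mulr_ge0 C0_ge0) // addr_ge0.
pose t := [seq l <- s | l \notin boxseq M].
have -> : Phi s X k - Phi (boxseq M) X k = Phi t X k.
  by rewrite /Phi (sum_sub_split _ (uniq_boxseq M) us Ms) [LHS]addrC addKr.
apply: le_trans (normc_sum _ _) _.
apply: (@le_trans _ _ (\sum_(l <- t) C0 * (nm k + 1) * f (zsub k l) * (b / M.+1%:R))).
  rewrite big_seq [leRHS]big_seq; apply: ler_sum => l; rewrite mem_filter => /andP[lM _].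
  rewrite transport_termE !normcM normc_iu mul1r normc_cR.
  apply: ler_pM; rewrite ?mulr_ge0 ?normc_ge0 //.
    rewrite mulrA; apply: (ler_wpM2r (normc_ge0 _)); exact: acoef_le_diff.
  rewrite ler_pdivlMr ?ltr0n // mulrC; apply: le_trans (moment1_le l).
  by apply: (ler_wpM2r (normc_ge0 _)); exact: knorm_notin_box.
rewrite -mulr_suml; apply: ler_wpM2r; first by rewrite divr_ge0.
rewrite -mulr_sumr; apply: (ler_wpM2l C1).
by case: hX => _ /(sumle_inj (@zsub_injl k)); apply; rewrite filter_uniq.
Qed.

End OneFamily.

(** In the bilinear splitting the derivatives always fall on the factor that is not a difference, so
    the sup norm of [X - Y] suffices. *)
Lemma Phi_lip b d X Y s k : moment2 b X -> moment2 b Y -> uniq s ->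
  (forall k, normc (X k - Y k) <= d) ->
  normc (Phi s X k - Phi s Y k) <= C0 * (nm k + 1) * (2 * b) * d.
Proof.
move=> hX hY us hd; have k0 := knorm_ge0 R k.
have C1 : 0 <= C0 * (nm k + 1) by rewrite (mulr_ge0 C0_ge0) // addr_ge0.
have d0 : 0 <= d by apply: le_trans (hd z0); exact: normc_ge0.
rewrite /Phi -sumrB; apply: le_trans (normc_sum _ _) _.
apply: (@le_trans _ _ (\sum_(l <- s) C0 * (nm k + 1) * (nm l ^+ 2 * normc (X l)
    + nm (zsub k l) ^+ 2 * normc (Y (zsub k l))) * d)).
  apply: ler_sum => l _; rewrite !transport_termE; set j := zsub k l.
  have -> : iu R * cR (a_ j l) * X j * X l - iu R * cR (a_ j l) * Y j * Y l =
    iu R * cR (a_ j l) * ((X j - Y j) * X l + Y j * (X l - Y l)) by ring.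
  rewrite normcM (normcM (iu R)) normc_iu mul1r normc_cR.
  apply: (@le_trans _ _ (`|a_ j l| * (d * normc (X l) + normc (Y j) * d))).
    apply: (ler_wpM2l (normr_ge0 _)); apply: le_trans (ler_normcD _ _) _; rewrite !normcM.
    by apply: lerD; [apply: (ler_wpM2r (normc_ge0 _))|apply: (ler_wpM2l (normc_ge0 _))].
  rewrite mulrDr mulrDr mulrDl; apply: lerD.
    have := ler_wpM2r (mulr_ge0 d0 (normc_ge0 (X l))) (acoef_le_inner k l).
    by move=> /le_trans; apply; apply: ler_of_eq; ring.
  have := ler_wpM2r (mulr_ge0 (normc_ge0 (Y j)) d0) (acoef_le_diff k l).
  by move=> /le_trans; apply; apply: ler_of_eq; rewrite /j; ring.
rewrite -mulr_suml; apply: (ler_wpM2r d0); rewrite -mulr_sumr; apply: (ler_wpM2l C1).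
rewrite big_split mulrDl mul1r; apply: lerD; first by case: hX => _; apply.
by case: hY => _ /(sumle_inj (@zsub_injl k)); apply.
Qed.

Section Trajectory.
Variables (b h : R) (s : seq Z3) (X0 : fcoef R) (M : nat).
Hypotheses (h0 : 0 <= h) (us : uniq s).
Let Y m := iter m (step s h) X0.
Hypothesis hY : forall m, (m <= M)%N -> moment2 b (Y m).
Hypothesis sY : forall m k, (m <= M)%N -> k \notin s -> Y m k = 0.

Let incr m k : (m < M)%N -> k \in s -> Y m.+1 k = Y m k - cR h * Phi s (Y m) k.
Proof. by move=> _ ks; rewrite /Y iterS /euler_step ks. Qed.

Lemma euler_increment m n k : (m + n <= M)%N ->
  normc (Y (m + n) k - Y m k) <= n%:R * h * (C0 * b * b).
Proof.
elim: n => [|n IH] mn; first by rewrite addn0 subrr normc0 !mul0r.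
have mn' : (m + n <= M)%N by apply: leq_trans mn; rewrite leq_add2l.
have -> : Y (m + n.+1) k - Y m k = (Y (m + n) k - Y m k) + (Y (m + n.+1) k - Y (m + n) k).
  by ring.
apply: le_trans (ler_normcD _ _) _.
have -> : n.+1%:R * h * (C0 * b * b) = n%:R * h * (C0 * b * b) + h * (C0 * b * b).
  by rewrite -natr1; ring.
apply: lerD; first exact: IH.
have hb : 0 <= C0 * b * b.
  by apply: le_trans (normc_ge0 _) (Phi_le (hY mn') z0 us).
case: (boolP (k \in s)) => ks; last first.
  by rewrite !sY // subrr normc0 mulr_ge0.
rewrite addnS incr //; last by rewrite addnS in mn.
rewrite addrAC subrr add0r normcN normcM normc_cR ger0_norm //.
by apply: (ler_wpM2l h0); exact: (Phi_le (hY mn')).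
Qed.

(** The base index [p] may be either end of the range. Both ends are needed to obtain a two-sided
    derivative in the limit. *)
Lemma euler_taylor m n p k : k \in s -> (m + n <= M)%N -> (m <= p <= m + n)%N ->
  normc (Y (m + n) k - Y m k + cR (n%:R * h) * Phi s (Y p) k) <=
  2 * (C0 * b) ^+ 2 * (nm k + 1) * b * (n%:R * h) ^+ 2.
Proof.
move=> ks mnM /andP[mp pmn].
have k0 := knorm_ge0 R k; have nh0 : 0 <= n%:R * h by rewrite mulr_ge0.
have b0 : 0 <= b by case: (hY mnM) => _ /sumle_ge0.
have hb := mulr_ge0 (mulr_ge0 C0_ge0 b0) b0.
(* The error per unit of time: the Lipschitz constant of [Phi_lip] applied to the distance that
   [euler_increment] allows between iterates. *)
set e := C0 * (nm k + 1) * (2 * b) * (n%:R * h * (C0 * b * b)).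
suff H q : (q <= n)%N ->
    normc (Y (m + q) k - Y m k + cR (q%:R * h) * Phi s (Y p) k) <= q%:R * h * e.
  apply: le_trans (H n (leqnn n)) _; apply: ler_of_eq; rewrite /e; ring.
elim: q => [_|q IH qn].
  by rewrite addn0 subrr mulr0n !mul0r addr0 normc0.
have mqM : (m + q < M)%N by apply: leq_trans mnM; rewrite -addnS leq_add2l.
have -> : Y (m + q.+1) k - Y m k + cR (q.+1%:R * h) * Phi s (Y p) k =
   (Y (m + q) k - Y m k + cR (q%:R * h) * Phi s (Y p) k)
   - cR h * (Phi s (Y (m + q)) k - Phi s (Y p) k).
  rewrite addnS incr //.
  have -> : cR (q.+1%:R * h) = cR (q%:R * h) + cR h.
    by rewrite /cR; apply: complexP => /=; rewrite -?natr1; ring.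
  by ring.
apply: le_trans (normcB_le _ _) _.
have -> : q.+1%:R * h * e = q%:R * h * e + h * e by rewrite -natr1; ring.
apply: lerD; first by apply: IH; exact: ltnW.
rewrite normcM normc_cR ger0_norm //; apply: (ler_wpM2l h0).
apply: (@Phi_lip b); [exact: hY (ltnW mqM)|exact: hY (leq_trans pmn mnM)|exact: us|].
have Lnat i : (i <= n)%N -> i%:R * h * (C0 * b * b) <= n%:R * h * (C0 * b * b).
  by move=> hi; apply: (ler_wpM2r hb); apply: (ler_wpM2r h0); rewrite ler_nat.
move=> l; have [mqp|pmq] := leqP (m + q) p.
  rewrite -normcN opprB -(subnKC mqp); apply: le_trans (euler_increment _ _) (Lnat _ _).
    by rewrite subnKC // (leq_trans pmn).
  by rewrite leq_subLR -addnA (leq_trans pmn) // leq_add2l leq_addl.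
rewrite -(subnKC (ltnW pmq)); apply: le_trans (euler_increment _ _) (Lnat _ _).
  by rewrite subnKC ltnW.
by rewrite leq_subLR (leq_trans _ (leq_add mp (leqnn n))) // leq_add2l ltnW.
Qed.

End Trajectory.
End Moments.

(** * Limits of complex sequences along a filter *)

Section ComplexLimit.
Variables (R : realType) (U : set_system nat).
Context {FU : ProperFilter U}.
Local Notation normc := (@normc R).

Definition ccvg (z : nat -> R[i]) (w : R[i]) : Prop :=
  (fun N => complex.Re (z N)) @ U --> complex.Re w /\
  (fun N => complex.Im (z N)) @ U --> complex.Im w.

Lemma ccvg_unique z w w' : ccvg z w -> ccvg z w' -> w = w'.
Proof.
move=> [h1 h2] [h3 h4]; apply: complexP.
  exact: (cvg_unique (@norm_hausdorff _ R) h1 h3).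
exact: (cvg_unique (@norm_hausdorff _ R) h2 h4).
Qed.

Lemma ccvg_near z z' w : (\forall N \near U, z N = z' N) -> ccvg z w -> ccvg z' w.
Proof.
move=> zz [h1 h2]; split.
  apply: cvg_trans h1; apply: near_eq_cvg; near=> N; by rewrite (near zz N).
apply: cvg_trans h2; apply: near_eq_cvg; near=> N; by rewrite (near zz N).
Unshelve. all: by end_near. Qed.

Lemma ccvg_cst w : ccvg (fun=> w) w.
Proof. by split; exact: cvg_cst. Qed.

Lemma ccvg_cR (c : nat -> R) l : c @ U --> l -> ccvg (fun N => cR (c N)) (cR l).
Proof. by move=> h; split => //=; exact: cvg_cst. Qed.

Lemma ccvgD z w z' w' : ccvg z w -> ccvg z' w' -> ccvg (fun N => z N + z' N) (w + w').
Proof.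
move=> [h1 h2] [h3 h4]; split.
  have -> : complex.Re (w + w') = complex.Re w + complex.Re w' by case: w {h1 h2} => ? ?; case: w' {h3 h4}.
  apply: cvg_trans (cvgD h1 h3); apply: near_eq_cvg; apply: filterE => N /=.
  by rewrite ?fctE /=; case: (z N) => ? ?; case: (z' N).
have -> : complex.Im (w + w') = complex.Im w + complex.Im w' by case: w {h1 h2} => ? ?; case: w' {h3 h4}.
apply: cvg_trans (cvgD h2 h4); apply: near_eq_cvg; apply: filterE => N /=.
by rewrite ?fctE /=; case: (z N) => ? ?; case: (z' N).
Qed.

Lemma ccvgM z w z' w' : ccvg z w -> ccvg z' w' -> ccvg (fun N => z N * z' N) (w * w').
Proof.
move=> [h1 h2] [h3 h4]; split.
  have -> : complex.Re (w * w') = complex.Re w * complex.Re w' - complex.Im w * complex.Im w'.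
    by case: w {h1 h2} => ? ?; case: w' {h3 h4}.
  apply: cvg_trans (cvgB (cvgM h1 h3) (cvgM h2 h4)); apply: near_eq_cvg; apply: filterE => N /=.
  by rewrite ?fctE /=; case: (z N) => ? ?; case: (z' N).
have -> : complex.Im (w * w') = complex.Re w * complex.Im w' + complex.Im w * complex.Re w'.
  by case: w {h1 h2} => ? ?; case: w' {h3 h4}.
apply: cvg_trans (cvgD (cvgM h1 h4) (cvgM h2 h3)); apply: near_eq_cvg; apply: filterE => N /=.
by rewrite ?fctE /=; case: (z N) => ? ?; case: (z' N).
Qed.

Lemma ccvgN z w : ccvg z w -> ccvg (fun N => - z N) (- w).
Proof.
move=> [h1 h2]; split.
  have -> : complex.Re (- w) = - complex.Re w by case: w {h1 h2}.
  apply: cvg_trans (cvgN h1); apply: near_eq_cvg; apply: filterE => N /=.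
  by rewrite ?fctE /=; case: (z N).
have -> : complex.Im (- w) = - complex.Im w by case: w {h1 h2}.
apply: cvg_trans (cvgN h2); apply: near_eq_cvg; apply: filterE => N /=.
by rewrite ?fctE /=; case: (z N).
Qed.

Lemma ccvgJ z w : ccvg z w -> ccvg (fun N => conjc (z N)) (conjc w).
Proof.
move=> [h1 h2]; split.
  have -> : complex.Re (conjc w) = complex.Re w by case: w {h1 h2}.
  apply: cvg_trans h1; apply: near_eq_cvg; apply: filterE => N /=.
  by rewrite ?fctE /=; case: (z N).
have -> : complex.Im (conjc w) = - complex.Im w by case: w {h1 h2}.
apply: cvg_trans (cvgN h2); apply: near_eq_cvg; apply: filterE => N /=.
by rewrite ?fctE /=; case: (z N).
Qed.

Lemma ccvg_sum (I : Type) (s : seq I) (z : I -> nat -> R[i]) (w : I -> R[i]) :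
  (forall x, ccvg (z x) (w x)) -> ccvg (fun N => \sum_(x <- s) z x N) (\sum_(x <- s) w x).
Proof.
move=> h; elim: s => [|x s IH].
  by rewrite big_nil; apply: ccvg_near (ccvg_cst 0); apply: filterE => N; rewrite big_nil.
rewrite big_cons; apply: ccvg_near (ccvgD (h x) IH).
by apply: filterE => N; rewrite big_cons.
Qed.

Lemma ccvg_cabs2 z w : ccvg z w -> (fun N => cabs2 (z N)) @ U --> cabs2 w.
Proof.
move=> [h1 h2]; apply: cvg_trans (cvgD (cvgM h1 h1) (cvgM h2 h2)).
by apply: near_eq_cvg; apply: filterE.
Qed.

Lemma ccvg_normc_le z w (B : nat -> R) l : ccvg z w -> B @ U --> l ->
  (\forall N \near U, normc (z N) <= B N) -> normc w <= l.
Proof.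
move=> zw Bl zB.
have l0 : 0 <= l.
  apply: (cvgr_to_ge Bl); near=> N; apply: le_trans (normc_ge0 (z N)) _; exact: (near zB N).
rewrite -ler_sqr ?nnegrE ?normc_ge0 // sqr_normc_cabs2 -subr_ge0.
apply: (cvgr_to_ge (cvgB (cvgM Bl Bl) (ccvg_cabs2 zw))).
near=> N; rewrite ?fctE /= subr_ge0 -sqr_normc_cabs2 -[leRHS]/(B N ^+ 2).
have h : normc (z N) <= B N by exact: (near zB N).
by rewrite lerXn2r ?nnegrE ?normc_ge0 // (le_trans (normc_ge0 _) h).
Unshelve. all: by end_near. Qed.

Lemma cvg_sum_seq (I : Type) (s : seq I) (f : I -> nat -> R) (a : I -> R) :
  (forall x, f x @ U --> a x) -> (fun N => \sum_(x <- s) f x N) @ U --> \sum_(x <- s) a x.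
Proof.
move=> h; elim: s => [|x s IH].
  by rewrite big_nil; under eq_fun do rewrite big_nil; exact: cvg_cst.
by rewrite big_cons; under eq_fun do rewrite big_cons; exact: cvgD.
Qed.

Lemma ccvg_sumle (W : Z3 -> R) (x : nat -> fcoef R) (y : fcoef R) E :
  (forall k, ccvg (fun N => x N k) (y k)) ->
  (forall N, sumle (fun k => W k * normc (x N k) ^+ 2) E) ->
  sumle (fun k => W k * normc (y k) ^+ 2) E.
Proof.
move=> xy hE s us.
have h : (fun N => \sum_(k <- s) W k * cabs2 (x N k)) @ U --> \sum_(k <- s) W k * cabs2 (y k).
  by apply: cvg_sum_seq => k; apply: cvgMr; exact: ccvg_cabs2.
under eq_bigr do rewrite sqr_normc_cabs2.
apply: (cvgr_to_le h); apply: filterE => N.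
by have := hE N s us; under eq_bigr do rewrite sqr_normc_cabs2.
Qed.

End ComplexLimit.

(** * Compactness through an ultrafilter *)

Section UltraLimit.
Variables (R : realType) (U : set_system nat).
Context {hU : UltraFilter U}.
Local Notation normc := (@normc R).

(** For an ultrafilter a cluster point is a limit. One ultrafilter thus serves all times and
    frequencies at once, without extracting subsequences. *)
Lemma ultra_bounded_cvg (u : nat -> R) (B : R) : (forall N, `|u N| <= B) ->
  exists l : R, u @ U --> l.
Proof.
move=> uB; have uF : (u @ U) `[- B, B]%classic.
  by apply: (@filterE _ U _ (u @^-1` _)) => N /=; rewrite in_itv /= -ler_norml.
have [p [_ cp]] := segment_compact (fmap_proper_filter u ultra_proper) uF.
exists p => V pV; have [//|UnV] := in_ultra_setVsetC (u @^-1` V) hU.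
by have [q [/= nVq Vq]] := cp (~` V) V UnV pV.
Qed.

Lemma ccvg_bounded (z : nat -> R[i]) (B : R) : (forall N, normc (z N) <= B) ->
  exists w, ccvg U z w.
Proof.
move=> zB; have [a ha] := @ultra_bounded_cvg (fun N => complex.Re (z N)) B
  (fun N => le_trans (ler_Re_normc _) (zB N)).
have [c hc] := @ultra_bounded_cvg (fun N => complex.Im (z N)) B
  (fun N => le_trans (ler_Im_normc _) (zB N)).
by exists (Complex a c).
Qed.

End UltraLimit.

(** * Passing to the limit in the approximations *)

Section LimitSolution.
Variables (R : realType) (alpha beta eta Omega : R).
Local Notation normc := (@normc R).
Local Notation nm := (@knorm R).
Local Notation Phi := (Phi alpha beta eta Omega).
Hypotheses (beta0 : 0 < beta) (eta0 : 0 < eta) (Omega0 : 0 < Omega).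
Hypotheses (gam1 : alpha + 1 <= 1).

Lemma cvg_harmonic_bound (u : nat -> R) (l C : R) :
  (forall N, `|l - u N| <= C / N.+1%:R) -> u @ \oo --> l.
Proof.
move=> h; have hh : (fun N => C * harmonic N) @ \oo --> (0 : R).
  by rewrite -(mulr0 C); apply: cvgMr; exact: cvg_harmonic.
apply/cvgrPdist_le => e e0; move/cvgr0Pnorm_le: hh => /(_ e e0).
by apply: filterS => N; apply: le_trans; apply: le_trans (ler_norm _); exact: h.
Qed.

(** [c N t t'] stands for the signed lag between the grid times that precede [t] and [t']. The
    Taylor bound is phrased with it since the approximations are constant between grid times. *)
Lemma limit_solution (T b E : R) (W G : Z3 -> R) (x : nat -> R -> fcoef R)
    (c : nat -> R -> R -> R) (th0 : fcoef R) : 0 <= T -> mean_free th0 ->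
  (forall N t, 0 <= t <= T -> [/\ real_valued (x N t), moment2 b (x N t) &
     sumle (fun k => W k * normc (x N t k) ^+ 2) E]) ->
  (forall N t t' k, 0 <= t <= T -> 0 <= t' <= T -> k \in boxseq N ->
     normc (x N t' k - x N t k + cR (c N t t') * Phi (boxseq N) (x N t) k) <=
       G k * c N t t' ^+ 2) ->
  (forall N t t', 0 <= t <= T -> 0 <= t' <= T -> `|(t' - t) - c N t t'| <= 2 / N.+1%:R) ->
  (forall N k, k \in boxseq N -> x N 0 k = th0 k) ->
  exists th : R -> fcoef R, th 0 = th0 /\ forall t, 0 <= t <= T ->
    [/\ real_valued (th t), mean_free (th t), sumle (fun k => W k * normc (th t k) ^+ 2) E &
     forall k, exists v, series_to (transport_term alpha beta eta Omega (th t) k) v /\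
       forall t', 0 <= t' <= T ->
         normc (th t' k - th t k + cR (t' - t) * v) <= G k * (t' - t) ^+ 2].
Proof.
move=> T0 th00 hx hT hc h0.
have [U [hU Uoo]] := ultraFilterLemma (eventually_filter).
have near_box k : \forall N \near U, k \in boxseq N by apply: Uoo; exact: in_boxseq_near.
have [f hf] : {f : R * Z3 -> R[i] & forall q, 0 <= q.1 <= T -> ccvg U (fun N => x N q.1 q.2) (f q)}.
  apply: (@choice _ _ (fun q w => 0 <= q.1 <= T -> ccvg U (fun N => x N q.1 q.2) w)).
  (* No bound is available outside [[0, T]]; the value 0 there is a dummy. *)
  move=> [t k] /=; have [tT|] := boolP (0 <= t <= T); last by exists 0.
  have hb N : normc (x N t k) <= b by have [_ /moment0_le hm _] := hx N t tT; exact: hm.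
  by have [w hw] := ccvg_bounded hb; exists w.
pose th t k := f (t, k).
have hth t k : 0 <= t <= T -> ccvg U (fun N => x N t k) (th t k) by move=> tT; exact: (hf (t, k)).
have z0T : 0 <= (0 : R) <= T by rewrite lexx.
exists th; split.
  apply/funext => k; apply: (ccvg_unique (hth 0 k z0T)).
  apply: ccvg_near (@ccvg_cst _ U _ (th0 k)).
  by apply: filterS (near_box k) => N hk; rewrite h0.
move=> t tT; split.
- apply/real_valuedP => k; apply: (ccvg_unique (hth t (zopp k) tT)).
  apply: ccvg_near (ccvgJ (hth t k tT)); apply: filterE => N.
  by have [/real_valuedP -> ] := hx N t tT.
- apply: (ccvg_unique (hth t z0 tT)); apply: ccvg_near (@ccvg_cst _ U _ 0).
  by apply: filterE => N; have [_ [-> _]] := hx N t tT.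
- apply: (ccvg_sumle (fun k => hth t k tT)) => N.
  by have [_ _ ] := hx N t tT.
move=> k.
have hPhi N : normc (Phi (boxseq N) (x N t) k) <= 3 / Omega * b * b.
  have [_ hm _] := hx N t tT.
  by apply: (Phi_le beta0 eta0 Omega0 gam1 hm); exact: uniq_boxseq.
(* The limit [v] of the truncated nonlinearities is the sum of the series by the uniform tail
   bound [Phi_tail]. *)
have [v hv] := ccvg_bounded hPhi; exists v; split.
  have hM M : normc (v - Phi (boxseq M) (th t) k) <=
      3 / Omega * (nm k + 1) * b * b / M.+1%:R.
    apply: (@ccvg_normc_le _ U _ (fun N => Phi (boxseq N) (x N t) k - Phi (boxseq M) (x N t) k) _ (fun=> _)).
    - apply: ccvgD hv (ccvgN _); apply: ccvg_sum => l; rewrite transport_termE.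
      by do 2?apply: ccvgM; [exact: ccvg_cst|exact: hth|exact: hth].
    - exact: cvg_cst.
    - have : \forall N \near U, (M <= N)%N by apply: Uoo; exists M.
      apply: filterS => N MN; have [_ hm _] := hx N t tT.
      rewrite -mulrA; apply: (Phi_tail beta0 eta0 Omega0 gam1 hm k (uniq_boxseq N)).
      exact: boxseq_mono.
  have ReB (a d : R[i]) : complex.Re a - complex.Re d = complex.Re (a - d) by case: a => ? ?; case: d.
  have ImB (a d : R[i]) : complex.Im a - complex.Im d = complex.Im (a - d) by case: a => ? ?; case: d.
  split; apply: cvg_harmonic_bound => M; apply: le_trans (hM M).
    by rewrite ReB; exact: ler_Re_normc.
  by rewrite ImB; exact: ler_Im_normc.
move=> t' t'T.
have cl : (fun N => c N t t') @ U --> t' - t.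
  move=> V /(@cvg_harmonic_bound _ _ 2 (fun N => hc N t t' tT t'T)); exact: Uoo.
apply: (@ccvg_normc_le _ U _
  (fun N => x N t' k - x N t k + cR (c N t t') * Phi (boxseq N) (x N t) k) _
  (fun N => G k * c N t t' ^+ 2)).
- apply: ccvgD; last by apply: ccvgM hv; exact: ccvg_cR.
  by apply: ccvgD (hth t' k t'T) _; apply: ccvgN; exact: hth.
- by apply: cvgMr; rewrite expr2; exact: cvgM.
- by apply: filterS (near_box k) => N hk; exact: hT.
Qed.

End LimitSolution.

(** * Differentiability from a second order bound *)

Section QuadraticBound.
Variable R : realType.
Implicit Types (f : R -> R) (t d G T : R).

Lemma is_derive_quadratic f t d G T : 0 <= G -> 0 < t < T ->
  (forall t', 0 <= t' <= T -> `|f t' - f t - (t' - t) * d| <= G * (t' - t) ^+ 2) ->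
  is_derive t (1 : R) f d.
Proof.
move=> G0 /andP[t0 tT] hf.
have hq : (fun h : R => h^-1 *: ((f \o shift t) (h *: (1 : R)) - f t)) @ 0^' --> d.
  apply/cvgrPdist_le => e e0.
  have G1 : 0 < G + 1 by apply: ltr_wpDl.
  have ne0 : 0 < e / (G + 1) by apply: divr_gt0.
  near=> h.
  have h0 : h != 0 by near: h; exact: nbhs_dnbhs_neq.
  have h1 : `|h| < Num.min t (Num.min (T - t) (e / (G + 1))).
    near: h; apply: dnbhs0_lt; rewrite !lt_min t0 ne0 subr_gt0 tT //.
  move: h1; rewrite !lt_min => /and3P[ht hT he].
  have ht' : 0 <= h + t <= T by move: ht hT; rewrite !ltr_norml => /andP[? ?] /andP[? ?]; lra.
  have := hf _ ht'; rewrite addrK => hfh.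
  have -> : d - h^-1 *: ((f \o shift t) (h *: (1 : R)) - f t) =
      - (h^-1 * (f (h + t) - f t - h * d)).
    by rewrite /= /GRing.scale /= mulr1; field.
  rewrite normrN normrM normfV ler_pdivrMl ?normr_gt0 //.
  apply: le_trans hfh _; rewrite -[h ^+ 2]real_normK ?num_real // expr2 mulrA.
  rewrite mulrC; apply: (ler_wpM2l (normr_ge0 _)).
  have := normr_ge0 h; move/ltW: he; rewrite ler_pdivlMr // mulrDr mulr1 mulrC => h2 h3; lra.
split; first by apply/cvg_ex; exists d.
exact: (cvg_lim (@norm_hausdorff _ R) hq).
Unshelve. all: by end_near. Qed.

Lemma cvg_right_quadratic f d G T : 0 <= G -> 0 < T ->
  (forall t', 0 <= t' <= T -> `|f t' - f 0 - t' * d| <= G * t' ^+ 2) ->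
  f t @[t --> 0^'+] --> f 0.
Proof.
move=> G0 T0 hf; apply/cvgrPdist_le => e e0.
have G1 : 0 < G + `|d| + 1 by rewrite ltr_wpDl // addr_ge0.
have ne0 : 0 < e / (G + `|d| + 1) by apply: divr_gt0.
near=> t.
have t0 : 0 < t by near: t; exact: nbhs_right_gt.
have tT : t <= T by near: t; exact: nbhs_right_le.
have t1 : t <= 1 by near: t; exact: nbhs_right_le.
have te : t <= e / (G + `|d| + 1) by near: t; exact: nbhs_right_le.
have htT : 0 <= t <= T by rewrite ltW.
have := hf _ htT; move: te; rewrite ler_pdivlMr // => te.
move=> h1; rewrite distrC.
have -> : f t - f 0 = (f t - f 0 - t * d) + t * d by ring.
apply: le_trans (ler_normD _ _) _; rewrite normrM (gtr0_norm t0).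
have : G * t ^+ 2 <= G * t.
  by apply: (ler_wpM2l G0); rewrite expr2 ger_pMr // ltW.
by move: te; rewrite !mulrDr; lra.
Unshelve. all: by end_near. Qed.

End QuadraticBound.

(** * Changing the power in the Gevrey norm *)

Section GevreyNorm.
Variables (R : realType) (rho : R).
Hypotheses (rho0 : 0 < rho).
Local Notation nm := (@knorm R).
Local Notation normc := (@normc R).
Local Notation wt := (@wt R rho).

Lemma gevrey_sumle (r tau B : R) (th : fcoef R) :
  (gevrey_norm2 r rho^-1 tau th <= B%:E)%E <->
  sumle (fun k => if k != z0 then
    powR (nm k) (2 * r) * expR (2 * tau * powR (nm k) rho) * normc (th k) ^+ 2 else 0) B.
Proof.
rewrite /gevrey_norm2 invrK esum_sumle.
  by split; apply: sumle_le => k; rewrite sqr_normc_cabs2.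
by move=> k; rewrite !mulr_ge0 ?powR_ge0 ?expR_ge0 ?cabs2_ge0.
Qed.

(** Half of the radius pays for the power 10, and [|k|^(2 r) >= 1] is dropped. *)
Lemma gevrey_to_wt (r tau : R) : 0 <= r -> 0 < tau ->
  exists2 c, 0 < c & forall th B, mean_free th ->
    (gevrey_norm2 r rho^-1 tau th <= B%:E)%E ->
    sumle (fun k => wt (tau / 2) k * normc (th k) ^+ 2) (c * B).
Proof.
move=> r0 t0; have [c c0 hc] := powR_le_expR 10 rho0 t0.
exists c => // th B th0 /gevrey_sumle /(sumleZ (ltW c0)); apply: sumle_le => k.
case: eqVneq => [->|k0]; first by rewrite th0 normc0 expr0n !mulr0.
have n1 := knorm_ge1 R k0; rewrite [leRHS]mulrA; apply: (ler_wpM2r (sqr_ge0 _)).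
have := hc _ n1; rewrite powR_mulrn ?knorm_ge0 // => h.
have := ler_wpM2r (expR_ge0 (tau * nm k `^ rho)) h.
have -> : expR (tau * nm k `^ rho) = expR (2 * (tau / 2) * nm k `^ rho) by congr expR; field.
move/le_trans; apply; rewrite -[leLHS]mulrA; apply: (ler_wpM2l (ltW c0)).
have -> : expR (2 * tau * nm k `^ rho) =
    expR (2 * (tau / 2) * nm k `^ rho) * expR (2 * (tau / 2) * nm k `^ rho).
  by rewrite -expRD; congr expR; field.
rewrite -[leLHS]mul1r; apply: (ler_wpM2r (mulr_ge0 (expR_ge0 _) (expR_ge0 _))).
by apply: powR_ge1 => //; rewrite mulr_ge0.
Qed.

(** The same trade in the other direction: half of the radius pays for [|k|^(2 r)], and the power 10
    is dropped. *)
Lemma wt_to_gevrey (r sig : R) : 0 < sig ->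
  exists2 c, 0 < c & forall th B,
    sumle (fun k => wt sig k * normc (th k) ^+ 2) B ->
    (gevrey_norm2 r rho^-1 (sig / 2) th <= (c * B)%:E)%E.
Proof.
move=> s0; have [c c0 hc] := powR_le_expR (2 * r) rho0 s0.
exists c => // th B /(sumleZ (ltW c0)) hB; apply/gevrey_sumle; apply: sumle_le hB => k.
case: eqVneq => [->|k0].
  exact: mulr_ge0 (ltW c0) (mulr_ge0 (wt_ge0 _ _ _) (sqr_ge0 _)).
have n1 := knorm_ge1 R k0; rewrite [leRHS]mulrA; apply: (ler_wpM2r (sqr_ge0 _)).
have h := ler_wpM2r (expR_ge0 (2 * (sig / 2) * nm k `^ rho)) (hc _ n1).
apply: le_trans h _; rewrite -[leLHS]mulrA; apply: (ler_wpM2l (ltW c0)).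
rewrite -expRD /wt.
have -> : sig * nm k `^ rho + 2 * (sig / 2) * nm k `^ rho = 2 * sig * nm k `^ rho by field.
by rewrite -[leLHS]mul1r; apply: (ler_wpM2r (expR_ge0 _)); exact: exprn_ege1.
Qed.

End GevreyNorm.

(** * Existence with a lifespan that does not depend on the datum *)

Section Existence.
Variables (R : realType) (alpha beta eta Omega rho : R).
Local Notation normc := (@normc R).
Local Notation nm := (@knorm R).
Local Notation Phi := (Phi alpha beta eta Omega).
Local Notation step := (euler_step alpha beta eta Omega).
Local Notation C0 := (3 / Omega).
Local Notation wt := (@wt R rho).
Hypotheses (beta0 : 0 < beta) (eta0 : 0 < eta) (Omega0 : 0 < Omega).
Hypotheses (rho0 : 0 < rho) (rho1 : rho <= 1).
Hypotheses (gam0 : 0 <= alpha + 1) (gamrho : alpha + 1 <= rho).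

Let gam1 : alpha + 1 <= 1. Proof. exact: le_trans rho1. Qed.

Lemma moment2_of_wt t X E : 0 <= t -> mean_free X ->
  sumle (fun k => wt t k * normc (X k) ^+ 2) E -> moment2 ((1000 + E) / 2) X.
Proof.
move=> t0 X0 hE; split => //; apply: sumle_le (sumle_Bfam X0 hE) => k.
rewrite /Bfam /Bs; apply: (ler_wpM2r (normc_ge0 _)); rewrite -[leLHS]mulr1.
apply: (ler_wpM2l (sqr_ge0 _)); rewrite -expR0 ler_expR mulr_ge0 ?powR_ge0 //.
Qed.

Section Approximations.
Variables (t1 E0 K mu T : R) (th0 : fcoef R).
Hypotheses (t10 : 0 < t1) (hK : 320 + 2 * t1 <= K).
Hypotheses (muE : mu = C0 * K * (1000 + (E0 + 1))) (mu0 : 0 < mu).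
Hypotheses (TE : T = t1 / (2 * mu)).
Hypotheses (m0 : mean_free th0) (r0 : real_valued th0).
Hypothesis (hE0 : sumle (fun k => wt t1 k * normc (th0 k) ^+ 2) E0).

Let D N := euler_defect alpha beta eta Omega rho (boxseq N) t1 (E0 + 1).
(* Makes the accumulated quadratic error of the Euler scheme at most 1 up to time [T]. *)
Let h N : R := (N.+1%:R + T * D N)^-1.
(** The number of steps completed by time [t]; [x] below is the piecewise constant interpolation of
    the Euler iterates. *)
Let ix N t := Num.truncn (t / h N).
Let x N t := iter (ix N t) (step (boxseq N) (h N)) (truncation (boxseq N) th0).
Let b := (1000 + (E0 + 1)) / 2.

Let T0 : 0 < T. Proof. by rewrite TE divr_gt0 // mulr_gt0. Qed.
Let D0 N : 0 <= D N. Proof. exact: euler_defect_ge0. Qed.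
Let den0 N : 0 < N.+1%:R + T * D N.
Proof. by rewrite ltr_pwDl ?ltr0n // mulr_ge0 // ltW. Qed.
Let h0 N : 0 < h N. Proof. by rewrite invr_gt0. Qed.
Let hN N : h N <= N.+1%:R^-1.
Proof. by rewrite lef_pV2 ?posrE ?ltr0n // lerDl mulr_ge0 // ltW. Qed.
Let hTD N : T * h N * D N <= 1.
Proof.
have -> : T * h N * D N = T * D N / (N.+1%:R + T * D N) by rewrite /h; ring.
by rewrite ler_pdivrMr // mul1r lerDr.
Qed.

Let ix_bounds N t : 0 <= t -> (ix N t)%:R * h N <= t < ((ix N t).+1)%:R * h N.
Proof.
move=> tp; have : 0 <= t / h N by rewrite divr_ge0 // ltW.
by move=> /truncn_itv; rewrite -/(ix N t) ler_pdivlMr // ltr_pdivrMr.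
Qed.

Let ix_mono N t t' : t <= t' -> (ix N t <= ix N t')%N.
Proof. by move=> tt'; apply: le_truncn; rewrite ler_pM2r ?invr_gt0. Qed.

Let iterates N m : (m <= ix N T)%N ->
  let Y := iter m (step (boxseq N) (h N)) (truncation (boxseq N) th0) in
  [/\ real_valued Y, moment2 b Y, (forall k, k \notin boxseq N -> Y k = 0) &
      sumle (fun k => wt (t1 / 2) k * normc (Y k) ^+ 2) (E0 + 1)].
Proof.
move=> mM Y; have /andP[MT _] := ix_bounds N (ltW T0).
(* [T] is the time in which the radius, shrinking at rate [mu], drops from [t1] to [t1 / 2]. *)
have e1 : mu * T = t1 / 2 by rewrite TE; field; rewrite gt_eqF.
have muM : mu * ((ix N T)%:R * h N) <= t1 / 2 by rewrite -e1 ler_pM2l.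
have hdef : (ix N T)%:R * h N ^+ 2 * D N <= 1.
  apply: le_trans (hTD N); apply: (ler_wpM2r (D0 N)).
  by rewrite expr2 mulrA; apply: ler_wpM2r => //; exact: ltW.
have t1n : 0 <= t1 by exact: ltW.
have t12 : t1 / 2 <= t1 by rewrite ler_pdivrMr // ler_peMr // ler1n.
have supp k : k \notin boxseq N -> truncation (boxseq N) th0 k = 0.
  by rewrite /truncation => /negbTE ->.
have hE : energy rho (boxseq N) t1 (truncation (boxseq N) th0) <= E0.
  rewrite /energy; apply: le_trans (hE0 (uniq_boxseq N)).
  rewrite big_seq [leRHS]big_seq; apply: ler_sum => k kN.
  by rewrite /truncation kN.
have [Yr Y0 Ys Ye] := energy_iter beta0 eta0 Omega0 rho0 rho1 gam0 gamrho (ltW (h0 N)) t1n hK muE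
  (truncation_real N r0) (truncation_mean_free (boxseq N) m0) supp hE (le_trans muM t12) hdef mM.
have Ysum : sumle (fun k => wt (t1 / 2) k * normc (Y k) ^+ 2) (E0 + 1).
  apply: (@sumle_le _ _ (fun k => wt (t1 - mu * (m%:R * h N)) k * normc (Y k) ^+ 2)).
    move=> k; apply: (ler_wpM2r (sqr_ge0 _)); apply: wt_mono.
    have : mu * (m%:R * h N) <= mu * ((ix N T)%:R * h N).
      apply: (ler_wpM2l (ltW mu0)); apply: (ler_wpM2r (ltW (h0 N))); by rewrite ler_nat.
    by move=> h1; have h2 := le_trans h1 muM; lra.
  apply: sumle_leC (energy_sumle _ _ (uniq_boxseq N) Ys).
  apply: le_trans Ye _; rewrite lerD2l; apply: le_trans hdef.
  apply: (ler_wpM2r (D0 N)); apply: (ler_wpM2r (sqr_ge0 _)); by rewrite ler_nat.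
split => //; apply: moment2_of_wt Ysum => //; by rewrite divr_ge0.
Qed.

Lemma euler_limit : exists th : R -> fcoef R, th 0 = th0 /\ forall t, 0 <= t <= T ->
    [/\ real_valued (th t), mean_free (th t),
        sumle (fun k => wt (t1 / 2) k * normc (th t k) ^+ 2) (E0 + 1) &
     forall k, exists v, series_to (transport_term alpha beta eta Omega (th t) k) v /\
       forall t', 0 <= t' <= T ->
         normc (th t' k - th t k + cR (t' - t) * v) <=
           2 * (C0 * b) ^+ 2 * (nm k + 1) * b * (t' - t) ^+ 2].
Proof.
have ixT N t : 0 <= t <= T -> (ix N t <= ix N T)%N by case/andP => _; exact: ix_mono.
pose c N t t' : R := ((ix N t')%:R - (ix N t)%:R) * h N.
apply: (@limit_solution R alpha beta eta Omega beta0 eta0 Omega0 gam1 T b (E0 + 1) _ _ x c) => //.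
- exact: ltW.
- by move=> N t tT; have [? ? _ ?] := iterates (ixT N t tT).
- move=> N t t' k tT t'T kN.
  have hY m : (m <= ix N T)%N -> moment2 b (iter m (step (boxseq N) (h N)) (truncation (boxseq N) th0)).
    by move=> mM; have [] := iterates mM.
  have hs m l : (m <= ix N T)%N -> l \notin boxseq N ->
      iter m (step (boxseq N) (h N)) (truncation (boxseq N) th0) l = 0.
    by move=> mM lN; have [_ _ -> ] := iterates mM.
  have := @euler_taylor R alpha beta eta Omega beta0 eta0 Omega0 gam1 b (h N) (boxseq N)
    (truncation (boxseq N) th0) (ix N T) (ltW (h0 N)) (uniq_boxseq N) hY hs.
  have [tt'|/ltnW t't] := leqP (ix N t) (ix N t').
    move=> /(_ (ix N t) (ix N t' - ix N t)%N (ix N t) k kN).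
    rewrite subnKC // leqnn tt' natrB // => H; exact: (H (ixT N t' t'T) isT).
  (* When [t'] precedes [t], the iterates run from [t'] to [t] with the base index at the later end,
     and the resulting expression is negated. *)
  move=> /(_ (ix N t') (ix N t - ix N t')%N (ix N t) k kN).
  rewrite subnKC // leqnn t't natrB // => /(_ (ixT N t tT) isT).
  rewrite -normcN /c /x.
  move: (iter (ix N t') _ _) (iter (ix N t) _ _) => Y' Y.
  have -> : - (Y k - Y' k + cR (((ix N t)%:R - (ix N t')%:R) * h N) * Phi (boxseq N) Y k) =
    Y' k - Y k + cR (((ix N t')%:R - (ix N t)%:R) * h N) * Phi (boxseq N) Y k.
    have -> : cR (((ix N t)%:R - (ix N t')%:R) * h N) = - cR (((ix N t')%:R - (ix N t)%:R) * h N).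
      by rewrite /cR; apply: complexP => /=; ring.
    by ring.
  move/le_trans; apply; apply: ler_of_eq; ring.
- move=> N t t' /andP[tp _] /andP[t'p _].
  have /andP[a1 a2] := ix_bounds N tp; have /andP[b1 b2] := ix_bounds N t'p.
  have := hN N; rewrite /c; have -> : 2 / N.+1%:R = N.+1%:R^-1 + N.+1%:R^-1 :> R by ring.
  move: (N.+1%:R^-1) => n hn; move: a1 a2 b1 b2; rewrite -!natr1 !mulrDl !mul1r.
  move: ((ix N t)%:R * h N) ((ix N t')%:R * h N) (h N) hn => p q hh hn a1 a2 b1 b2.
  by rewrite ler_norml mulNr; apply/andP; split; lra.
- move=> N k kN; rewrite /x /ix mul0r truncn0 /= /truncation kN //.
Qed.

End Approximations.

Lemma MG_existence (r tau0 K0 : R) : 0 <= r -> 0 < tau0 -> 0 < K0 ->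
  exists2 T : R, 0 < T & forall th0, mean_free th0 -> real_valued th0 ->
    (gevrey_norm2 r rho^-1 tau0 th0 <= (K0 ^+ 2)%:E)%E ->
    exists th : R -> fcoef R,
      MG_solution_Gs alpha beta eta Omega r rho^-1 T th0 th /\
      forall t, 0 <= t < T -> real_valued (th t).
Proof.
move=> r0 tau00 K00.
have [c c0 hc] := gevrey_to_wt rho0 r0 tau00.
have [t1 t1E] : exists t1, t1 = tau0 / 2 by exists (tau0 / 2).
have [E0 E0E] : exists E0, E0 = c * K0 ^+ 2 by exists (c * K0 ^+ 2).
have [K hK] : exists K, 320 + 2 * t1 <= K by exists (320 + 2 * t1).
have [mu muE] : exists mu, mu = C0 * K * (1000 + (E0 + 1)) by eexists.
have [T TE] : exists T, T = t1 / (2 * mu) by eexists.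
have t10 : 0 < t1 by rewrite t1E divr_gt0.
have E00 : 0 < E0 by rewrite E0E mulr_gt0 // exprn_gt0.
have Kp : 0 < K by apply: lt_le_trans hK; exact: (addr_gt0 (ltr0n R 320) (mulr_gt0 (ltr0n R 2) t10)).
have C0p : 0 < C0 := divr_gt0 (ltr0n R 3) Omega0.
have E1p : 0 < 1000 + (E0 + 1) := addr_gt0 (ltr0n R 1000) (addr_gt0 E00 ltr01).
have mup : 0 < mu by rewrite muE; exact: mulr_gt0 (mulr_gt0 C0p Kp) E1p.
have T0 : 0 < T by rewrite TE; exact: divr_gt0 t10 (mulr_gt0 (ltr0n R 2) mup).
(* All constants that enter [T] are fixed before the datum: they involve [K0] and [tau0], besides
   the parameters of the problem. *)
exists T => // th0 m0 rv0 hth0.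
have hth00 : sumle (fun k => wt t1 k * normc (th0 k) ^+ 2) E0 by rewrite t1E E0E; exact: hc.
have [th [th0E hth]] := euler_limit t10 hK muE mup TE m0 rv0 hth00.
have TT t : 0 <= t < T -> 0 <= t <= T by move=> /andP[-> /ltW ->].
have zT : 0 <= (0 : R) <= T by rewrite lexx ltW.
move: hth; set b := (1000 + (E0 + 1)) / 2 => hth.
have b0 : 0 <= b := ltW (divr_gt0 E1p (ltr0n R 2)).
move: b b0 hth {hK muE TE E1p hc hth00} => b b0 hth.
pose G k := 2 * (C0 * b) ^+ 2 * (nm k + 1) * b.
have G0 k : 0 <= G k.
  rewrite /G; apply: mulr_ge0 b0; apply: mulr_ge0; last by rewrite addr_ge0 ?knorm_ge0.
  by apply: mulr_ge0 => //; exact: sqr_ge0.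
have ReE (y z w : R[i]) (d : R) : complex.Re (y - z + cR d * w) =
    complex.Re y - complex.Re z - d * (- complex.Re w).
  by case: y => ? ?; case: z => ? ?; case: w => ? ? /=; ring.
have ImE (y z w : R[i]) (d : R) : complex.Im (y - z + cR d * w) =
    complex.Im y - complex.Im z - d * (- complex.Im w).
  by case: y => ? ?; case: z => ? ?; case: w => ? ? /=; ring.
exists th; split; last by move=> t /TT/hth[].
split => //.
- by move=> t /TT/hth[].
- have sig0 : 0 < t1 / 2 by rewrite divr_gt0.
  have [c' c'0 hc'] := wt_to_gevrey rho0 r sig0.
  (* One halving of [t1] was spent during the evolution, the other pays for the power [2 * r]. *)
  move=> T' /andP[_ T'T]; exists (t1 / 2 / 2), (c' * (E0 + 1)); split; first by rewrite divr_gt0.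
  move=> t /andP[tp tT']; apply: hc'.
  have tT : 0 <= t <= T by rewrite tp (le_trans tT') // ltW.
  by have [] := hth _ tT.
- move=> k; rewrite -th0E; have [_ _ _ /(_ k)[v [_ hv]]] := hth _ zT.
  split.
    apply: (@cvg_right_quadratic _ (fun t => complex.Re (th t k)) (- complex.Re v) (G k) T) => // t tT.
    have := hv _ tT; rewrite !subr0; apply: le_trans.
    by apply: le_trans (ler_Re_normc _); rewrite ReE.
  apply: (@cvg_right_quadratic _ (fun t => complex.Im (th t k)) (- complex.Im v) (G k) T) => // t tT.
  have := hv _ tT; rewrite !subr0; apply: le_trans.
  by apply: le_trans (ler_Im_normc _); rewrite ImE.
move=> t tT k; have tT' : 0 <= t <= T by case/andP: tT => *; rewrite !ltW.
have [_ _ _ /(_ k)[v [hs hv]]] := hth _ tT'; exists v; split => //; split.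
  apply: (@is_derive_quadratic _ (fun t => complex.Re (th t k)) t _ (G k) T) => // t' t'T.
  apply: le_trans (hv _ t'T); apply: le_trans (ler_Re_normc _); by rewrite ReE.
apply: (@is_derive_quadratic _ (fun t => complex.Im (th t k)) t _ (G k) T) => // t' t'T.
apply: le_trans (hv _ t'T); apply: le_trans (ler_Im_normc _); by rewrite ImE.
Qed.

End Existence.

(** * Energy estimate for the difference of two solutions *)

Section DifferenceEstimate.
Variables (R : realType) (alpha beta eta Omega rho : R).
Local Notation normc := (@normc R).
Local Notation nm := (@knorm R).
Local Notation a_ := (acoef alpha beta eta Omega).
Local Notation tt := (transport_term alpha beta eta Omega).
Local Notation skew := (skew_term alpha beta eta Omega).
Local Notation C0 := (3 / Omega).
Local Notation wt := (@wt R rho).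
Local Notation g k := (powR (nm k) rho).
Hypotheses (beta0 : 0 < beta) (eta0 : 0 < eta) (Omega0 : 0 < Omega).
Hypotheses (rho0 : 0 < rho) (rho1 : rho <= 1).
Hypotheses (gam0 : 0 <= alpha + 1) (gamrho : alpha + 1 <= rho).

Let C0_ge0 : 0 <= C0. Proof. by rewrite divr_ge0 // ltW. Qed.
Let gam1 : alpha + 1 <= 1. Proof. exact: le_trans rho1. Qed.

(** Bilinearity, [v v - u u = u w + w v]: the first part is antisymmetric in [w], and in the second
    the gradient acts on [v]. *)
Lemma transport_term_diff (u v : fcoef R) (k l : Z3) :
  let w := fun m => v m - u m in
  complex.Re (conjc (w k) * (tt v k l - tt u k l)) =
  skew u w k l + complex.Re (conjc (w k) * (iu R * cR (a_ (zsub k l) l) * w (zsub k l) * v l)).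
Proof.
move=> w; rewrite /skew_term.
have ReD (x y : R[i]) : complex.Re x + complex.Re y = complex.Re (x + y).
  by case: x => ? ?; case: y.
by rewrite ReD; congr complex.Re; rewrite !transport_termE /w; ring.
Qed.

Variables (sig s E : R) (u v : fcoef R).
Hypotheses (s0 : 0 <= s) (ssig : 2 * s <= sig).
Hypotheses (ur : real_valued u) (u0 : mean_free u) (v0 : mean_free v).
Hypotheses (hu : sumle (fun k => wt sig k * normc (u k) ^+ 2) E).
Hypotheses (hv : sumle (fun k => wt sig k * normc (v k) ^+ 2) E).

Let w : fcoef R := fun k => v k - u k.
Let b := (1000 + E) / 2.
Let bw := (1000 + 4 * E) / 2.
Local Notation V := (Vfam rho s w).

Let sig0 : 0 <= sig. Proof. by apply: le_trans ssig; rewrite mulr_ge0. Qed.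
Let s_le : s <= sig. Proof. by apply: le_trans ssig; rewrite ler_peMl // ler1n. Qed.
Let w0 : mean_free w. Proof. by rewrite /mean_free /w u0 v0 subr0. Qed.

Let hw : sumle (fun k => wt sig k * normc (w k) ^+ 2) (4 * E).
Proof.
have -> : 4 * E = 2 * (E + E) by ring.
apply: sumle_le (sumleZ (ler0n R 2) (sumleD hu hv)) => k.
have -> : 2 * (wt sig k * normc (u k) ^+ 2 + wt sig k * normc (v k) ^+ 2) =
  wt sig k * (2 * (normc (u k) ^+ 2 + normc (v k) ^+ 2)) by ring.
apply: (ler_wpM2l (wt_ge0 _ _ _)).
have := normcB_le (v k) (u k); rewrite -/(w k).
have := normc_ge0 (w k); have := normc_ge0 (v k); have := normc_ge0 (u k).
move: (normc (w k)) (normc (v k)) (normc (u k)) => x y z z0' y0 x0 xyz.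
apply: (@le_trans _ _ ((y + z) ^+ 2)); first by rewrite lerXn2r ?nnegrE // addr_ge0.
by have := mul_le_half y z; nra.
Qed.

Let E0 : 0 <= E. Proof. exact: sumle_ge0 hu. Qed.
Let b_ge0 : 0 <= b. Proof. exact: divr_ge0 (addr_ge0 (ler0n R 1000) E0) (ler0n R 2). Qed.
Let bw_ge0 : 0 <= bw.
Proof. exact: divr_ge0 (addr_ge0 (ler0n R 1000) (mulr_ge0 (ler0n R 4) E0)) (ler0n R 2). Qed.

Let hB (x : fcoef R) : mean_free x -> sumle (fun k => wt sig k * normc (x k) ^+ 2) E ->
  sumle (Bfam rho s x) b.
Proof.
move=> x0 hx; apply: sumle_Bfam => //; apply: sumle_le hx => k.
by apply: (ler_wpM2r (sqr_ge0 _)); exact: wt_mono.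
Qed.

(** At radius [sig] the power 10 is available, more than [|k|^(1 + rho)]; the spare [|k|] is what
    gives decay outside boxes. *)
Let V_tail : sumle (fun k => nm k * V k ^+ 2) (4 * E).
Proof.
apply: sumle_le hw => k; have [->|k0] := eqVneq k z0.
  by rewrite knorm0 mul0r w0 normc0 expr0n mulr0.
have n1 := knorm_ge1 R k0; rewrite sqr_Vfam // mulrA mulrA.
apply: (ler_wpM2r (sqr_ge0 _)); apply: ler_pM; rewrite ?expR_ge0 //.
- by rewrite mulr_ge0 ?powR_ge0 ?knorm_ge0.
- apply: (@le_trans _ _ (nm k ^+ 2)); last by rewrite ler_weXn2l.
  rewrite expr2; apply: (ler_wpM2l (knorm_ge0 R k)); exact: powR_le_id.
- by rewrite ler_expR; apply: (ler_wpM2r (powR_ge0 _ _)); apply: ler_wpM2l.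
Qed.

(* The frequencies [l] outside the box [N] lack their antisymmetric partner; the decay of [w]
   makes their contribution [O(1/N)]. *)
Lemma difference_estimate (N M : nat) : (N <= M)%N ->
  `|\sum_(k <- boxseq N) expR (2 * s * g k) *
      \sum_(l <- boxseq M) complex.Re (conjc (w k) * (tt v k l - tt u k l))| <=
  C0 * (sig + 2) * b * (\sum_(k <- boxseq N) V k ^+ 2) +
  (C0 * (sig + 2) * b * (4 * E) + C0 * bw * b * bw) / N.+1%:R.
Proof.
move=> NM; set S := \sum_(k <- boxseq N) V k ^+ 2.
(* The convolution bounds need the sum of [V k ^+ 2] over all frequencies, which exceeds the box sum
   [S] by a tail. *)
pose z := S + 4 * E / N.+1%:R.
have hz : sumle (fun k => V k ^+ 2) z.
  apply: sumle_box_tail => [k|]; first exact: sqr_ge0.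
  by apply: sumle_tail => [k|]; [exact: sqr_ge0 | exact: V_tail].
have z_ge0 := sumle_ge0 hz.
have zz : (z + z) / 2 = z by field.
pose W k := expR (2 * s * g k).
pose dir k l := complex.Re (conjc (w k) * (iu R * cR (a_ (zsub k l) l) * w (zsub k l) * v l)).
pose t := [seq l <- boxseq M | l \notin boxseq N].
have ut : uniq t by rewrite filter_uniq ?uniq_boxseq.
(* Three parts: the antisymmetric pairs inside the box, the unpaired frequencies [l] between the two
   boxes, and the term with the gradient on [v]. *)
have -> : \sum_(k <- boxseq N) expR (2 * s * g k) *
      \sum_(l <- boxseq M) complex.Re (conjc (w k) * (tt v k l - tt u k l)) =
   \sum_(k <- boxseq N) \sum_(l <- boxseq N) W k * skew u w k l
   + \sum_(k <- boxseq N) \sum_(l <- t) W k * skew u w k l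
   + \sum_(k <- boxseq N) \sum_(l <- boxseq M) W k * dir k l.
  rewrite -!big_split; apply: eq_bigr => k _ /=.
  rewrite -!mulr_sumr -!mulrDr -(sum_sub_split (skew u w k) (uniq_boxseq N) (uniq_boxseq M) (boxseq_mono NM)).
  rewrite -big_split; congr (_ * _).
  by apply: eq_bigr => l _; rewrite transport_term_diff.
have -> : C0 * (sig + 2) * b * S +
    (C0 * (sig + 2) * b * (4 * E) + C0 * bw * b * bw) / N.+1%:R =
  C0 * sig * b * z + C0 * bw * b * (bw / N.+1%:R) + C0 * 2 * b * z.
  by rewrite /z; ring.
apply: le_trans (ler_normD _ _) _; apply: lerD; first apply: le_trans (ler_normD _ _) _.
apply: lerD.
- rewrite skew_sum // normrM ger0_norm ?invr_ge0 //.
  apply: (@le_trans _ _ (C0 * s * b * z)); last first.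
    apply: (ler_wpM2r z_ge0); apply: (ler_wpM2r b_ge0); exact: (ler_wpM2l C0_ge0).
  have -> : C0 * s * b * z = 2^-1 * (C0 * (2 * s) * (b * ((z + z) / 2))).
    by rewrite zz; field; rewrite (gt_eqF Omega0).
  rewrite ler_pM2l ?invr_gt0 //.
  apply: le_trans (ler_norm_sum _ _ _) _.
  apply: (@le_trans _ _ (\sum_(k <- boxseq N) \sum_(l <- boxseq N)
      C0 * (2 * s) * (Bfam rho s u (zsub k l) * V k * V l))).
    apply: ler_sum => k _; apply: le_trans (ler_norm_sum _ _ _) _.
    apply: ler_sum => l _; rewrite -[leRHS]mulrA.
    exact: (exp_skew_pair beta0 eta0 Omega0 rho0 rho1 gam0 gamrho k l s0 u0 w0).
  under eq_bigr do rewrite -mulr_sumr; rewrite -mulr_sumr.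
  apply: (ler_wpM2l (mulr_ge0 C0_ge0 (mulr_ge0 (ler0n R 2) s0))).
  by apply: (sum_conv_diff (uniq_boxseq N) (uniq_boxseq N) (Bfam_ge0 rho s u) (hB u0 hu) hz hz).
- apply: le_trans (ler_norm_sum _ _ _) _.
  have mu2 : moment2 b u by exact: (moment2_of_wt sig0 u0 hu).
  have mw : moment2 bw w by exact: (moment2_of_wt sig0 w0 hw).
  have hBw : sumle (Bfam rho sig w) bw by exact: sumle_Bfam.
  apply: (@le_trans _ _ (\sum_(k <- boxseq N) \sum_(l <- t)
     C0 * (Bfam rho sig w k * (nm (zsub k l) * normc (u (zsub k l)))) * (bw / N.+1%:R))).
    apply: ler_sum => k _; apply: le_trans (ler_norm_sum _ _ _) _.
    rewrite big_seq [leRHS]big_seq; apply: ler_sum => l; rewrite mem_filter => /andP[lN _].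
    rewrite normrM (ger0_norm (expR_ge0 _)).
    apply: le_trans (ler_wpM2l (expR_ge0 _) (skew_term_le _ _ _ _ _ _ _ _)) _.
    rewrite [leLHS]mulrA; apply: ler_pM; rewrite ?mulr_ge0 ?expR_ge0 ?normc_ge0 //; last first.
      rewrite ler_pdivlMr ?ltr0n // mulrC; apply: le_trans (moment1_le mw l).
      by apply: (ler_wpM2r (normc_ge0 _)); exact: knorm_notin_box.
    (* Without cancellation the full weight at radius [s] rests on [w k] alone. It is covered by the
       half weight at radius [sig], which is where [2 * s <= sig] is needed. *)
    have hBk : nm k * expR (2 * s * g k) * normc (w k) <= Bfam rho sig w k.
      rewrite /Bfam /Bs; apply: (ler_wpM2r (normc_ge0 _)).
      apply: ler_pM; rewrite ?knorm_ge0 ?expR_ge0 ?knorm_le_sqr //.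
      by rewrite ler_expR; apply: (ler_wpM2r (powR_ge0 _ _)).
    rewrite -acoef_zsub.
    have q0 : 0 <= normc (u (zsub k l)) * (expR (2 * s * g k) * normc (w k)).
      by rewrite mulr_ge0 ?normc_ge0 // mulr_ge0 ?normc_ge0 ?expR_ge0.
    have h1 := ler_wpM2r q0 (acoef_lin beta0 eta0 Omega0 gam1 (zsub k l) k).
    have q1 : 0 <= C0 * (nm (zsub k l) * normc (u (zsub k l))).
      by apply: (mulr_ge0 C0_ge0); rewrite mulr_ge0 ?knorm_ge0 ?normc_ge0.
    have h2 := ler_wpM2l q1 hBk; move: h1 h2.
    move: (nm (zsub k l)) (nm k) (expR (2 * s * g k)) (normc (u (zsub k l))) (normc (w k))
      (Bfam rho sig w k) C0 (`|a_ (zsub k l) k|).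
    move=> nj nk e xu xw B c a h1 h2.
    apply: le_trans (le_trans (le_trans _ h1) (le_trans _ h2)) _; apply: ler_of_eq; ring.
  under eq_bigr do rewrite -mulr_suml -mulr_sumr -mulr_sumr.
  rewrite -mulr_suml -mulr_sumr; apply: ler_wpM2r; first by rewrite divr_ge0.
  rewrite -[leRHS]mulrA; apply: (ler_wpM2l C0_ge0).
  apply: (@le_trans _ _ (\sum_(k <- boxseq N) Bfam rho sig w k * b)).
    apply: ler_sum => k _; apply: (ler_wpM2l (Bfam_ge0 _ _ _ _)).
    exact: (sumle_inj (@zsub_injl k) (moment1_sumle mu2)).
  by rewrite -mulr_suml; apply: (ler_wpM2r b_ge0); apply: hBw; exact: uniq_boxseq.
- apply: le_trans (ler_norm_sum _ _ _) _.
  have -> : C0 * 2 * b * z = C0 * 2 * (b * ((z + z) / 2)) by rewrite zz; ring.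
  apply: (@le_trans _ _ (\sum_(k <- boxseq N) \sum_(l <- boxseq M)
      C0 * 2 * (Bfam rho s v l * V (zsub k l) * V k))).
    apply: ler_sum => k _; apply: le_trans (ler_norm_sum _ _ _) _.
    apply: ler_sum => l _; rewrite -[leRHS]mulrA normrM (ger0_norm (expR_ge0 _)).
    have := exp_direct_term beta0 eta0 Omega0 rho0 rho1 gam0 gamrho k l s0 v0 w0.
    apply: le_trans; apply: (ler_wpM2l (expR_ge0 _)).
    apply: le_trans (ler_Re_normc _) _; rewrite !normcM normcC normc_iu mul1r normc_cR.
    by apply: ler_of_eq; ring.
  under eq_bigr do rewrite -mulr_sumr; rewrite -mulr_sumr.
  apply: (ler_wpM2l (mulr_ge0 C0_ge0 (ler0n R 2))).
  by apply: (sum_conv_inner (uniq_boxseq N) (uniq_boxseq M) (Bfam_ge0 rho s v) (hB v0 hv) hz hz).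
Qed.

End DifferenceEstimate.

(** * Derivatives and growth of weighted sums in time *)

Section DerivativeTools.
Variable R : realType.
Implicit Types (f : R -> R) (x a c : R).

Lemma is_derive_continuous f x df : is_derive x (1 : R) f df -> f y @[y --> x] --> f x.
Proof. by case=> /derivable1_diffP/differentiable_continuous. Qed.

Lemma growth_bound f a c C : a < c ->
  (forall x, a < x < c -> exists2 df, is_derive x (1 : R) f df & df <= C) ->
  f x @[x --> a^'+] --> f a -> f x @[x --> c] --> f c -> f c <= f a + C * (c - a).
Proof.
move=> ac hd fa fc.
have dE x : x \in `]a, c[ -> is_derive x (1 : R) f ('D_1 f x).
  by rewrite in_itv /= => /hd[df [h1 h2] _]; split.
have hc : {within `[a, c], continuous f}.
  apply/(continuous_within_itvP f ac); split => //; last exact: cvg_at_left_filter.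
  by move=> x /dE; exact: is_derive_continuous.
have [z zac e] := MVT ac dE hc.
have : f c - f a <= C * (c - a).
  rewrite e; apply: ler_wpM2r; first by rewrite subr_ge0 ltW.
  by have := zac; rewrite in_itv /= => /hd[df [_ ->]].
by rewrite lerBlDl.
Qed.

Lemma is_derive_sum_seq (I : Type) (s : seq I) (f : I -> R -> R) (df : I -> R) x :
  (forall k, is_derive x (1 : R) (f k) (df k)) ->
  is_derive x (1 : R) (fun y => \sum_(k <- s) f k y) (\sum_(k <- s) df k).
Proof.
move=> h; elim: s => [|k s IH].
  by rewrite big_nil; under eq_fun do rewrite big_nil; exact: is_derive_cst.
rewrite big_cons; under eq_fun do rewrite big_cons; exact: is_deriveD.
Qed.

Lemma is_derive_weight (A B t0 gk x : R) :
  is_derive x (1 : R) (fun y => expR (2 * (A - B * (y - t0)) * gk))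
    (- (2 * B * gk) * expR (2 * (A - B * (x - t0)) * gk)).
Proof.
pose L y : R := 2 * (A + B * t0) * gk + - (2 * B * gk) * y.
have LE y : 2 * (A - B * (y - t0)) * gk = L y by rewrite /L; ring.
under eq_fun do rewrite LE.
rewrite LE mulrC.
have hL : is_derive x (1 : R) L (- (2 * B * gk)).
  have h : is_derive x (1 : R) (cst (2 * (A + B * t0) * gk) + (- (2 * B * gk)) *: (id : R -> R))
      (0 + (- (2 * B * gk)) *: (1 : R)) by exact: is_deriveD.
  by apply: (is_derive_eq h); rewrite add0r /GRing.scale /= mulr1.
exact: (is_derive1_comp (is_derive_expR _) hL).
Qed.

Lemma is_derive_weighted_sqr (A B t0 gk x dp dq : R) (p q : R -> R) :
  is_derive x (1 : R) p dp -> is_derive x (1 : R) q dq ->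
  is_derive x (1 : R)
    (fun y => expR (2 * (A - B * (y - t0)) * gk) * (p y ^+ 2 + q y ^+ 2))
    (- (2 * B) * (gk * (expR (2 * (A - B * (x - t0)) * gk) * (p x ^+ 2 + q x ^+ 2)))
     + 2 * (expR (2 * (A - B * (x - t0)) * gk) * (p x * dp + q x * dq))).
Proof.
move=> hp hq.
have h := is_deriveM (is_derive_weight A B t0 gk x) (is_deriveD (is_deriveM hp hp) (is_deriveM hq hq)).
apply: (is_derive_eq h); rewrite /GRing.scale /= ?fctE /=.
by move: (expR _) => e; ring.
Qed.

Lemma cvg_weighted_sqr (F : set_system R) (e p q : R -> R) (a b c : R) : Filter F ->
  e x @[x --> F] --> a -> p x @[x --> F] --> b -> q x @[x --> F] --> c ->
  e x * (p x ^+ 2 + q x ^+ 2) @[x --> F] --> a * (b ^+ 2 + c ^+ 2).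
Proof. by move=> FF ea pb qc; rewrite !expr2; apply: cvgM ea (cvgD (cvgM pb pb) (cvgM qc qc)). Qed.

End DerivativeTools.

(** * Uniqueness on successive short intervals *)

Section Uniqueness.
Variables (R : realType) (alpha beta eta Omega rho : R).
Local Notation normc := (@normc R).
Local Notation nm := (@knorm R).
Local Notation tt := (transport_term alpha beta eta Omega).
Local Notation C0 := (3 / Omega).
Local Notation wt := (@wt R rho).
Local Notation g k := (powR (nm k) rho).
Hypotheses (beta0 : 0 < beta) (eta0 : 0 < eta) (Omega0 : 0 < Omega).
Hypotheses (rho0 : 0 < rho) (rho1 : rho <= 1).
Hypotheses (gam0 : 0 <= alpha + 1) (gamrho : alpha + 1 <= rho).

(** The bound of [difference_estimate] is uniform in the inner box [M], so it survives the limit to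
    the full nonlinearities. *)
Lemma difference_estimate_lim (sig s E : R) (u v du dv : fcoef R) (N : nat) :
  0 <= s -> 2 * s <= sig -> real_valued u -> mean_free u -> mean_free v ->
  sumle (fun k => wt sig k * normc (u k) ^+ 2) E ->
  sumle (fun k => wt sig k * normc (v k) ^+ 2) E ->
  (forall k, series_to (tt u k) (du k)) -> (forall k, series_to (tt v k) (dv k)) ->
  `|\sum_(k <- boxseq N) expR (2 * s * g k) * complex.Re (conjc (v k - u k) * (dv k - du k))| <=
  C0 * (sig + 2) * ((1000 + E) / 2) *
    (\sum_(k <- boxseq N) Vfam rho s (fun k => v k - u k) k ^+ 2) +
  (C0 * (sig + 2) * ((1000 + E) / 2) * (4 * E) +
   C0 * ((1000 + 4 * E) / 2) * ((1000 + E) / 2) * ((1000 + 4 * E) / 2)) / N.+1%:R.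
Proof.
move=> s0 ssig ur u0 v0 hu hv hdu hdv; pose w k := v k - u k.
have est M := @difference_estimate R alpha beta eta Omega rho beta0 eta0 Omega0 rho0 rho1 gam0
  gamrho sig s E u v s0 ssig ur u0 v0 hu hv N M.
set RHS := (X in _ <= X).
pose F M := \sum_(k <- boxseq N) expR (2 * s * g k) *
  complex.Re (conjc (w k) * (\sum_(l <- boxseq M) tt v k l - \sum_(l <- boxseq M) tt u k l)).
have hF : F @ \oo --> \sum_(k <- boxseq N) expR (2 * s * g k) *
    complex.Re (conjc (w k) * (dv k - du k)).
  apply: cvg_sum_seq => k; apply: cvgMr.
  have : ccvg \oo (fun M => conjc (w k) *
     (\sum_(l <- boxseq M) tt v k l + - \sum_(l <- boxseq M) tt u k l))
     (conjc (w k) * (dv k + - du k)).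
    apply: ccvgM (ccvg_cst _) _; apply: ccvgD; first exact: hdv.
    by apply: ccvgN; exact: hdu.
  by case.
apply: (cvgr_to_le (cvg_norm hF)); exists N => // M /= NM.
apply: le_trans (est M NM); apply: ler_of_eq; congr `| _ |; apply: eq_bigr => k _.
by congr (_ * _); rewrite -sumrB mulr_sumr Re_sum.
Qed.

Section TwoSolutions.
Variables (T T' sig E : R) (th th' : R -> fcoef R).
Hypotheses (T'T : T' < T) (sig0 : 0 < sig).
Hypotheses (thr : forall t, 0 <= t <= T' -> real_valued (th t)).
Hypotheses (th0 : forall t, 0 <= t <= T' -> mean_free (th t)).
Hypotheses (th0' : forall t, 0 <= t <= T' -> mean_free (th' t)).
Hypotheses (hE : forall t, 0 <= t <= T' -> sumle (fun k => wt sig k * normc (th t k) ^+ 2) E).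
Hypotheses (hE' : forall t, 0 <= t <= T' -> sumle (fun k => wt sig k * normc (th' t k) ^+ 2) E).

Let rcont (x : R -> fcoef R) := forall t, 0 <= t < T -> forall k,
  (fun t => complex.Re (x t k)) y @[y --> t^'+] --> complex.Re (x t k) /\
  (fun t => complex.Im (x t k)) y @[y --> t^'+] --> complex.Im (x t k).
Let solves (x : R -> fcoef R) := forall t, 0 < t < T -> forall k, exists v : R[i],
  series_to (tt (x t) k) v /\
  is_derive t (1 : R) (fun t' => complex.Re (x t' k)) (- complex.Re v) /\
  is_derive t (1 : R) (fun t' => complex.Im (x t' k)) (- complex.Im v).
Hypotheses (rth : rcont th) (rth' : rcont th') (sth : solves th) (sth' : solves th').

(** [nu] is the coefficient of the dissipation in the difference estimate. A radius shrinking at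
    this rate from [sig / 2] cancels that term exactly, and only [Cst / N.+1] remains. *)
Let nu := C0 * (sig + 2) * ((1000 + E) / 2).
Let Cst := C0 * (sig + 2) * ((1000 + E) / 2) * (4 * E) +
   C0 * ((1000 + 4 * E) / 2) * ((1000 + E) / 2) * ((1000 + 4 * E) / 2).

Let w t k : R[i] := th' t k - th t k.
Let p k t : R := complex.Re (th' t k) - complex.Re (th t k).
Let q k t : R := complex.Im (th' t k) - complex.Im (th t k).
Let weighted t0 N t := \sum_(k <- boxseq N)
  expR (2 * (sig / 2 - nu * (t - t0)) * g k) * (p k t ^+ 2 + q k t ^+ 2).

Let pq_cabs2 k t : p k t ^+ 2 + q k t ^+ 2 = normc (w t k) ^+ 2.
Proof.
by rewrite sqr_normc_cabs2 /w /p /q; case: (th' t k) => ? ?; case: (th t k).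
Qed.

Let weighted_derive t0 N t : 0 <= t0 -> t0 < t < T' -> 0 <= sig / 2 - nu * (t - t0) -> 0 <= nu ->
  exists2 dy, is_derive t (1 : R) (weighted t0 N) dy & dy <= 2 * Cst / N.+1%:R.
Proof.
move=> t00 /andP[t0t tT'] s0 nu0.
have tpos : 0 < t by exact: le_lt_trans t0t.
have tT : 0 < t < T by rewrite tpos (lt_trans tT').
have tTc : 0 <= t <= T' by rewrite !ltW.
pose e k := expR (2 * (sig / 2 - nu * (t - t0)) * g k).
have [du hdu] : {du : fcoef R & forall k, series_to (tt (th t) k) (du k) /\
   is_derive t (1 : R) (fun t' => complex.Re (th t' k)) (- complex.Re (du k)) /\
   is_derive t (1 : R) (fun t' => complex.Im (th t' k)) (- complex.Im (du k))}.
  by apply: (@choice _ _ (fun k v => series_to (tt (th t) k) v /\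
    is_derive t (1 : R) (fun t' => complex.Re (th t' k)) (- complex.Re v) /\
    is_derive t (1 : R) (fun t' => complex.Im (th t' k)) (- complex.Im v))); exact: sth.
have [dv hdv] : {dv : fcoef R & forall k, series_to (tt (th' t) k) (dv k) /\
   is_derive t (1 : R) (fun t' => complex.Re (th' t' k)) (- complex.Re (dv k)) /\
   is_derive t (1 : R) (fun t' => complex.Im (th' t' k)) (- complex.Im (dv k))}.
  by apply: (@choice _ _ (fun k v => series_to (tt (th' t) k) v /\
    is_derive t (1 : R) (fun t' => complex.Re (th' t' k)) (- complex.Re v) /\
    is_derive t (1 : R) (fun t' => complex.Im (th' t' k)) (- complex.Im v))); exact: sth'.
exists (\sum_(k <- boxseq N) (- (2 * nu) * (g k * (e k * (p k t ^+ 2 + q k t ^+ 2))) +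
    2 * (e k * (p k t * (- complex.Re (dv k) - - complex.Re (du k)) +
                q k t * (- complex.Im (dv k) - - complex.Im (du k)))))).
  apply: is_derive_sum_seq => k; have [_ [u1 u2]] := hdu k; have [_ [v1 v2]] := hdv k.
  by apply: is_derive_weighted_sqr; exact: is_deriveB.
rewrite big_split /= -!mulr_sumr.
have ssig : 2 * (sig / 2 - nu * (t - t0)) <= sig.
  have : 0 <= nu * (t - t0) by rewrite mulr_ge0 // subr_ge0 ltW.
  by move: (nu * (t - t0)) => m m0; lra.
have := @difference_estimate_lim sig _ E (th t) (th' t) du dv N s0 ssig (thr tTc) (th0 tTc)
  (th0' tTc) (hE tTc) (hE' tTc) (fun k => (hdu k).1) (fun k => (hdv k).1).
have -> : \sum_(k <- boxseq N) Vfam rho (sig / 2 - nu * (t - t0)) (fun k => th' t k - th t k) k ^+ 2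
  = \sum_(k <- boxseq N) g k * (e k * (p k t ^+ 2 + q k t ^+ 2)).
  apply: eq_bigr => k _; rewrite sqr_Vfam ?pq_cabs2 //.
  by rewrite /mean_free th0 // th0' // subr0.
have -> : \sum_(k <- boxseq N) expR (2 * (sig / 2 - nu * (t - t0)) * g k) *
     complex.Re (conjc (th' t k - th t k) * (dv k - du k)) =
  - \sum_(k <- boxseq N) e k * (p k t * (- complex.Re (dv k) - - complex.Re (du k)) +
                q k t * (- complex.Im (dv k) - - complex.Im (du k))).
  rewrite -sumrN; apply: eq_bigr => k _; rewrite -/(e k) -mulrN; congr (_ * _).
  rewrite /p /q; case: (th' t k) => ? ?; case: (th t k) => ? ?.
  by case: (dv k) => ? ?; case: (du k) => ? ? /=; ring.
rewrite normrN -/nu -/Cst => /(le_trans (ler_norm _)).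
rewrite -[2 * Cst / _]mulrA.
move: (Cst / _) nu (\sum_(k <- boxseq N) g k * _) (\sum_(k <- boxseq N) e k * _) => a n S A h.
by nra.
Qed.

Let weighted_cont t0 N t : 0 < t < T -> weighted t0 N x @[x --> t] --> weighted t0 N t.
Proof.
move=> tT.
suff [dy hy] : exists dy, is_derive t (1 : R) (weighted t0 N) dy by exact: is_derive_continuous hy.
have [d hd] : {d : Z3 -> R & forall k, is_derive t (1 : R) (fun t =>
  expR (2 * (sig / 2 - nu * (t - t0)) * g k) * (p k t ^+ 2 + q k t ^+ 2)) (d k)}.
  apply: (@choice _ _ (fun k d => is_derive t (1 : R) (fun t =>
    expR (2 * (sig / 2 - nu * (t - t0)) * g k) * (p k t ^+ 2 + q k t ^+ 2)) d)) => k.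
  have [v [_ [v1 v2]]] := sth tT k; have [v' [_ [v1' v2']]] := sth' tT k.
  eexists; apply: is_derive_weighted_sqr; exact: is_deriveB.
by eexists; apply: is_derive_sum_seq hd.
Qed.

Let weighted_rcont t0 N : 0 <= t0 < T ->
  weighted t0 N x @[x --> t0^'+] --> weighted t0 N t0.
Proof.
move=> t0T.
have h k : (fun t => expR (2 * (sig / 2 - nu * (t - t0)) * g k) * (p k t ^+ 2 + q k t ^+ 2)) x
   @[x --> t0^'+] --> expR (2 * (sig / 2 - nu * (t0 - t0)) * g k) * (p k t0 ^+ 2 + q k t0 ^+ 2).
  have [a1 a2] := rth t0T k; have [b1 b2] := rth' t0T k.
  have c1 : p k x @[x --> t0^'+] --> p k t0 by exact: cvgB b1 a1.
  have c2 : q k x @[x --> t0^'+] --> q k t0 by exact: cvgB b2 a2.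
  apply: (@cvg_weighted_sqr R _ (fun y => expR (2 * (sig / 2 - nu * (y - t0)) * g k))
    (p k) (q k) _ _ _ _ _ c1 c2).
  exact: cvg_at_right_filter (is_derive_continuous (is_derive_weight (sig / 2) nu t0 (g k) t0)).
rewrite /weighted; elim: (boxseq N) => [|k l IH].
  by rewrite big_nil; under eq_fun do rewrite big_nil; exact: cvg_cst.
by rewrite big_cons; under eq_fun do rewrite big_cons; exact: cvgD.
Qed.

(** [weighted] starts at 0 and is [O(1/N)] at time [t]. As long as its radius is nonnegative it
    dominates each squared coefficient of the difference, which is therefore 0. *)
Let step_unique t0 t : 0 <= t0 -> t0 < t <= T' -> 0 <= nu -> nu * (t - t0) <= sig / 2 ->
  th' t0 = th t0 -> th' t = th t.
Proof.
move=> t00 /andP[t0t tT'] nu0 hnu e0; apply/funext => k.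
have t0T : 0 <= t0 < T by rewrite t00 (lt_trans t0t) // (le_lt_trans tT').
have tT : 0 < t < T by rewrite (le_lt_trans t00) // (le_lt_trans tT').
have wz N : weighted t0 N t0 = 0.
  rewrite /weighted big1 // => l _.
  have wl0 : w t0 l = 0 by rewrite /w e0 subrr.
  by rewrite pq_cabs2 wl0 normc0 expr0n mulr0.
have hN N : weighted t0 N t <= 2 * Cst * (t - t0) / N.+1%:R.
  have hd x : t0 < x < t ->
      exists2 dy, is_derive x (1 : R) (weighted t0 N) dy & dy <= 2 * Cst / N.+1%:R.
    move=> /andP[t0x xt]; apply: weighted_derive => //.
      by rewrite t0x (lt_le_trans xt).
    rewrite subr_ge0; apply: le_trans hnu; apply: ler_wpM2l => //.
    by rewrite lerD2r ltW.
  have := growth_bound t0t hd (@weighted_rcont t0 N t0T) (@weighted_cont t0 N t tT).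
  by rewrite wz add0r => /le_trans; apply; apply: ler_of_eq; ring.
have hk N : k \in boxseq N -> normc (w t k) ^+ 2 <= 2 * Cst * (t - t0) / N.+1%:R.
  move=> kN; apply: le_trans (hN N).
  have pos l : 0 <= expR (2 * (sig / 2 - nu * (t - t0)) * g l) * (p l t ^+ 2 + q l t ^+ 2).
    by rewrite pq_cabs2; apply: mulr_ge0 (expR_ge0 _) (sqr_ge0 _).
  have sub : {subset [:: k] <= boxseq N} by move=> l; rewrite inE => /eqP ->.
  have := @ler_sum_sub R _ [:: k] (boxseq N) pos isT (uniq_boxseq N) sub.
  rewrite big_seq1 => /(le_trans _); apply.
  rewrite pq_cabs2 ler_peMl ?sqr_ge0 // -[leLHS]expR0 ler_expR.
  have s0 : 0 <= sig / 2 - nu * (t - t0) by rewrite subr_ge0.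
  exact: mulr_ge0 (mulr_ge0 (ler0n R 2) s0) (powR_ge0 _ _).
have w20 : normc (w t k) ^+ 2 <= 0.
  apply: (@cvgr_to_ge _ \oo _ _ (fun N => 2 * Cst * (t - t0) * harmonic N)).
    by rewrite -[X in _ --> X](mulr0 (2 * Cst * (t - t0))); apply: cvgMr; exact: cvg_harmonic.
  by apply: filterS (in_boxseq_near k) => N /hk.
have wk0 : normc (w t k) = 0.
  by apply/eqP; rewrite -sqrf_eq0; apply/eqP/le_anti; rewrite w20 sqr_ge0.
by apply/eqP; rewrite -subr_eq0; apply/eqP; exact: eq0_normc wk0.
Qed.

(** Both solutions keep radius [sig] and bound [E] on all of [[0, T']], so every restart begins
    again at [sig / 2], and steps of the fixed length [d] exhaust the interval. *)
Lemma solutions_agree : th' 0 = th 0 -> forall t, 0 <= t <= T' -> th' t = th t.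
Proof.
move=> e0.
have [T'0|T'0] := leP 0 T'; last first.
  by move=> t /andP[a1 a2]; have := le_lt_trans (le_trans a1 a2) T'0; rewrite ltxx.
have zT : 0 <= (0 : R) <= T' by rewrite lexx.
have E0 : 0 <= E by exact: sumle_ge0 (hE zT).
have nu0 : 0 < nu.
  apply: mulr_gt0; first apply: mulr_gt0; first exact: divr_gt0 (ltr0n R 3) Omega0.
    exact: addr_gt0 sig0 (ltr0n R 2).
  exact: divr_gt0 (ltr_pwDl (ltr0n R 1000) E0) (ltr0n R 2).
pose d := sig / 2 / nu.
have d0 : 0 < d by rewrite !divr_gt0.
have H (n : nat) t : 0 <= t <= T' -> t <= n%:R * d -> th' t = th t.
  elim: n t => [|n IH] t /andP[tp tT'].
    by rewrite mul0r => t0; have -> : t = 0 by apply/le_anti; rewrite t0.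
  move=> tn; have [tnd|ndt] := leP t (n%:R * d); first by apply: IH => //; rewrite tp.
  have nd0 : 0 <= n%:R * d by rewrite mulr_ge0 // ltW.
  apply: (@step_unique (n%:R * d)) => //; [by rewrite ndt|exact: ltW| |].
    have -> : sig / 2 = nu * d by rewrite /d [RHS]mulrC divfK ?gt_eqF.
    apply: (ler_wpM2l (ltW nu0)); rewrite lerBlDl; apply: le_trans tn _.
    by rewrite -natr1 mulrDl mul1r.
  by apply: IH; rewrite ?lexx // nd0 (le_trans (ltW ndt)).
move=> t tT'; apply: (H (Num.truncn (t / d)).+1 _ tT').
by rewrite -ler_pdivrMr // ltW // truncnS_gt.
Qed.

End TwoSolutions.

Lemma MG_uniqueness (r T : R) (th0 : fcoef R) (th th' : R -> fcoef R) : 0 <= r ->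
  MG_solution_Gs alpha beta eta Omega r rho^-1 T th0 th ->
  MG_solution_Gs alpha beta eta Omega r rho^-1 T th0 th' ->
  (forall t, 0 <= t < T -> real_valued (th t)) ->
  forall t, 0 <= t < T -> th' t = th t.
Proof.
move=> r0 [i1 m1 b1 c1 d1] [i2 m2 b2 c2 d2] thr t0 /andP[t00 t0T].
(* A radius and a bound uniform in time are available only up to times before [T], so a time between
   [t0] and [T] is fixed. *)
pose T' := (t0 + T) / 2.
have T'T : T' < T by rewrite /T'; lra.
have t0T' : t0 <= T' by rewrite /T'; lra.
have T'0 : 0 < T' by rewrite /T'; lra.
have TT t : 0 <= t <= T' -> 0 <= t < T by move=> /andP[-> h] /=; apply: le_lt_trans T'T.
have [ta [Ba [ta0 ha]]] := b1 T' (introT andP (conj T'0 T'T)).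
have [tb [Bb [tb0 hb]]] := b2 T' (introT andP (conj T'0 T'T)).
have [ca ca0 hca] := gevrey_to_wt rho0 r0 ta0.
have [cb cb0 hcb] := gevrey_to_wt rho0 r0 tb0.
pose sig := Num.min (ta / 2) (tb / 2); pose E := Num.max (ca * Ba) (cb * Bb).
have sig0 : 0 < sig by rewrite lt_min !divr_gt0.
have h1 t : 0 <= t <= T' -> sumle (fun k => wt sig k * normc (th t k) ^+ 2) E.
  move=> tT; apply: (@sumle_leC _ _ (ca * Ba)); first by rewrite le_max lexx.
  apply: sumle_le (hca _ _ (m1 _ (TT _ tT)) (ha _ tT)) => k.
  by apply: (ler_wpM2r (sqr_ge0 _)); apply: wt_mono; rewrite ge_min lexx.
have h2 t : 0 <= t <= T' -> sumle (fun k => wt sig k * normc (th' t k) ^+ 2) E.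
  move=> tT; apply: (@sumle_leC _ _ (cb * Bb)); first by rewrite le_max lexx orbT.
  apply: sumle_le (hcb _ _ (m2 _ (TT _ tT)) (hb _ tT)) => k.
  by apply: (ler_wpM2r (sqr_ge0 _)); apply: wt_mono; rewrite ge_min lexx orbT.
(* Right continuity comes from the initial condition at time 0 and from differentiability
   afterwards; it allows each short interval to start at any [t0], including 0. *)
have rcont (x : R -> fcoef R) : x 0 = th0 ->
    (forall k, (fun t => complex.Re (x t k)) t @[t --> 0^'+] --> complex.Re (th0 k) /\
               (fun t => complex.Im (x t k)) t @[t --> 0^'+] --> complex.Im (th0 k)) ->
    (forall t, 0 < t < T -> forall k, exists v : R[i], series_to (tt (x t) k) v /\
       is_derive t (1 : R) (fun t' => complex.Re (x t' k)) (- complex.Re v) /\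
       is_derive t (1 : R) (fun t' => complex.Im (x t' k)) (- complex.Im v)) ->
    forall t, 0 <= t < T -> forall k,
      (fun t => complex.Re (x t k)) y @[y --> t^'+] --> complex.Re (x t k) /\
      (fun t => complex.Im (x t k)) y @[y --> t^'+] --> complex.Im (x t k).
  move=> x0 xc xd t /andP[tp tT] k; move: tp; rewrite le_eqVlt => /predU1P[<-|tp].
    by rewrite x0; exact: xc.
  have [v [_ [v1 v2]]] := xd t (introT andP (conj tp tT)) k.
  by split; apply: cvg_at_right_filter; [exact: is_derive_continuous v1|exact: is_derive_continuous v2].
apply: (@solutions_agree T T' sig E th th') => //.
- by move=> t /TT; exact: thr.
- by move=> t /TT; exact: m1.
- by move=> t /TT; exact: m2.
- exact: rcont.
- exact: rcont.
- by rewrite i1.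
- by rewrite t00.
Qed.

End Uniqueness.

Theorem theorem5p1 (R : realType) (beta eta Omega : R)
  (hbeta : 0 < beta) (heta : 0 < eta) (hOmega : 0 < Omega)
  (alpha s r K0 tau0 : R)
  (hcase : (-1 < alpha <= 0 /\ 1 <= s <= (alpha + 1)^-1) \/
           (alpha = -1 /\ 1 <= s))
  (hr : 3 < r) (hK0 : 0 < K0) (htau0 : 0 < tau0) :
  exists Tstar : R, 0 < Tstar /\
    forall th0 : fcoef R,
      mean_free th0 -> real_valued th0 ->
      (gevrey_norm2 r s tau0 th0 <= (K0 ^+ 2)%:E)%E ->
      exists th : R -> fcoef R,
        MG_solution_Gs alpha beta eta Omega r s Tstar th0 th /\
        forall th' : R -> fcoef R,
          MG_solution_Gs alpha beta eta Omega r s Tstar th0 th' ->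
          forall t, 0 <= t < Tstar -> th' t = th t.
Proof.
have s1 : 1 <= s by case: hcase => [[_ /andP[]]|[]].
have s0 : 0 < s by exact: lt_le_trans s1.
have [gam0 gams] : 0 <= alpha + 1 /\ alpha + 1 <= s^-1.
  case: hcase => [[/andP[a1 _] /andP[_ hs]]|[-> _]].
    have a0 : 0 < alpha + 1 by lra.
    by split; [exact: ltW | rewrite -[alpha + 1]invrK lef_pV2 ?posrE ?invr_gt0].
  by rewrite addNr lexx invr_ge0 ltW.
have sinv0 : 0 < s^-1 by rewrite invr_gt0.
have sinv1 : s^-1 <= 1 by rewrite invf_le1.
have r0 : 0 <= r by lra.
have [T T0 hT] := MG_existence hbeta heta hOmega sinv0 sinv1 gam0 gams r0 htau0 hK0.
rewrite invrK in hT; exists T; split; first exact: T0.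
move=> th0 m0 rv0 hth0.
have [th [hth thr]] := hT th0 m0 rv0 hth0.
exists th; split; first exact: hth.
move=> th' hth'.
have := @MG_uniqueness R alpha beta eta Omega s^-1 hbeta heta hOmega sinv0 sinv1 gam0 gams
  r T th0 th th' r0.
by rewrite invrK => /(_ hth hth' thr).
Qed.
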